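(* Every pseudo-solvable subgroup $G$ of $\widehat{\mathrm{Diff}}_1(\mathbb{C}^2,0)$ is solvable.
   Context: $\widehat{\mathrm{Diff}}_1(\mathbb{C}^2,0)$ is the group (under composition) of formal diffeomorphisms of $(\mathbb{C}^2,0)$ tangent to the identity, i.e. pairs $(F_1,F_2)$ of formal power series in $\mathbb{C}[[x,y]]$ with $F_1=x+\text{(terms of degree}\ge2)$ and $F_2=y+\text{(terms of degree}\ge2)$. Commutators are $[g_1,g_2]=g_1\circ g_2\circ g_1^{-1}\circ g_2^{-1}$. Given a group $G$ with a finite generating set $S$, define sets $S(j)\subseteq G$ by $S(0)=S$ and by letting $S(j+1)$ be the set of all commutators $[F_1^{\pm1},F_2^{\pm1}]$ with $F_1\in S(j)$ and $F_2\in S(j)\cup S(j-1)$ ($F_2\in S(0)$ if $j=0$). The group $G$ is pseudo-solvable if it admits a finite generating set $S$ such that $S(j)$ is reduced to the identity for all $j$ large enough. *)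

(* Defs.v *)
From HB Require Import structures.
From mathcomp Require Import all_boot all_order all_algebra.
From mathcomp Require Import boolp classical_sets functions cardinality reals.
From mathcomp Require Import complex.

Set Implicit Arguments.
Unset Strict Implicit.
Unset Printing Implicit Defensive.

Import GRing.Theory.
Local Open Scope ring_scope.

(* K[[x, y]] : [F i j] is the coefficient of x^i y^j. *)
Definition fps2 (K : Type) := nat -> nat -> K.

HB.instance Definition _ (K : zmodType) :=
  GRing.Zmodule.copy (fps2 K) (nat -> nat -> K).

Section Fps2Ring.
Variable K : comNzRingType.
Implicit Types F G H : fps2 K.

Definition fps2_one : fps2 K := fun i j => ((i == 0%N) && (j == 0%N))%:R.

Definition fps2_mul F G : fps2 K := fun i j =>
  \sum_(a < i.+1) \sum_(b < j.+1) F a b * G (i - a)%N (j - b)%N.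

Lemma fps2P F G : (forall i j, F i j = G i j) -> F = G.
Proof. by move=> e; apply/funext => i; apply/funext => j. Qed.

Lemma fps2_addE F G i j : (F + G) i j = F i j + G i j.
Proof. by []. Qed.

Lemma fps2_oppE F i j : (- F) i j = - F i j.
Proof. by []. Qed.

Lemma fps2_0E i j : (0 : fps2 K) i j = 0.
Proof. by []. Qed.

Definition fps2_of_poly (p : {poly {poly K}}) : fps2 K := fun i j => p`_i`_j.

Definition fps2_trunc n F : {poly {poly K}} :=
  \poly_(i < n) \poly_(j < n) F i j.

Lemma fps2_truncE n F i j : (i < n)%N -> (j < n)%N ->
  fps2_of_poly (fps2_trunc n F) i j = F i j.
Proof. by move=> hi hj; rewrite /fps2_of_poly coef_poly hi coef_poly hj. Qed.

Lemma fps2_of_polyM p q :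
  fps2_of_poly (p * q) = fps2_mul (fps2_of_poly p) (fps2_of_poly q).
Proof.
apply: fps2P => i j; rewrite /fps2_of_poly coefM coef_sum.
by apply: eq_bigr => a _; rewrite coefM.
Qed.

Lemma fps2_mul_local n F F' G G' :
  (forall i j, (i < n)%N -> (j < n)%N -> F i j = F' i j) ->
  (forall i j, (i < n)%N -> (j < n)%N -> G i j = G' i j) ->
  forall i j, (i < n)%N -> (j < n)%N -> fps2_mul F G i j = fps2_mul F' G' i j.
Proof.
move=> eF eG i j hi hj; apply: eq_bigr => a _; apply: eq_bigr => b _.
have ha : (a < n)%N by apply: leq_ltn_trans hi; rewrite -ltnS.
have hb : (b < n)%N by apply: leq_ltn_trans hj; rewrite -ltnS.
by rewrite eF // eG //; apply: leq_ltn_trans (leq_subr _ _) _.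
Qed.

Lemma fps2_mulA : associative fps2_mul.
Proof.
move=> F G H; apply: fps2P => i j.
set n := (i + j).+1.
have hi : (i < n)%N by rewrite ltnS leq_addr.
have hj : (j < n)%N by rewrite ltnS leq_addl.
pose T E := fps2_of_poly (fps2_trunc n E).
have tE E : forall a b, (a < n)%N -> (b < n)%N -> E a b = T E a b.
  by move=> a b ha hb; rewrite /T fps2_truncE.
have := @fps2_mul_local n F (T F) (fps2_mul G H) (fps2_mul (T G) (T H)) (tE F)
  (fps2_mul_local (tE G) (tE H)) i j hi hj.
have := @fps2_mul_local n (fps2_mul F G) (fps2_mul (T F) (T G)) H (T H)
  (fps2_mul_local (tE F) (tE G)) (tE H) i j hi hj.
by move=> -> ->; rewrite /T -!fps2_of_polyM mulrA.
Qed.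

Lemma fps2_mulC : commutative fps2_mul.
Proof.
move=> F G; apply: fps2P => i j.
rewrite /fps2_mul [LHS](reindex_inj rev_ord_inj); apply: eq_bigr => a _.
rewrite [LHS](reindex_inj rev_ord_inj); apply: eq_bigr => b _ /=.
by rewrite !subSS !(subKn (leq_ord _)) mulrC.
Qed.

Lemma fps2_mul1 : left_id fps2_one fps2_mul.
Proof.
move=> F; apply: fps2P => i j.
rewrite /fps2_mul big_ord_recl big_ord_recl /= /fps2_one /= mul1r !subn0.
rewrite big1 ?addr0 => [|b _]; last by rewrite mul0r.
by rewrite big1 ?addr0 // => a _; rewrite big1 // => b _; rewrite mul0r.
Qed.

Lemma fps2_mulDl : left_distributive fps2_mul +%R.
Proof.
move=> F G H; apply: fps2P => i j.
rewrite fps2_addE /fps2_mul -big_split; apply: eq_bigr => a _.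
by rewrite -big_split; apply: eq_bigr => b _; rewrite fps2_addE mulrDl.
Qed.

Lemma fps2_oner_neq0 : fps2_one != 0.
Proof.
apply/eqP => /(congr1 (fun F : fps2 K => F 0%N 0%N)).
by rewrite /fps2_one fps2_0E; apply/eqP; exact: oner_neq0.
Qed.

End Fps2Ring.

HB.instance Definition _ (K : comNzRingType) :=
  GRing.Zmodule_isComNzRing.Build (fps2 K) (@fps2_mulA K) (@fps2_mulC K)
    (@fps2_mul1 K) (@fps2_mulDl K) (@fps2_oner_neq0 K).

Section Composition.
Variable K : comNzRingType.
Implicit Types (F H : fps2 K) (G : fps2 K * fps2 K) (p : {poly {poly K}}).

Definition fps2_x : fps2 K := fun i j => ((i == 1%N) && (j == 0%N))%:R.
Definition fps2_y : fps2 K := fun i j => ((i == 0%N) && (j == 1%N))%:R.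

(* [F] has no term of total degree less than [n] *)
Definition fps2_ord n F := forall i j, (i + j < n)%N -> F i j = 0.

(* F(G_1, G_2), for [G.1] and [G.2] without constant term: then G_1^a G_2^b has
   no term of degree less than a + b, so that only the indices a, b <= i + j
   contribute to the coefficient of x^i y^j. *)
Definition fps2_comp F G : fps2 K := fun i j =>
  \sum_(a < (i + j).+1) \sum_(b < (i + j).+1)
    F a b * (G.1 ^+ a * G.2 ^+ b) i j.

Definition tangent_to_id G := fps2_ord 2 (G.1 - fps2_x) /\ fps2_ord 2 (G.2 - fps2_y).

Lemma fps2_sumE I (r : seq I) (P : pred I) (f : I -> fps2 K) i j :
  (\sum_(k <- r | P k) f k) i j = \sum_(k <- r | P k) f k i j.
Proof. by elim/big_rec2: _ => // k s F _ <-. Qed.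

Lemma fps2_mulE F H i j : (F * H) i j =
  \sum_(a < i.+1) \sum_(b < j.+1) F a b * H (i - a)%N (j - b)%N.
Proof. by []. Qed.

Lemma fps2_ordW m n F : (m <= n)%N -> fps2_ord n F -> fps2_ord m F.
Proof. by move=> mn hF i j h; apply: hF; apply: leq_trans mn. Qed.

Lemma fps2_ordD n F H : fps2_ord n F -> fps2_ord n H -> fps2_ord n (F + H).
Proof. by move=> hF hH i j h; rewrite fps2_addE hF ?hH ?addr0. Qed.

Lemma fps2_ordN n F : fps2_ord n F -> fps2_ord n (- F).
Proof. by move=> hF i j h; rewrite fps2_oppE hF ?oppr0. Qed.

Lemma fps2_ordB n F H : fps2_ord n F -> fps2_ord n H -> fps2_ord n (F - H).
Proof. by move=> hF hH; apply: fps2_ordD => //; apply: fps2_ordN. Qed.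

Lemma fps2_ord_sum n I (r : seq I) (P : pred I) (f : I -> fps2 K) :
  (forall k, P k -> fps2_ord n (f k)) -> fps2_ord n (\sum_(k <- r | P k) f k).
Proof. by move=> h i j hij; rewrite fps2_sumE big1 // => k Pk; apply: h. Qed.

Lemma fps2_ordM m n F H :
  fps2_ord m F -> fps2_ord n H -> fps2_ord (m + n) (F * H).
Proof.
move=> hF hH i j hij; rewrite fps2_mulE big1 // => -[a /= ha] _.
rewrite big1 // => -[b /= hb] _.
have [h|h] := ltnP (a + b) m; first by rewrite hF ?mul0r.
rewrite (hH (i - a)%N) ?mulr0 //.
rewrite -(ltn_add2l (a + b)); apply: leq_trans (_ : m + n <= _)%N.
  by rewrite addnACA !subnKC.
by rewrite leq_add2r.
Qed.

Lemma fps2_ord0 F : fps2_ord 0 F.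
Proof. by []. Qed.

Lemma fps2_ordMl n F H : fps2_ord n H -> fps2_ord n (F * H).
Proof. by move=> h; rewrite -[n]add0n; apply: fps2_ordM. Qed.

Lemma fps2_ordMr n F H : fps2_ord n F -> fps2_ord n (F * H).
Proof. by move=> h; rewrite mulrC; apply: fps2_ordMl. Qed.

Lemma fps2_ordX F a : fps2_ord 1 F -> fps2_ord a (F ^+ a).
Proof.
by move=> h; elim: a => // a IH; rewrite exprS -add1n; apply: fps2_ordM.
Qed.

Lemma fps2_ord_eq F H : (forall n, fps2_ord n (F - H)) -> F = H.
Proof.
move=> h; apply: fps2P => i j; apply/eqP.
by rewrite -subr_eq0 -fps2_oppE -fps2_addE (h (i + j).+1).
Qed.

Lemma fps2_ord_trans n F F' H :
  fps2_ord n (F - F') -> fps2_ord n (F' - H) -> fps2_ord n (F - H).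
Proof. by move=> h1 h2; have := fps2_ordD h1 h2; rewrite addrA subrK. Qed.

Lemma fps2_ord_sym n F H : fps2_ord n (F - H) -> fps2_ord n (H - F).
Proof. by move/fps2_ordN; rewrite opprB. Qed.

Lemma fps2_ord_x : fps2_ord 1 fps2_x.
Proof. by move=> [|i] [|j]. Qed.

Lemma fps2_ord_y : fps2_ord 1 fps2_y.
Proof. by move=> [|i] [|j]. Qed.

Definition fps2_nocst G := fps2_ord 1 G.1 /\ fps2_ord 1 G.2.

Lemma fps2_nocst_mon G a b : fps2_nocst G -> fps2_ord (a + b) (G.1 ^+ a * G.2 ^+ b).
Proof. by case=> h1 h2; apply: fps2_ordM; apply: fps2_ordX. Qed.

Lemma tangent_nocst G : tangent_to_id G -> fps2_nocst G.
Proof.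
move=> [h1 h2]; split.
  rewrite -(subrK fps2_x G.1).
  by apply: fps2_ordD fps2_ord_x; apply: fps2_ordW h1.
rewrite -(subrK fps2_y G.2).
by apply: fps2_ordD fps2_ord_y; apply: fps2_ordW h2.
Qed.

Lemma fps2_of_poly_is_zmod_morphism : zmod_morphism (@fps2_of_poly K).
Proof.
move=> p q; apply: fps2P => i j.
by rewrite fps2_addE fps2_oppE /fps2_of_poly !coefB.
Qed.

Lemma fps2_of_poly_is_monoid_morphism : monoid_morphism (@fps2_of_poly K).
Proof.
split; last by move=> p q; rewrite fps2_of_polyM.
apply: fps2P => i j; rewrite /fps2_of_poly coef1 /GRing.one /= /fps2_one.
by case: i => [|i] /=; rewrite ?coef1 ?coef0.
Qed.

HB.instance Definition _ := GRing.isZmodMorphism.Build _ _ (@fps2_of_poly K)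
  fps2_of_poly_is_zmod_morphism.
HB.instance Definition _ := GRing.isMonoidMorphism.Build _ _ (@fps2_of_poly K)
  fps2_of_poly_is_monoid_morphism.

Definition fps2_cst (c : K) : fps2 K := (@fps2_of_poly K \o polyC \o polyC) c.
HB.instance Definition _ := GRing.RMorphism.copy fps2_cst
  (@fps2_of_poly K \o polyC \o polyC).

Lemma fps2_cstM c F i j : (fps2_cst c * F) i j = c * F i j.
Proof.
rewrite fps2_mulE big_ord_recl big_ord_recl /= /fps2_cst /= /fps2_of_poly.
rewrite !coefC /= !subn0 big1 ?addr0 => [|b _]; last by rewrite coefC mul0r.
by rewrite big1 ?addr0 // => a _; rewrite big1 // => b _; rewrite coefC /= ?coef0 ?nth_nil mul0r.
Qed.

Definition fps2_ev G : {poly {poly K}} -> fps2 K :=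
  horner_eval G.1 \o map_poly (horner_eval G.2 \o map_poly fps2_cst).
HB.instance Definition _ G := GRing.RMorphism.copy (fps2_ev G)
  (horner_eval G.1 \o map_poly (horner_eval G.2 \o map_poly fps2_cst)).

Lemma fps2_ev_horner G p :
  fps2_ev G p = (map_poly (horner_eval G.2 \o map_poly fps2_cst) p).[G.1].
Proof. by []. Qed.

Lemma fps2_evE G n p :
  (size p <= n)%N -> (forall a, (size (p`_a)%R <= n)%N) ->
  fps2_ev G p = \sum_(a < n) \sum_(b < n)
    fps2_cst p`_a`_b * (G.1 ^+ a * G.2 ^+ b).
Proof.
move=> hp ha; rewrite fps2_ev_horner (@horner_coef_wide _ n).
  apply: eq_bigr => a _; rewrite coef_map /= /horner_eval (@horner_coef_wide _ n).
    rewrite mulr_suml; apply: eq_bigr => b _.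
    by rewrite coef_map /= -mulrA [_ ^+ a * _]mulrC.
  by apply: leq_trans (ha a); apply: size_poly.
by apply: leq_trans hp; apply: size_poly.
Qed.

Lemma fps2_size_bound p : exists n,
  (size p <= n)%N /\ forall a, (size (p`_a)%R <= n)%N.
Proof.
exists (maxn (size p) (\max_(a < size p) size (p`_a)%R)); split.
  exact: leq_maxl.
move=> a; have [h|h] := ltnP a (size p); last by rewrite nth_default ?size_poly0.
rewrite leq_max; apply/orP; right.
exact: (leq_bigmax (Ordinal h)).
Qed.

Lemma fps2_ev_ord n G p : fps2_nocst G ->
  fps2_ord n (fps2_of_poly p) -> fps2_ord n (fps2_ev G p).
Proof.
move=> hG hp; have [m [h1 h2]] := fps2_size_bound p.
rewrite (fps2_evE _ h1 h2); apply: fps2_ord_sum => a _; apply: fps2_ord_sum => b _.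
have [h|h] := ltnP (a + b) n.
  by have := hp _ _ h; rewrite /fps2_of_poly => ->; rewrite rmorph0 mul0r.
by apply: fps2_ordMl; apply: fps2_ordW h _; apply: fps2_nocst_mon.
Qed.

Lemma fps2_comp_wide n F G i j : fps2_nocst G -> (i + j < n)%N ->
  fps2_comp F G i j =
  \sum_(a < n) \sum_(b < n) F a b * (G.1 ^+ a * G.2 ^+ b) i j.
Proof.
move=> hG hn; rewrite /fps2_comp.
have v a b : (i + j < a + b)%N -> F a b * (G.1 ^+ a * G.2 ^+ b) i j = 0.
  by move=> h; rewrite (fps2_nocst_mon hG) ?mulr0.
rewrite (big_ord_widen n (fun a => \sum_(b < (i + j).+1)
   F a b * (G.1 ^+ a * G.2 ^+ b) i j)) // big_mkcond; apply: eq_bigr => a _.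
case: ltnP => ha; last first.
  by rewrite big1 // => b _; apply: v; apply: leq_trans ha (leq_addr _ _).
rewrite (big_ord_widen n (fun b =>
   F a b * (G.1 ^+ a * G.2 ^+ b) i j)) // big_mkcond; apply: eq_bigr => b _.
case: ltnP => hb //.
by rewrite v //; apply: leq_trans hb (leq_addl _ _).
Qed.

Lemma fps2_comp_trunc n F G : fps2_nocst G ->
  fps2_ord n (fps2_comp F G - fps2_ev G (fps2_trunc n F)).
Proof.
move=> hG i j h; rewrite fps2_addE fps2_oppE (fps2_comp_wide _ hG h).
rewrite (@fps2_evE _ n); first last.
- move=> a; rewrite coef_poly; case: ifP => _; last by rewrite size_poly0.
  exact: size_poly.
- exact: size_poly.
rewrite fps2_sumE; apply/eqP; rewrite subr_eq0; apply/eqP.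
apply: eq_bigr => a _; rewrite fps2_sumE; apply: eq_bigr => b _.
by rewrite fps2_cstM coef_poly ltn_ord coef_poly ltn_ord.
Qed.

Lemma fps2_trunc_ord n F : fps2_ord n (F - fps2_of_poly (fps2_trunc n F)).
Proof.
move=> i j h; rewrite fps2_addE fps2_oppE fps2_truncE ?subrr //.
  exact: leq_ltn_trans (leq_addr _ _) h.
exact: leq_ltn_trans (leq_addl _ _) h.
Qed.

Lemma fps2_compD F H G : fps2_comp (F + H) G = fps2_comp F G + fps2_comp H G.
Proof.
apply: fps2P => i j; rewrite fps2_addE /fps2_comp -big_split.
apply: eq_bigr => a _; rewrite -big_split; apply: eq_bigr => b _.
by rewrite fps2_addE mulrDl.
Qed.

Lemma fps2_comp0 G : fps2_comp 0 G = 0.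
Proof.
apply: fps2P => i j; rewrite /fps2_comp big1 // => a _.
by rewrite big1 // => b _; rewrite fps2_0E mul0r.
Qed.

Lemma fps2_compB F H G : fps2_comp (F - H) G = fps2_comp F G - fps2_comp H G.
Proof.
by apply/eqP; rewrite -(addrK (fps2_comp H G) (fps2_comp (F - H) G)) -fps2_compD subrK.
Qed.

Lemma fps2_comp_sum I (r : seq I) (P : pred I) (f : I -> fps2 K) G :
  fps2_comp (\sum_(k <- r | P k) f k) G = \sum_(k <- r | P k) fps2_comp (f k) G.
Proof.
by apply: (big_morph (fps2_comp^~ G)) => [F H|]; [exact: fps2_compD | exact: fps2_comp0].
Qed.

Lemma fps2_comp_ord n F G : fps2_nocst G ->
  fps2_ord n F -> fps2_ord n (fps2_comp F G).
Proof.
move=> hG hF i j h; rewrite /fps2_comp big1 // => a _; rewrite big1 // => b _.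
have [h'|h'] := ltnP (a + b) n; first by rewrite hF ?mul0r.
by rewrite (fps2_nocst_mon hG) ?mulr0 //; apply: leq_trans h'.
Qed.

Lemma fps2_comp_of_poly p G : fps2_nocst G ->
  fps2_comp (fps2_of_poly p) G = fps2_ev G p.
Proof.
move=> hG; apply: fps2_ord_eq => n.
apply: (fps2_ord_trans (fps2_comp_trunc (n := n) _ hG)).
rewrite -rmorphB; apply: fps2_ev_ord => //.
by rewrite rmorphB; apply: fps2_ord_sym; apply: fps2_trunc_ord.
Qed.

Lemma fps2_ordMB n F F' H H' : fps2_ord n (F - F') -> fps2_ord n (H - H') ->
  fps2_ord n (F * H - F' * H').
Proof.
move=> hF hH.
have -> : F * H - F' * H' = (F - F') * H + F' * (H - H').
  by rewrite mulrBl mulrBr addrA subrK.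
by apply: fps2_ordD; [apply: fps2_ordMr | apply: fps2_ordMl].
Qed.

Lemma fps2_compM F H G : fps2_nocst G ->
  fps2_comp (F * H) G = fps2_comp F G * fps2_comp H G.
Proof.
move=> hG; apply: fps2_ord_eq => n.
apply: (fps2_ord_trans (fps2_comp_trunc (n := n) _ hG)).
apply: (@fps2_ord_trans _ _ (fps2_ev G (fps2_trunc n F * fps2_trunc n H))).
  rewrite -rmorphB; apply: fps2_ev_ord => //; rewrite rmorphB rmorphM.
  apply: (@fps2_ord_trans _ _ (F * H)); first exact/fps2_ord_sym/fps2_trunc_ord.
  by apply: fps2_ordMB; apply: fps2_trunc_ord.
by rewrite rmorphM; apply: fps2_ordMB; apply: fps2_ord_sym; apply: fps2_comp_trunc.
Qed.

Lemma fps2_comp_cst c G : fps2_nocst G -> fps2_comp (fps2_cst c) G = fps2_cst c.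
Proof.
move=> hG; rewrite {1}/fps2_cst /= fps2_comp_of_poly // fps2_ev_horner.
by rewrite map_polyC hornerC /= /horner_eval map_polyC hornerC.
Qed.

Lemma fps2_xE : fps2_x = fps2_of_poly 'X.
Proof.
apply: fps2P => i j; rewrite /fps2_of_poly coefX /fps2_x.
by case: eqP => _ /=; rewrite ?coef1 ?coef0.
Qed.

Lemma fps2_yE : fps2_y = fps2_of_poly ('X)%:P.
Proof.
apply: fps2P => i j; rewrite /fps2_of_poly coefC /fps2_y.
by case: eqP => _ /=; rewrite ?coefX ?coef0.
Qed.

Lemma fps2_comp_x G : fps2_nocst G -> fps2_comp fps2_x G = G.1.
Proof.
move=> hG; rewrite fps2_xE fps2_comp_of_poly // fps2_ev_horner.
by rewrite map_polyX hornerX.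
Qed.

Lemma fps2_comp_y G : fps2_nocst G -> fps2_comp fps2_y G = G.2.
Proof.
move=> hG; rewrite fps2_yE fps2_comp_of_poly // fps2_ev_horner.
by rewrite map_polyC hornerC /= /horner_eval map_polyX hornerX.
Qed.

Lemma fps2_comp1 G : fps2_nocst G -> fps2_comp 1 G = 1.
Proof. by move=> hG; rewrite -(rmorph1 fps2_cst) fps2_comp_cst. Qed.

Lemma fps2_compX F G a : fps2_nocst G -> fps2_comp (F ^+ a) G = fps2_comp F G ^+ a.
Proof.
move=> hG; elim: a => [|a IH]; first by rewrite !expr0 fps2_comp1.
by rewrite !exprS fps2_compM // IH.
Qed.

Definition fps2_pcomp (F G : fps2 K * fps2 K) : fps2 K * fps2 K :=
  (fps2_comp F.1 G, fps2_comp F.2 G).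

Lemma fps2_pcomp_nocst (F G : fps2 K * fps2 K) :
  fps2_nocst F -> fps2_nocst G -> fps2_nocst (fps2_pcomp F G).
Proof. by move=> [h1 h2] hG; split; apply: fps2_comp_ord. Qed.

Lemma fps2_compA F (G H : fps2 K * fps2 K) : fps2_nocst G -> fps2_nocst H ->
  fps2_comp (fps2_comp F G) H = fps2_comp F (fps2_pcomp G H).
Proof.
move=> hG hH; apply: fps2_ord_eq => n.
apply: (@fps2_ord_trans _ _ (fps2_comp (fps2_ev G (fps2_trunc n F)) H)).
  rewrite -fps2_compB; apply: fps2_comp_ord => //; exact: fps2_comp_trunc.
suff -> : fps2_comp (fps2_ev G (fps2_trunc n F)) H =
    fps2_ev (fps2_pcomp G H) (fps2_trunc n F).
  by apply: fps2_ord_sym; apply: fps2_comp_trunc; apply: fps2_pcomp_nocst.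
have [m [h1 h2]] := fps2_size_bound (fps2_trunc n F).
rewrite !(fps2_evE _ h1 h2) fps2_comp_sum; apply: eq_bigr => a _.
rewrite fps2_comp_sum; apply: eq_bigr => b _.
by rewrite !fps2_compM ?fps2_comp_cst ?fps2_compX.
Qed.

Lemma fps2_monE a b i j :
  (fps2_x ^+ a * fps2_y ^+ b) i j = ((i == a) && (j == b))%:R.
Proof.
rewrite fps2_xE fps2_yE -!rmorphXn -rmorphM /= /fps2_of_poly.
rewrite mulrC mul_polyC coefZ coefXn.
by case: eqP => _ /=; rewrite ?mulr1 ?mulr0 ?coefXn ?coef0.
Qed.

Lemma fps2_id_nocst : fps2_nocst (fps2_x, fps2_y).
Proof. by split; [exact: fps2_ord_x | exact: fps2_ord_y]. Qed.

Lemma fps2_comp_id F : fps2_comp F (fps2_x, fps2_y) = F.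
Proof.
apply: fps2P => i j; rewrite /fps2_comp.
have hi : (i < (i + j).+1)%N by rewrite ltnS leq_addr.
have hj : (j < (i + j).+1)%N by rewrite ltnS leq_addl.
rewrite (bigD1 (Ordinal hi)) //= (bigD1 (Ordinal hj)) //= fps2_monE !eqxx mulr1.
rewrite big1 ?addr0 => [|b hb]; last first.
  suff /negPf e : (b : nat) != j by rewrite fps2_monE [j == _]eq_sym e andbF mulr0.
  by apply: contra hb => /eqP e; apply/eqP/val_inj.
rewrite big1 ?addr0 // => a ha; rewrite big1 // => b _.
suff /negPf e : (a : nat) != i by rewrite fps2_monE [i == _]eq_sym e mulr0.
by apply: contra ha => /eqP e; apply/eqP/val_inj.
Qed.

Lemma tangent_id : tangent_to_id (fps2_x, fps2_y).
Proof. by split => i j _; rewrite /= subrr. Qed.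

Lemma tangent_mon G a b : tangent_to_id G ->
  fps2_ord (a + b).+1 (fps2_x ^+ a * fps2_y ^+ b - G.1 ^+ a * G.2 ^+ b).
Proof.
move=> hG; have [n1 n2] := tangent_nocst hG; case: hG => h1 h2.
have P F H k : fps2_ord 1 F -> fps2_ord 1 H -> fps2_ord 2 (F - H) ->
    fps2_ord k.+1 (F ^+ k - H ^+ k).
  move=> hF hH hFH; elim: k => [|k IH]; first by rewrite !expr0 subrr.
  have -> : F ^+ k.+1 - H ^+ k.+1 = F * (F ^+ k - H ^+ k) + (F - H) * H ^+ k.
    by rewrite mulrBl mulrBr -!exprS addrA subrK.
  apply: fps2_ordD; first by rewrite -(add1n k.+1); apply: fps2_ordM.
  by rewrite -(add2n k); apply: fps2_ordM => //; apply: fps2_ordX.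
have -> : fps2_x ^+ a * fps2_y ^+ b - G.1 ^+ a * G.2 ^+ b =
    (fps2_x ^+ a - G.1 ^+ a) * fps2_y ^+ b + G.1 ^+ a * (fps2_y ^+ b - G.2 ^+ b).
  by rewrite mulrBl mulrBr addrA subrK.
apply: fps2_ordD.
  rewrite -addSn; apply: fps2_ordM; last by apply: fps2_ordX; exact: fps2_ord_y.
  by apply: P => //; [exact: fps2_ord_x | exact: fps2_ord_sym].
rewrite -addnS; apply: fps2_ordM; first exact: fps2_ordX.
by apply: P => //; [exact: fps2_ord_y | exact: fps2_ord_sym].
Qed.

Definition fps2_diff G F : fps2 K := F - fps2_comp F G.

Lemma fps2_diff_ord m G F : tangent_to_id G ->
  fps2_ord m F -> fps2_ord m.+1 (fps2_diff G F).
Proof.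
move=> hG hF i j h; rewrite /fps2_diff -{1}(fps2_comp_id F) fps2_addE fps2_oppE.
rewrite /fps2_comp -sumrB big1 // => a _; rewrite -sumrB big1 // => b _.
have [h'|h'] := ltnP (a + b) m; first by rewrite hF // !mul0r subrr.
rewrite -mulrBr -fps2_oppE -fps2_addE (tangent_mon hG) ?mulr0 //.
exact: leq_trans h _.
Qed.

(* The solution H of H(G_1, G_2) = F for G tangent to the identity, obtained as
   the sum of the iterates of F |-> F - F(G_1, G_2), which raises the order. *)
Definition fps2_compV G F : fps2 K := fun i j =>
  \sum_(k < (i + j).+1) iter k (fps2_diff G) F i j.

Lemma fps2_iter_ord G F k : tangent_to_id G ->
  fps2_ord k (iter k (fps2_diff G) F).
Proof. by move=> hG; elim: k => //= k IH; apply: fps2_diff_ord. Qed.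

Lemma fps2_compV_trunc n G F : tangent_to_id G ->
  fps2_ord n (fps2_compV G F - \sum_(k < n) iter k (fps2_diff G) F).
Proof.
move=> hG i j h; rewrite fps2_addE fps2_oppE fps2_sumE /fps2_compV.
apply/eqP; rewrite subr_eq0; apply/eqP.
rewrite (big_ord_widen n (fun k => iter k (fps2_diff G) F i j)) // big_mkcond.
apply: eq_bigr => k _; case: ltnP => // hk.
by rewrite (fps2_iter_ord _ hG).
Qed.

Lemma fps2_compVK G F : tangent_to_id G -> fps2_comp (fps2_compV G F) G = F.
Proof.
move=> hG; have nG := tangent_nocst hG; apply: fps2_ord_eq => n.
apply: (@fps2_ord_trans _ _ (fps2_comp (\sum_(k < n) iter k (fps2_diff G) F) G)).
  by rewrite -fps2_compB; apply: fps2_comp_ord => //; apply: fps2_compV_trunc.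
rewrite fps2_comp_sum.
have -> : \sum_(k < n) fps2_comp (iter k (fps2_diff G) F) G =
    F - iter n (fps2_diff G) F.
  elim: n => [|n IH]; first by rewrite big_ord0 subrr.
  rewrite big_ord_recr IH iterS; set A := iter n _ _.
  by rewrite /fps2_diff opprB [RHS]addrA [RHS]addrAC.
by rewrite addrAC subrr add0r; apply: fps2_ordN; apply: fps2_iter_ord.
Qed.

Lemma fps2_compV_ord G F : tangent_to_id G -> fps2_ord 1 F ->
  fps2_ord 2 (fps2_compV G F - F).
Proof.
move=> hG hF; apply: fps2_ord_trans (fps2_compV_trunc (n := 2) _ hG) _.
rewrite big_ord_recl big_ord1 /= addrAC subrr add0r.
exact: fps2_diff_ord.
Qed.

Lemma tangent_pcomp (F G : fps2 K * fps2 K) :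
  tangent_to_id F -> tangent_to_id G -> tangent_to_id (fps2_pcomp F G).
Proof.
move=> [h1 h2] hG; have nG := tangent_nocst hG; case: (hG) => g1 g2; split => /=.
  apply: (@fps2_ord_trans _ _ (fps2_comp fps2_x G)).
    by rewrite -fps2_compB; apply: fps2_comp_ord.
  by rewrite fps2_comp_x.
apply: (@fps2_ord_trans _ _ (fps2_comp fps2_y G)).
  by rewrite -fps2_compB; apply: fps2_comp_ord.
by rewrite fps2_comp_y.
Qed.

Lemma tangent_compV G : tangent_to_id G ->
  tangent_to_id (fps2_compV G fps2_x, fps2_compV G fps2_y).
Proof.
move=> hG; split; apply: fps2_compV_ord => //.
  exact: fps2_ord_x.
exact: fps2_ord_y.
Qed.

(* The group of formal diffeomorphisms of (K^2, 0) tangent to the identity. *)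
Record diff1 := Diff1 {
  diff1_val :> fps2 K * fps2 K;
  diff1_tangent : tangent_to_id diff1_val }.

Lemma diff1_inj (F G : diff1) : diff1_val F = diff1_val G -> F = G.
Proof. by case: F G => [F hF] [G hG] /= e; subst G; congr Diff1; exact: Prop_irrelevance. Qed.

HB.instance Definition _ := gen_eqMixin diff1.
HB.instance Definition _ := gen_choiceMixin diff1.

Definition diff1_id : diff1 := Diff1 tangent_id.

Definition diff1_comp (F G : diff1) : diff1 :=
  Diff1 (tangent_pcomp (diff1_tangent F) (diff1_tangent G)).

Definition diff1_inv (F : diff1) : diff1 := Diff1 (tangent_compV (diff1_tangent F)).

Lemma diff1_compA : associative diff1_comp.
Proof.
move=> [F hF] [G hG] [H hH]; apply: diff1_inj; rewrite /= /fps2_pcomp /=.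
by rewrite !fps2_compA //; apply: tangent_nocst.
Qed.

Lemma diff1_comp1F : left_id diff1_id diff1_comp.
Proof.
move=> [[F1 F2] hF]; apply: diff1_inj; rewrite /= /fps2_pcomp /=.
by rewrite fps2_comp_x ?fps2_comp_y //; apply: tangent_nocst.
Qed.

Lemma diff1_compF1 : right_id diff1_id diff1_comp.
Proof.
by move=> [[F1 F2] hF]; apply: diff1_inj; rewrite /= /fps2_pcomp /= !fps2_comp_id.
Qed.

Lemma diff1_compVF : left_inverse diff1_id diff1_inv diff1_comp.
Proof.
by move=> [F hF]; apply: diff1_inj; rewrite /= /fps2_pcomp /= !fps2_compVK.
Qed.

Lemma diff1_compFV : right_inverse diff1_id diff1_inv diff1_comp.
Proof.
move=> F; rewrite -[LHS]diff1_comp1F -{1}(diff1_compVF (diff1_inv F)).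
by rewrite -diff1_compA (diff1_compA _ F) diff1_compVF diff1_comp1F diff1_compVF.
Qed.

HB.instance Definition _ := isGroup.Build diff1
  diff1_compA diff1_comp1F diff1_compF1 diff1_compVF diff1_compFV.

End Composition.

Section Groups.
Variable gT : groupType.
Implicit Types (x y : gT) (A B G S : set gT).
Local Open Scope classical_set_scope.
Local Open Scope group_scope.

Definition subgroup : set (set gT) := [set G : set gT | group_closed [in G]].

Definition generated_subgroup S : set gT := smallest subgroup S.

(* differs from the library's [~ x, y] = x^-1 * y^-1 * x * y *)
Definition commutator x y : gT := x * y * x^-1 * y^-1.

Definition commutators A B : set gT := [set commutator x y | x in A & y in B].

Fixpoint derived_subgroup n G : set gT :=
  if n is m.+1 then
    let D := derived_subgroup m G in generated_subgroup (commutators D D)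
  else G.

Definition solvable_group G := exists n, derived_subgroup n G = [set 1].

Definition with_inverses A : set gT := A `|` [set x^-1 | x in A].

Definition signed_commutators A B : set gT :=
  commutators (with_inverses A) (with_inverses B).

Fixpoint iter_commutators S j : set gT :=
  match j with
  | 0 => S
  | 1 => signed_commutators S S
  | (i.+1 as k).+1 => signed_commutators (iter_commutators S k)
                        (iter_commutators S k `|` iter_commutators S i)
  end.

Definition pseudo_solvable G := exists S : set gT,
  [/\ finite_set S, generated_subgroup S = G &
      exists N, forall j, (N <= j)%N -> iter_commutators S j = [set 1]].

End Groups.

(* Main.v *)
Require Import Defs.
From HB Require Import structures.
From mathcomp Require Import all_boot all_order all_algebra.
From mathcomp Require Import boolp classical_sets functions cardinality reals.
From mathcomp Require Import complex.
From mathcomp Require Import zify ring.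

(** Let [K] be the fraction field of the ring of formal power series in two variables. The
    group acts on [K] by composition with inverses. An element [g] tangent to the identity
    is unipotent for the order of vanishing at the origin, so that it has a logarithm, a
    continuous derivation of [K]: a (meromorphic, formal) vector field. It kills exactly the
    elements fixed by [g], and conjugate elements have conjugate logarithms. Vector fields
    form a space of dimension two over [K]. The record [setting] collects these facts, which
    are all that the argument uses; the logarithm is the derivative at [n = 0] of the powers
    [g ^ n], which are polynomial in [n] up to any given order ([log_leibniz]).

    Solvability is first replaced by a more precise property. For a nonzero vector field [X]
    let [I] be its field of first integrals, the kernel of [X]. A set [P] of automorphisms is
    [adapted] to [X] when each of its elements multiplies [X] by an element of [I] and the
    elements commute with one another on [I]. The third derived subgroup of an adapted
    group is trivial ([adapted_derived3]): commutators fix [I], commutators of such elements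
    also fix [X], and elements with both properties commute.

    Write [T_j] for the iterated commutators. For large [j] they are trivial, and
    a descending induction shows that [T_(j+1)] together with [T_j] is adapted to some vector
    field ([adapted_step], [adapted_descent]). Let [A] be [T_j], let [T] be [T_(j+1)] and let
    [H] be the group generated by [T_(j+1)] and [T_(j+2)], adapted to [X] by the induction
    hypothesis. Three consequences of the commutator relations are used: conjugation by [A]
    maps [T] into [H]; commutators of elements of [A] are in [T]; an element of [A] that does
    not centralise [T] conjugates some nontrivial element of [T] to an element of [T].

    If the logarithms of [T] are tangent to a single foliation, [A] preserves it, and one
    compares the affine structures of the leaves ([step1]). If they are not, and [T] is not
    abelian, commutators of [T] are tangent to the foliation of [X], which is therefore
    preserved by [A]; again the affine structures along the leaves are compared
    ([step2_nonab]). Finally, if [T] is abelian and its logarithms span a plane over the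
    constants, either [A] preserves this plane or it fixes the line of the plane that is
    tangent to the foliation of [X] ([step2_ab]). In all cases the actions on first integrals
    commute because they commute with a common vector field ([comm_on_ker]). Unipotency enters
    through the fact that conjugation has no constant eigenvalue other than [1]
    ([unipotent]). *)

Set Implicit Arguments.
Unset Strict Implicit.
Unset Printing Implicit Defensive.

Import Order.TTheory GRing.Theory Num.Theory.
Local Open Scope classical_set_scope.
Local Open Scope ring_scope.

(** * Orders of vanishing and limits *)

(** [ge n f] reads: [f] vanishes to order at least [n] at the origin. The last two fields
    make this order a discrete valuation, which takes finite values on nonzero elements. *)
Record filtration (K : fieldType) := Filtration {
  ge :> int -> K -> Prop;
  ge_le : forall m n f, m <= n -> ge n f -> ge m f;
  ge0 : forall n, ge n 0;
  geD : forall n f g, ge n f -> ge n g -> ge n (f + g);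
  geN : forall n f, ge n f -> ge n (- f);
  geM : forall m n f g, ge m f -> ge n g -> ge (m + n) (f * g);
  ge1 : ge 0 1;
  ge_natV : forall k, ge 0 (k.+1%:R^-1);
  nat_neq0 : forall k, k.+1%:R != 0 :> K;
  ge_sep : forall f, (forall n, ge n f) -> f = 0;
  ge_exact : forall f, f != 0 -> exists n, ge n f /\ ge (- n) f^-1 }.

Section Filtration.
Variables (K : fieldType) (v : filtration K).
Implicit Types (f g h : K) (n : int) (X : K -> K).

Lemma geB n f g : v n f -> v n g -> v n (f - g).
Proof. by move=> hf hg; apply: geD => //; apply: geN. Qed.

Lemma geNE n f : v n (- f) -> v n f.
Proof. by move/geN; rewrite opprK. Qed.

Lemma ge_subC n f g : v n (f - g) -> v n (g - f).
Proof. by move/geN; rewrite opprB. Qed.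

Lemma ge_trans n f g h : v n (f - g) -> v n (g - h) -> v n (f - h).
Proof. by move=> hf hg; have := geD hf hg; rewrite addrA subrK. Qed.

Lemma ge_sum n I (r : seq I) (P : pred I) (F : I -> K) :
  (forall i, P i -> v n (F i)) -> v n (\sum_(i <- r | P i) F i).
Proof.
by move=> hF; elim/big_rec: _ => [|i x hi hx]; [exact: ge0 | apply: geD => //; exact: hF].
Qed.

Lemma geMn n f k : v n f -> v n (f *+ k).
Proof. by move=> hf; elim: k => [|k IH]; [exact: ge0 | rewrite mulrS; exact: geD]. Qed.

Lemma ge_nat k : v 0 k%:R.
Proof. by apply: geMn; exact: ge1. Qed.

Lemma geMl n f c : v 0 c -> v n f -> v n (c * f).
Proof. by move=> hc hf; rewrite -[n]add0r; exact: geM. Qed.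

Lemma ge_bound f : exists n, v n f.
Proof.
have [->|/(ge_exact v)[n [hn _]]] := eqVneq f 0; first by exists 0; exact: ge0.
by exists n.
Qed.

Lemma ge1_neq n : 0 < n -> ~ v n 1.
Proof.
move=> hn h1; have /eqP := oner_neq0 K; apply; apply: (@ge_sep _ v) => m.
have hk k : v (k%:Z) 1.
  elim: k => [|k IH]; first exact: ge1.
  have h := geM h1 IH; rewrite mul1r in h.
  by apply: ge_le h; lia.
by apply: ge_le (hk `|m|%N); lia.
Qed.

(** Orders add up in products, so a bound on the order of [c * f] and the failure of a
    bound on that of [f] give a bound on the order of [c]. *)
Lemma ge_cancel n k f c : f != 0 -> v n (c * f) -> ~ v (n - k + 1) f -> v k c.
Proof.
move=> f0 hc hf; have [m [h1 h2]] := ge_exact v f0.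
have hm : m <= n - k.
  by rewrite leNgt; apply/negP => hlt; apply: hf; apply: ge_le h1; lia.
have := geM hc h2; rewrite mulfK // => h; apply: ge_le h; lia.
Qed.

Definition lim (s : nat -> K) l :=
  forall n, exists m0, forall m, (m0 <= m)%N -> v n (l - s m).

Lemma lim_unique s l1 l2 : lim s l1 -> lim s l2 -> l1 = l2.
Proof.
move=> h1 h2; apply/eqP; rewrite -subr_eq0; apply/eqP/(@ge_sep _ v) => n.
have [m1 H1] := h1 n; have [m2 H2] := h2 n.
have := geB (H1 _ (leq_maxl m1 m2)) (H2 _ (leq_maxr m1 m2)).
by rewrite opprB addrA subrK.
Qed.

Lemma lim_cst l : lim (fun=> l) l.
Proof. by move=> n; exists 0%N => m _; rewrite subrr; exact: ge0. Qed.

Lemma lim_eq s t l : s =1 t -> lim s l -> lim t l.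
Proof. by move=> e h n; have [m0 H] := h n; exists m0 => m hm; rewrite -e; exact: H. Qed.

Lemma lim_comb X b s l : (forall f g, X (f - g) = X f - X g) ->
  (forall n f, v n f -> v (n + b) (X f)) -> lim s l -> lim (X \o s) (X l).
Proof.
move=> XB Xb h n; have [m0 H] := h (n - b); exists m0 => m /H /Xb.
by rewrite XB /= subrK.
Qed.

Lemma limD s t l k : lim s l -> lim t k -> lim (fun m => s m + t m) (l + k).
Proof.
move=> h1 h2 n; have [m1 H1] := h1 n; have [m2 H2] := h2 n.
exists (maxn m1 m2) => m; rewrite geq_max => /andP[/H1 a1 /H2 a2].
by have := geD a1 a2; rewrite addrACA -opprD.
Qed.

Lemma limMr s l c : lim s l -> lim (fun m => s m * c) (l * c).
Proof.
have [b hb] := ge_bound c.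
apply: (@lim_comb ( *%R^~ c) b) => [f g|n f hf]; first by rewrite mulrBl.
exact: geM.
Qed.

Lemma limMl s l c : lim s l -> lim (fun m => c * s m) (c * l).
Proof. by move=> /(@limMr _ _ c) h; rewrite mulrC; apply: lim_eq h => m; rewrite mulrC. Qed.

Lemma limN s l : lim s l -> lim (fun m => - s m) (- l).
Proof. by move=> /(@limMl _ _ (-1)); rewrite mulN1r; apply: lim_eq => m; rewrite mulN1r. Qed.

Lemma limB s t l k : lim s l -> lim t k -> lim (fun m => s m - t m) (l - k).
Proof. by move=> h1 /limN; exact: limD. Qed.

Lemma lim_close s t l : (forall n, exists m0, forall m, (m0 <= m)%N -> v n (s m - t m)) ->
  lim s l -> lim t l.
Proof.
move=> h1 h2 n; have [m1 H1] := h1 n; have [m2 H2] := h2 n.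
exists (maxn m1 m2) => m; rewrite geq_max => /andP[/H1 a1 /H2 a2].
exact: ge_trans a2 a1.
Qed.

Lemma lim_ge n s l : lim s l -> (forall m, v n (s m)) -> v n l.
Proof.
by move=> h hs; have [m0 /(_ m0 (leqnn _)) H] := h n; rewrite -(subrK (s m0) l); exact: geD.
Qed.

(** Since the integers are of order [0] and invertible, dividing differences by them does
    not lower orders: the coefficients of a polynomial vanish at least to the order to
    which all its values at natural numbers do. *)
Lemma ge_interp n (P : {poly K}) :
  (forall k, v n P.[k%:R]) -> forall i, v n P`_i.
Proof.
move=> hP.
suff H d N (Q : {poly K}) : (size Q <= d)%N ->
    (forall k, (N <= k)%N -> v n Q.[k%:R]) -> forall i, v n Q`_i.
  by apply: (H (size P) 0%N) => // k _.
elim: d N Q => [|d IH] N Q hs hQ i.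
  by move: hs; rewrite leqn0 size_poly_eq0 => /eqP ->; rewrite coef0; exact: ge0.
have /factor_theorem[q hq] : root (Q - Q.[N%:R]%:P) N%:R.
  by rewrite /root hornerD hornerN hornerC subrr.
have hQN : v n Q.[N%:R] by exact: hQ.
have hqi : forall i, v n q`_i.
  apply: (IH N.+1 q) => [|k hk].
    have [->|q0] := eqVneq q 0; first by rewrite size_poly0.
    have : (size (q * ('X - N%:R%:P))%R <= d.+1)%N.
      rewrite -hq; apply: leq_trans (size_polyD _ _) _.
      rewrite geq_max hs size_polyN size_polyC; case: (_ != 0) => //.
    by rewrite size_Mmonic ?monicXsubC // size_XsubC addn2.
  have e : q.[k%:R] = (k - N.+1).+1%:R^-1 * (Q.[k%:R] - Q.[N%:R]).
    have -> : Q.[k%:R] - Q.[N%:R] = (Q - Q.[N%:R]%:P).[k%:R].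
      by rewrite hornerD hornerN hornerC.
    rewrite hq hornerM hornerXsubC -natrB; last by lia.
    have -> : (k - N)%N = (k - N.+1).+1 by lia.
    by rewrite mulrC mulfK // (nat_neq0 v).
  rewrite e; apply: geMl; first exact: ge_natV.
  by apply: geB => //; apply: hQ; lia.
rewrite -(subrK Q.[N%:R]%:P Q) hq coefD; apply: geD; last first.
  by rewrite coefC; case: eqP => // _; exact: ge0.
rewrite mulrBr coefB coefMX coefMC; apply: geB.
  by case: eqP => // _; exact: ge0.
by rewrite mulrC; apply: geMl => //; exact: ge_nat.
Qed.

End Filtration.

(** * Powers of an operator, interpolated *)

Section Iterates.
Variable M : zmodType.

(** This is the binomial expansion of the powers of [1 + (S - 1)]. *)
Lemma iter_binomial (S : M -> M) (x : M) n :
  (forall a b, S (a + b) = S a + S b) ->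
  iter n S x = \sum_(k < n.+1) iter k (fun a => S a - a) x *+ 'C(n, k).
Proof.
move=> SD; set N := fun a => S a - a.
have SE a : S a = N a + a by rewrite subrK.
have S0 : S 0 = 0 by apply: (addrI (S 0)); rewrite -SD !addr0.
have N0 : N 0 = 0 by rewrite /N S0 subrr.
have ND a b : N (a + b) = N a + N b by rewrite /N SD opprD addrACA.
have NM a k : N (a *+ k) = N a *+ k.
  by elim: k => [|k IH]; rewrite ?mulr0n ?N0 // !mulrS ND IH.
have Nsum (F : nat -> M) m : N (\sum_(k < m) F k) = \sum_(k < m) N (F k).
  by elim: m => [|m IH]; rewrite ?big_ord0 // !big_ord_recr ND IH.
elim: n => [|n IH]; first by rewrite big_ord_recl big_ord0 /= addr0.
rewrite iterS IH SE (Nsum (fun k => iter k N x *+ 'C(n, k))).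
have -> : \sum_(k < n.+1) N (iter k N x *+ 'C(n, k)) = \sum_(k < n.+1) iter k.+1 N x *+ 'C(n, k).
  by apply: eq_bigr => k _; rewrite NM.
have -> : \sum_(k < n.+1) iter k N x *+ 'C(n, k) = x + \sum_(k < n.+1) iter k.+1 N x *+ 'C(n, k.+1).
  rewrite [LHS]big_ord_recl [in RHS]big_ord_recr /= bin0 bin_small // mulr0n addr0.
  by congr (_ + _); apply: eq_bigr.
rewrite addrCA -big_split [RHS]big_ord_recl /= bin0; congr (_ + _).
by apply: eq_bigr => k _; rewrite binS mulrnDr addrC.
Qed.

End Iterates.

Section Binomials.
Variables (K : fieldType) (v : filtration K).

(** The binomial coefficient ['C(n, k)] as a polynomial in [n]. Its linear coefficient is that
    of the power [N ^ k] in the logarithm of [1 + N], by the binomial formula for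
    [(1 + N) ^ n]. *)
Fixpoint binpoly k : {poly K} :=
  if k is k'.+1 then k'.+1%:R^-1 *: (binpoly k' * ('X - k'%:R%:P)) else 1.

Definition logcoef k : K := (binpoly k)`_1.

Lemma binpolyE n k : (binpoly k).[n%:R] = 'C(n, k)%:R.
Proof.
elim: k => [|k IH]; first by rewrite hornerC bin0.
rewrite /= hornerZ hornerM hornerXsubC IH; apply: (mulfI (nat_neq0 v k)).
rewrite mulrA divff ?(nat_neq0 v) // mul1r.
have [h|h] := leqP k n; last by rewrite !bin_small ?mul0r ?mulr0 //; lia.
by rewrite -natrB // -!natrM mul_bin_left mulnC.
Qed.

Lemma binpoly_0 k : (binpoly k)`_0 = (k == 0%N)%:R.
Proof.
rewrite -horner_coef0; have := binpolyE 0 k; rewrite mulr0n => ->.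
by rewrite bin0n.
Qed.

Lemma logcoef0 : logcoef 0 = 0.
Proof. by rewrite /logcoef /= coefC. Qed.

Lemma logcoefS k : logcoef k.+1 = (-1) ^+ k / k.+1%:R.
Proof.
have step j : logcoef j.+1 = j.+1%:R^-1 * ((j == 0%N)%:R - logcoef j * j%:R).
  by rewrite /logcoef /= coefZ mulrBr coefB coefMX coefMC binpoly_0.
elim: k => [|k IH]; first by rewrite step logcoef0 mul0r subr0 mulr1 expr0 mul1r.
rewrite step /= IH sub0r divfK ?(nat_neq0 v) // exprS mulN1r mulrC.
by [].
Qed.

Lemma ge_sign k : v 0 ((-1) ^+ k).
Proof. by rewrite -signr_odd; case: odd; [apply: geN|]; exact: ge1. Qed.

Lemma ge_logcoef k : v 0 (logcoef k).
Proof.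
case: k => [|k]; first by rewrite logcoef0; exact: ge0.
rewrite logcoefS; rewrite -[0]addr0; apply: geM; [exact: ge_sign | exact: ge_natV].
Qed.

Lemma logcoef1 : logcoef 1 = 1.
Proof. by rewrite logcoefS expr0 mul1r invr1. Qed.

(** Up to terms of high order both sides of the hypothesis are polynomials in [n]; by
    [ge_interp] their linear coefficients agree up to high order. With [r] and [t] built
    from iterates of [s - 1], this turns multiplicativity of all powers of [s] into a
    Leibniz rule for the logarithm of [s]. *)
Lemma log_leibniz (M : int) (r : nat -> K) (t : nat -> nat -> K) :
  (forall n, \sum_(k < n.+1) r k *+ 'C(n, k) =
     \sum_(i < n.+1) \sum_(j < n.+1) t i j *+ ('C(n, i) * 'C(n, j))) ->
  (forall k, v (M + k%:Z) (r k)) ->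
  (forall i j, v (M + i%:Z + j%:Z) (t i j)) ->
  forall m, v (M + m%:Z) (\sum_(k < m) logcoef k * r k -
    (\sum_(k < m) logcoef k * t k 0%N + \sum_(k < m) logcoef k * t 0%N k)).
Proof.
move=> e hr ht m.
pose P := \sum_(k < m) r k *: binpoly k -
  \sum_(i < m) \sum_(j < m) t i j *: (binpoly i * binpoly j).
have wide n N (F : nat -> K) : (n <= N)%N -> (forall k, (n < k)%N -> F k = 0) ->
    \sum_(k < n.+1) F k = \sum_(k < N.+1) F k.
  move=> hnN hF; rewrite (big_ord_widen N.+1 F) ?ltnS // big_mkcond.
  by apply: eq_bigr => k _; case: ltnP => // hk; rewrite hF.
have cut (c : nat -> K) N : (m <= N)%N -> (forall k, (m <= k)%N -> v (M + m%:Z) (c k)) ->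
    v (M + m%:Z) (\sum_(k < N) c k - \sum_(k < m) c k).
  move=> hN hc; rewrite (@big_ord_widen _ _ _ m N c) // [X in _ - X]big_mkcond -sumrB.
  apply: ge_sum => k _; case: ltnP => hk; first by rewrite subrr; exact: ge0.
  by rewrite subr0; exact: hc.
have hP : forall i, v (M + m%:Z) P`_i.
  apply: ge_interp => n; set N := maxn n m.
  have hn : (n <= N)%N by exact: leq_maxl.
  have hm : (m <= N.+1)%N by apply: leqW; exact: leq_maxr.
  have E1 : \sum_(k < n.+1) r k *+ 'C(n, k) = \sum_(k < N.+1) r k *+ 'C(n, k).
    by apply: (wide _ _ (fun k => r k *+ 'C(n, k))) => // k hk; rewrite bin_small.
  have E2 : \sum_(i < n.+1) \sum_(j < n.+1) t i j *+ ('C(n, i) * 'C(n, j)) =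
      \sum_(i < N.+1) \sum_(j < N.+1) t i j *+ ('C(n, i) * 'C(n, j)).
    have -> : \sum_(i < n.+1) \sum_(j < n.+1) t i j *+ ('C(n, i) * 'C(n, j)) =
        \sum_(i < n.+1) \sum_(j < N.+1) t i j *+ ('C(n, i) * 'C(n, j)).
      apply: eq_bigr => i _.
      by apply: (wide _ _ (fun j => t i j *+ ('C(n, i) * 'C(n, j)))) => // k hk;
        rewrite [X in (_ * X)%N]bin_small // muln0.
    apply: (wide _ _ (fun i => \sum_(j < N.+1) t i j *+ ('C(n, i) * 'C(n, j)))) => // k hk.
    by rewrite big1 // => j _; rewrite bin_small.
  have -> : P.[n%:R] = \sum_(k < m) r k *+ 'C(n, k) -
      \sum_(i < m) \sum_(j < m) t i j *+ ('C(n, i) * 'C(n, j)).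
    rewrite hornerD hornerN !horner_sum; congr (_ - _).
      by apply: eq_bigr => k _; rewrite hornerZ binpolyE mulr_natr.
    apply: eq_bigr => i _; rewrite horner_sum; apply: eq_bigr => j _.
    by rewrite hornerZ hornerM !binpolyE -natrM mulr_natr.
  have H1 : v (M + m%:Z) (\sum_(k < N.+1) r k *+ 'C(n, k) - \sum_(k < m) r k *+ 'C(n, k)).
    by apply: (cut (fun k => r k *+ 'C(n, k))) => // k hk; apply: geMn; apply: ge_le (hr k); lia.
  have H2 : v (M + m%:Z) (\sum_(i < N.+1) \sum_(j < N.+1) t i j *+ ('C(n, i) * 'C(n, j)) -
      \sum_(i < m) \sum_(j < m) t i j *+ ('C(n, i) * 'C(n, j))).
    apply: (@ge_trans _ _ _ _ (\sum_(i < m) \sum_(j < N.+1) t i j *+ ('C(n, i) * 'C(n, j)))).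
      apply: (cut (fun i => \sum_(j < N.+1) t i j *+ ('C(n, i) * 'C(n, j)))) => // k hk.
      by apply: ge_sum => j _; apply: geMn; apply: ge_le (ht k j); lia.
    rewrite -sumrB; apply: ge_sum => i _.
    by apply: (cut (fun j => t i j *+ ('C(n, i) * 'C(n, j)))) => // k hk; apply: geMn; apply: ge_le (ht i k); lia.
  rewrite -E1 e E2 in H1.
  exact: ge_trans (ge_subC H1) H2.
have := hP 1%N; rewrite /P coefB !coef_sum.
have -> : \sum_(i < m) (r i *: binpoly i)`_1 = \sum_(k < m) logcoef k * r k.
  by apply: eq_bigr => k _; rewrite coefZ mulrC.
have -> // : \sum_(i < m) (\sum_(j < m) t i j *: (binpoly i * binpoly j))`_1 =
    \sum_(k < m) logcoef k * t k 0%N + \sum_(k < m) logcoef k * t 0%N k.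
have E i j : (t i j *: (binpoly i * binpoly j))`_1 =
    (j == 0%N)%:R * (logcoef i * t i j) + (i == 0%N)%:R * (logcoef j * t i j).
  rewrite coefZ coefM big_ord_recl big_ord1 /= !binpoly_0 -!/(logcoef _).
  by rewrite /logcoef /=; ring.
case: m {P cut hP} => [|m]; first by rewrite !big_ord0 addr0.
under eq_bigr => i _ do rewrite coef_sum.
under eq_bigr => i _ do under eq_bigr => j _ do rewrite E.
under eq_bigr => i _ do rewrite big_split /=.
rewrite big_split /=; congr (_ + _).
  apply: eq_bigr => i _; rewrite big_ord_recl /= mul1r big1 ?addr0 // => j _.
  by rewrite mul0r.
rewrite big_ord_recl /= [X in _ + X]big1 ?addr0 => [|i _].
  by apply: eq_bigr => j _; rewrite mul1r.
by rewrite big1 // => j _; rewrite mul0r.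
Qed.

End Binomials.

Lemma logcoef_rmorph (k K : fieldType) (phi : {rmorphism k -> K}) n :
  phi (logcoef k n) = logcoef K n.
Proof.
rewrite /logcoef -coef_map; suff -> : map_poly phi (binpoly k n) = binpoly K n by [].
elim: n => [|n IH]; first by rewrite /= rmorph1.
rewrite /= map_polyZ fmorphV rmorph_nat rmorphM /= IH rmorphB /= map_polyX map_polyC.
by rewrite /= rmorph_nat.
Qed.

(** * Unipotent automorphisms and vector fields *)

Section VectorFields.
Variables (K : fieldType) (v : filtration K) (scal : K -> Prop).

Definition raises b (X : K -> K) := forall n f, v n f -> v (n + b) (X f).

Record vf (X : K -> K) : Prop := VF {
  vfD : forall f g, X (f + g) = X f + X g;
  vfM : forall f g, X (f * g) = X f * g + f * X g;
  vf_scal : forall c, scal c -> X c = 0;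
  vf_raises : exists b, raises b X }.

End VectorFields.

(** Partial sums of the logarithm of [s], expanded in powers of [s - 1]. *)
Definition log_seq (K : fieldType) (s : K -> K) (f : K) m :=
  \sum_(k < m) logcoef K k * iter k (fun a => s a - a) f.

(** What the proof uses of formal diffeomorphisms acting on the fractions of power series.
    Vector fields are linear over [scal]. The group acts by automorphisms that are the
    identity on initial forms ([act_near]). Logarithms are only required on enough elements
    to reach all others by division ([log_frac]). The coordinates [sx] and [sy] determine a
    vector field ([vf_xy]), which bounds the dimension of the space of vector fields by two,
    and the Euler field ([euler_near]) detects that a constant has order zero. *)
Record setting := Setting {
  sK : fieldType;
  sv : filtration sK;
  scal : sK -> Prop;
  sU : groupType;
  act : sU -> sK -> sK;
  actD : forall g f h, act g (f + h) = act g f + act g h;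
  actM : forall g f h, act g (f * h) = act g f * act g h;
  act1g : forall f, act 1%g f = f;
  actMg : forall g h f, act (g * h)%g f = act g (act h f);
  act_scal : forall g c, scal c -> act g c = c;
  act_near : forall g n f, sv n f -> sv (n + 1) (act g f - f);
  act_faithful : forall g, (forall f, act g f = f) -> g = 1%g;
  log_frac : forall g f, exists a b, [/\ b != 0, f = a / b,
    exists e, lim sv (log_seq (act g) a) e & exists e, lim sv (log_seq (act g) b) e];
  sx : sK;
  sy : sK;
  vf_xy : forall X, vf sv scal X -> X sx = 0 -> X sy = 0 -> forall f, X f = 0;
  euler : sK -> sK;
  vf_euler : vf sv scal euler;
  euler_near : forall n f, sv n f -> sv (n + 1) (euler f - n%:~R * f);
  euler_neq0 : exists f, euler f != 0 }.

Section Setting.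
Variable (S : setting).
Local Notation K := (sK S).
Local Notation v := (@sv S).
Local Notation U := (sU S).
Local Notation vf := (vf v (@scal S)).
Local Notation act := (@act S).
Local Notation raises := (raises v).
Implicit Types (f a b c u p s r : K) (g h : U) (X Y Z V W : K -> K).

Lemma act0 g : act g 0 = 0.
Proof. by apply: (addrI (act g 0)); rewrite -actD !addr0. Qed.

Lemma actN g f : act g (- f) = - act g f.
Proof. by apply: (addrI (act g f)); rewrite -actD !subrr act0. Qed.

Lemma actB g f k : act g (f - k) = act g f - act g k.
Proof. by rewrite actD actN. Qed.

Lemma actK g f : act g^-1%g (act g f) = f.
Proof. by rewrite -actMg mulVg act1g. Qed.

Lemma actVK g f : act g (act g^-1%g f) = f.
Proof. by rewrite -actMg mulgV act1g. Qed.

Lemma act_eq0 g f : (act g f == 0) = (f == 0).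
Proof.
by apply/eqP/eqP => [e|->]; [rewrite -(actK g f) e act0 | rewrite act0].
Qed.

Lemma act1 g : act g 1 = 1.
Proof.
have h : act g 1 != 0 by rewrite act_eq0 oner_neq0.
by apply: (mulfI h); rewrite -actM !mulr1.
Qed.

Lemma actV g f : act g f^-1 = (act g f)^-1.
Proof.
have [->|h] := eqVneq f 0; first by rewrite invr0 act0 invr0.
have h' : act g f != 0 by rewrite act_eq0.
by apply: (mulfI h'); rewrite -actM !divff // act1.
Qed.

Lemma act_nat g k : act g k%:R = k%:R.
Proof. by elim: k => [|k IH]; rewrite ?act0 // mulrS actD act1 IH. Qed.

Lemma act_sum g I (r : seq I) (P : pred I) (F : I -> K) :
  act g (\sum_(i <- r | P i) F i) = \sum_(i <- r | P i) act g (F i).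
Proof. by apply: (big_morph (act g)) => [f k|]; rewrite ?actD ?act0. Qed.

Lemma act_logcoef g k : act g (logcoef K k) = logcoef K k.
Proof.
case: k => [|k]; first by rewrite logcoef0 act0.
rewrite (logcoefS v) actM actV act_nat -signr_odd; congr (_ / _).
by case: odd; rewrite ?expr1 ?actN act1.
Qed.

Lemma act_ge g n f : v n f -> v n (act g f).
Proof.
move=> h; rewrite -(subrK f (act g f)); apply: geD => //.
by apply: ge_le (act_near g h); lia.
Qed.

Section Derivations.
Variables (X : K -> K) (hX : vf X).

Lemma vf_D f k : X (f + k) = X f + X k. Proof. exact: (vfD hX). Qed.
Lemma vf_M f k : X (f * k) = X f * k + f * X k. Proof. exact: (vfM hX). Qed.

Lemma vf_0 : X 0 = 0.
Proof. by apply: (addrI (X 0)); rewrite -vf_D // !addr0. Qed.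

Lemma vf_N f : X (- f) = - X f.
Proof. by apply: (addrI (X f)); rewrite -vf_D // !subrr vf_0. Qed.

Lemma vf_B f k : X (f - k) = X f - X k.
Proof. by rewrite vf_D // vf_N. Qed.

Lemma vf_1 : X 1 = 0.
Proof. by apply: (addrI (X 1)); rewrite addr0 -{3}(mulr1 1) vf_M // mulr1 mul1r. Qed.

Lemma vf_nat k : X k%:R = 0.
Proof. by elim: k => [|k IH]; rewrite ?vf_0 // mulrS vf_D // vf_1 IH addr0. Qed.

Lemma vf_V f : X f^-1 = - X f / f ^+ 2.
Proof.
have [->|h] := eqVneq f 0; first by rewrite invr0 vf_0 oppr0 mul0r.
have : X (f * f^-1) = 0 by rewrite divff // vf_1.
rewrite vf_M // => /eqP; rewrite addrC addr_eq0 => /eqP e.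
by apply: (mulfI h); rewrite e; field.
Qed.

Lemma vf_div f k : k != 0 -> X (f / k) = (X f * k - f * X k) / k ^+ 2.
Proof. by move=> h; rewrite vf_M // vf_V; field. Qed.

Lemma vf_logcoef k : X (logcoef K k) = 0.
Proof.
case: k => [|k]; first by rewrite logcoef0 vf_0.
rewrite (logcoefS v) vf_M // vf_V vf_nat oppr0 mul0r mulr0 addr0 -signr_odd.
by case: odd; rewrite ?expr1 ?vf_N vf_1 ?oppr0 mul0r.
Qed.

Lemma vf_sum I (r : seq I) (P : pred I) (F : I -> K) :
  X (\sum_(i <- r | P i) F i) = \sum_(i <- r | P i) X (F i).
Proof. by apply: (big_morph X) => [f k|]; rewrite ?vf_D ?vf_0. Qed.

Lemma vf_Mn f n : X (f *+ n) = X f *+ n.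
Proof. by elim: n => [|n IH]; rewrite ?mulr0n ?vf_0 // !mulrS vf_D // IH. Qed.

Lemma vf_lim t l : lim v t l -> lim v (X \o t) (X l).
Proof.
have [b hb] := vf_raises hX.
by apply: (@lim_comb _ _ _ b) => // f k; exact: vf_B.
Qed.

End Derivations.

Lemma act_lim g t l : lim v t l -> lim v (act g \o t) (act g l).
Proof.
apply: (@lim_comb _ _ _ 0) => [f k|n f h]; first exact: actB.
by rewrite addr0; exact: act_ge.
Qed.

Definition delta g f := act g f - f.

Lemma delta_ge g n f : v n f -> v (n + 1) (delta g f).
Proof. exact: act_near. Qed.

Lemma iter_delta_ge g n f k : v n f -> v (n + k%:Z) (iter k (delta g) f).
Proof.
move=> h; elim: k => [|k IH]; first by rewrite addr0.
by apply: ge_le (delta_ge g IH); lia.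
Qed.

Lemma iter_actM g f k n : iter n (act g) (f * k) = iter n (act g) f * iter n (act g) k.
Proof. by elim: n => //= n ->; rewrite actM. Qed.

Lemma log_seqM_near g f k : exists n, forall m, v (n + m%:Z)
  (log_seq (act g) (f * k) m - (log_seq (act g) f m * k + f * log_seq (act g) k m)).
Proof.
have [nf hf] := ge_bound v f; have [nk hk] := ge_bound v k; exists (nf + nk) => m.
have -> : log_seq (act g) f m * k + f * log_seq (act g) k m =
    \sum_(i < m) logcoef K i * (iter i (delta g) f * iter 0 (delta g) k) +
    \sum_(i < m) logcoef K i * (iter 0 (delta g) f * iter i (delta g) k).
  rewrite /log_seq mulr_suml mulr_sumr /=; congr (_ + _); apply: eq_bigr => i _.
    by rewrite mulrA.
  by rewrite mulrCA.
apply: (@log_leibniz _ v _ _ (fun i j => iter i (delta g) f * iter j (delta g) k)).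
- move=> n; rewrite -iter_binomial; last exact: actD.
  rewrite iter_actM !(@iter_binomial _ (act g)); try exact: actD.
  rewrite mulr_suml; apply: eq_bigr => i _; rewrite mulr_sumr; apply: eq_bigr => j _.
  by rewrite mulrnAl mulrnAr -mulrnA mulnC.
- by move=> i; apply: iter_delta_ge; exact: geM.
- by move=> i j; apply: ge_le (geM (iter_delta_ge g i hf) (iter_delta_ge g j hk)); lia.
Qed.

Lemma near_lim (t w : nat -> K) n : (forall m, v (n + m%:Z) (t m - w m)) ->
  forall k, exists m0, forall m, (m0 <= m)%N -> v k (t m - w m).
Proof. by move=> h k; exists `|k - n|%N => m hm; apply: ge_le (h m); lia. Qed.

(** The approximate Leibniz rule [log_seqM_near] turns the convergence of the logarithm on
    two elements into its convergence on their quotient. *)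
Lemma log_ex g f : exists e, lim v (log_seq (act g) f) e.
Proof.
have [a [b [b0 ef [ea ha] [eb hb]]]] := log_frac g f.
have [n hn] := log_seqM_near g f b; rewrite (_ : f * b = a) in hn; last by rewrite ef divfK.
exists ((ea - f * eb) / b); apply: lim_close (limMr b^-1 (limB ha (limMl f hb))).
have [nb hnb] := ge_bound v b^-1.
apply: (@near_lim _ _ (n + nb)) => m; have := geM (hn m) hnb.
rewrite opprD addrCA mulrDl mulNr mulfK // [X in v _ X]addrC => h.
by apply: ge_le h; lia.
Qed.

Definition log g f : K := projT1 (cid (log_ex g f)).

Lemma log_lim g f : lim v (log_seq (act g) f) (log g f).
Proof. exact: projT2 (cid (log_ex g f)). Qed.

Lemma log_seqD g f k m : log_seq (act g) (f + k) m = log_seq (act g) f m + log_seq (act g) k m.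
Proof.
rewrite /log_seq -big_split /=; apply: eq_bigr => i _; rewrite -mulrDr; congr (_ * _).
elim: (i : nat) => //= j ->; rewrite actD; ring.
Qed.

Lemma logM g f k : log g (f * k) = log g f * k + f * log g k.
Proof.
have [n hn] := log_seqM_near g f k.
apply: (lim_unique (v := v) (s := log_seq (act g) (f * k))); first exact: log_lim.
have h := limD (limMr k (log_lim g f)) (limMl f (log_lim g k)).
apply: lim_close h; apply: near_lim => m.
by apply: ge_subC; exact: (hn m).
Qed.

Lemma log_fixed g f : act g f = f -> log g f = 0.
Proof.
move=> e; apply: lim_unique (log_lim g f) _.
apply: lim_eq (lim_cst v 0) => m; rewrite /log_seq big1 // => -[i hi] _ /=.
case: i {hi} => [|i]; first by rewrite logcoef0 mul0r.
suff -> : iter i.+1 (fun a => act g a - a) f = 0 by rewrite mulr0.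
by elim: i => [|i IH]; [rewrite /= e subrr | rewrite iterS IH act0 subr0].
Qed.

Lemma log_raises g : raises 1 (log g).
Proof.
move=> n f h; apply: lim_ge (log_lim g f) _ => m; apply: ge_sum => -[i hi] _ /=.
case: i {hi} => [|i]; first by rewrite logcoef0 mul0r; exact: ge0.
apply: geMl; first exact: ge_logcoef.
by apply: ge_le (iter_delta_ge g i.+1 h); lia.
Qed.

Lemma vf_log g : vf (log g).
Proof.
split; [|exact: logM|by move=> c hc; apply: log_fixed; exact: act_scal|by exists 1; exact: log_raises].
move=> f k; apply: lim_unique (log_lim g _) _.
apply: lim_eq (limD (log_lim g f) (log_lim g k)) => m.
by rewrite log_seqD.
Qed.

(** The direct image of the vector field [X] under [g]. *)
Definition Ad g X f := act g (X (act g^-1%g f)).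

Lemma Ad_act g X f : Ad g X (act g f) = act g (X f).
Proof. by rewrite /Ad actK. Qed.

Lemma AdM g h X f : Ad (g * h)%g X f = Ad g (Ad h X) f.
Proof. by rewrite /Ad actMg invgM actMg. Qed.

Lemma Ad1 X f : Ad 1%g X f = X f.
Proof. by rewrite /Ad act1g invg1 act1g. Qed.

Lemma AdK g X f : Ad g^-1%g (Ad g X) f = X f.
Proof. by rewrite -AdM mulVg Ad1. Qed.

Lemma eq_Ad g X Y : (forall f, X f = Y f) -> forall f, Ad g X f = Ad g Y f.
Proof. by move=> e f; rewrite /Ad e. Qed.

Lemma vf_Ad g X : vf X -> vf (Ad g X).
Proof.
move=> hX; split=> [f k|f k|c hc|]; rewrite ?/Ad.
- by rewrite actD vf_D // actD.
- by rewrite actM vf_M // actD !actM !actVK.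
- by rewrite (act_scal _ hc) (vf_scal hX hc) act0.
have [b hb] := vf_raises hX; exists b => n f h.
by apply: act_ge; apply: hb; exact: act_ge.
Qed.

Lemma Ad_log g h f : Ad g (log h) f = log (g * h * g^-1)%g f.
Proof.
apply: lim_unique (act_lim g (log_lim h (act g^-1%g f))) _.
apply: lim_eq (log_lim _ f) => m /=; rewrite /log_seq act_sum; apply: eq_bigr => i _.
rewrite actM act_logcoef; congr (_ * _).
elim: (i : nat) => [|j IH]; first by rewrite actVK.
by rewrite /= actB IH !actMg actK.
Qed.

Lemma act_log g f : act g (log g f) = log g (act g f).
Proof.
by have := Ad_log g g (act g f); rewrite Ad_act mulgK.
Qed.

(** * An automorphism and its logarithm have the same local behaviour *)

Section Stable.
Variable (D : K -> Prop).
Hypothesis D_sub : forall a b, D a -> D b -> D (a - b).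

Lemma iter_delta_stable g f k : (forall f, D f -> D (act g f)) -> D f -> D (iter k (delta g) f).
Proof. by move=> hg hf; elim: k => //= k IH; apply: D_sub => //; exact: hg. Qed.

Lemma log_local g h : (forall f, D f -> D (act g f)) ->
  (forall f, D f -> act g f = act h f) -> forall f, D f -> log g f = log h f.
Proof.
move=> hg e f hf; apply: lim_unique (log_lim g f) _.
apply: lim_eq (log_lim h f) => m; rewrite /log_seq; apply: eq_bigr => i _; congr (_ * _).
elim: (i : nat) => //= j ->; rewrite e //.
exact: iter_delta_stable.
Qed.

(** If [g] and [h] agree up to relative order [m] on [D], the second and higher powers of
    [g - 1] and [h - 1] agree up to relative order [m + 1]; equality of the logarithms then
    forces [g] and [h] to agree up to relative order [m + 1]. *)
Lemma eq_act_of_log g h : (forall f, D f -> D (act g f)) -> (forall f, D f -> D (act h f)) ->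
  (forall f, D f -> log g f = log h f) -> forall f, D f -> act g f = act h f.
Proof.
move=> hg hh e f hf; apply/eqP; rewrite -subr_eq0; apply/eqP/(@ge_sep _ v) => n.
suff H m : forall k f, D f -> v k f -> v (k + m.+1%:Z) (act g f - act h f).
  have [k hk] := ge_bound v f.
  by apply: ge_le (H `|n - k|%N k f hf hk); lia.
elim: m => [|m IH] {n} {f hf}k f hf hk.
  have := geB (delta_ge g hk) (delta_ge h hk).
  by rewrite /delta opprB addrA subrK.
have A j : v (k + m.+1%:Z + j%:Z) (iter j.+1 (delta g) f - iter j.+1 (delta h) f).
  elim: j => [|j IHj].
    by rewrite addr0 /= /delta opprB addrA subrK; exact: IH.
  rewrite iterS [iter j.+2 (delta h) f]iterS.
  move: IHj; set a := iter _ _ _; set b := iter _ _ _ => IHj.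
  have -> : delta g a - delta h b = delta g (a - b) + (act g b - act h b).
    by rewrite /delta actB; ring.
  apply: geD; first by apply: ge_le (delta_ge g IHj); lia.
  have hb : v (k + j.+1%:Z) b by exact: iter_delta_ge.
  by apply: ge_le (IH _ _ _ hb); [lia | exact: iter_delta_stable].
have := limB (log_lim g f) (log_lim h f); rewrite e // subrr => /(_ (k + m.+2%:Z)).
move=> [m0 /(_ (maxn m0 2) (leq_maxl _ _))]; rewrite sub0r => /geNE.
have [N ->] : exists N, maxn m0 2 = N.+2 by exists (maxn m0 2).-2; lia.
rewrite /log_seq -sumrB 2!big_ord_recl /= /bump /= logcoef0 (logcoef1 v) !mul0r subrr add0r !mul1r.
set R := \sum_(i < _) _ => hR.
have hR' : v (k + m.+2%:Z) R.
  apply: ge_sum => i _; rewrite -mulrBr; apply: geMl; first exact: ge_logcoef.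
  by apply: ge_le (A i.+1); lia.
by have := geB hR hR'; rewrite addrK opprB addrA subrK.
Qed.

End Stable.

Lemma log_1 f : log 1%g f = 0.
Proof. by apply: log_fixed; rewrite act1g. Qed.

(** Compare [g] with the identity on the subset where its logarithm vanishes. *)
Lemma fixed_log g f : log g f = 0 -> act g f = f.
Proof.
move=> e; rewrite -[RHS]act1g.
have hg := vf_log g.
apply: (@eq_act_of_log (fun f => log g f = 0)) => // [a b ha hb|a ha|a ha|a ha].
- by rewrite vf_B // ha hb subrr.
- by rewrite -act_log ha act0.
- by rewrite act1g.
- by rewrite ha log_1.
Qed.

Lemma log_inj g h : (forall f, log g f = log h f) -> g = h.
Proof.
move=> e; have H f : act g f = act h f by apply: (@eq_act_of_log (fun=> True)).
have : (h^-1 * g)%g = 1%g by apply: (@act_faithful S) => f; rewrite actMg H actK.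
by move/(congr1 (fun x => (h * x)%g)); rewrite mulVKg mulg1.
Qed.

Lemma log_eq0 g : (forall f, log g f = 0) -> g = 1%g.
Proof. by move=> e; apply: log_inj => f; rewrite e log_1. Qed.

Lemma Ad_log_id g h : (g * h)%g = (h * g)%g -> forall f, Ad g (log h) f = log h f.
Proof. by move=> e f; rewrite Ad_log e mulgK. Qed.

Lemma comm_of_Ad_log g h : (forall f, Ad g (log h) f = log h f) -> (g * h)%g = (h * g)%g.
Proof.
move=> e; have : (g * h * g^-1)%g = h by apply: log_inj => f; rewrite -Ad_log.
by move/(congr1 (fun x => (x * g)%g)); rewrite mulgVK.
Qed.

(** * Vector fields form a plane over the field of fractions *)

Definition nz X := exists f, X f != 0.

(** [Y] is a multiple of [X] over the field of fractions: it is tangent to the foliation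
    of [X]. *)
Definition parallel X Y := exists a, forall f, Y f = a * X f.

Lemma nzPn X : ~ nz X -> forall f, X f = 0.
Proof. by move=> h f; apply/eqP/negPn/negP => hf; apply: h; exists f. Qed.

Lemma nz_log g : g <> 1%g -> nz (log g).
Proof. by move=> h; apply: contrapT => /nzPn /log_eq0. Qed.

Lemma nz_Ad g X : nz X -> nz (Ad g X).
Proof. by move=> [f hf]; exists (act g f); rewrite Ad_act act_eq0. Qed.

Lemma vf_comb a b X Y : vf X -> vf Y -> vf (fun f => a * X f + b * Y f).
Proof.
move=> hX hY; split=> [f k|f k|c hc|].
- by rewrite (vf_D hX) (vf_D hY); ring.
- by rewrite (vf_M hX) (vf_M hY); ring.
- by rewrite (vf_scal hX hc) (vf_scal hY hc) !mulr0 addr0.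
have [m hm] := vf_raises hX; have [n hn] := vf_raises hY.
have [i hi] := ge_bound v a; have [j hj] := ge_bound v b.
exists (Num.min (i + m) (j + n)) => k f hf; apply: geD.
  by apply: ge_le (geM hi (hm _ _ hf)); rewrite addrCA lerD2l ge_min lexx.
by apply: ge_le (geM hj (hn _ _ hf)); rewrite addrCA lerD2l ge_min lexx orbT.
Qed.

Lemma vf_scale a X : vf X -> vf (fun f => a * X f).
Proof.
move=> hX; have := vf_comb a 0 hX hX; congr vf.
by apply/funext => f; rewrite mul0r addr0.
Qed.

Lemma parallel_refl X : parallel X X.
Proof. by exists 1 => f; rewrite mul1r. Qed.

Lemma parallel_trans X Y Z : parallel X Y -> parallel Y Z -> parallel X Z.
Proof. by move=> [a ha] [b hb]; exists (b * a) => f; rewrite hb ha mulrA. Qed.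

Lemma parallel_coef_neq0 X Y a : nz Y -> (forall f, Y f = a * X f) -> a != 0.
Proof. by move=> [f hf] e; apply: contraNneq hf => a0; rewrite e a0 mul0r. Qed.

Lemma parallel_sym X Y : nz Y -> parallel X Y -> parallel Y X.
Proof.
move=> nY [a e]; have a0 := parallel_coef_neq0 nY e; exists a^-1 => f.
by rewrite e mulKf.
Qed.

(** A vector field is determined by its values at the two coordinates, so this is Cramer's
    rule in a space of dimension two. *)
Lemma rank2 X Y Z : vf X -> vf Y -> vf Z -> nz X -> ~ parallel X Y ->
  exists a b, forall f, Z f = a * Y f + b * X f.
Proof.
move=> hX hY hZ nX hXY; pose x := sx S; pose y := sy S.
have zero a b c : a * X x + b * Y x + c * Z x = 0 -> a * X y + b * Y y + c * Z y = 0 ->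
    forall f, a * X f + b * Y f + c * Z f = 0.
  move=> ex ey; have h := vf_comb 1 c (vf_comb a b hX hY) hZ.
  by move=> f; have := vf_xy h; rewrite !mul1r => /(_ ex ey f); rewrite mul1r.
have nXY : X x != 0 \/ X y != 0.
  apply: contrapT => /not_orP[/negP/negPn/eqP ex /negP/negPn/eqP ey].
  by case: nX => f /eqP; apply; apply: (vf_xy hX).
have d0 : X x * Y y - X y * Y x != 0.
  apply/eqP => /eqP; rewrite subr_eq0 => /eqP d; apply: hXY.
  have prop c : Y x = c * X x -> Y y = c * X y -> parallel X Y.
    move=> ex ey; exists c => f; have := @zero (- c) 1 0 _ _ f.
    rewrite ex ey => /(_ ltac:(ring) ltac:(ring)) H.
    by apply/eqP; rewrite -subr_eq0 -H; apply/eqP; ring.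
  case: nXY => h; [apply: (prop (Y x / X x)) | apply: (prop (Y y / X y))].
  - by rewrite divfK.
  - by apply: (mulfI h); rewrite d; field.
  - by apply: (mulfI h); rewrite -d; field.
  - by rewrite divfK.
exists ((X x * Z y - X y * Z x) / (X x * Y y - X y * Y x)).
exists ((Z x * Y y - Z y * Y x) / (X x * Y y - X y * Y x)) => f.
set D := X x * Y y - X y * Y x in d0 *.
have := @zero ((Z x * Y y - Z y * Y x) / D) ((X x * Z y - X y * Z x) / D) (-1) _ _ f.
move=> /(_ ltac:(rewrite /D; field; exact: d0) ltac:(rewrite /D; field; exact: d0)) E.
by apply/eqP; rewrite -subr_eq0 -oppr_eq0 -E; apply/eqP; ring.
Qed.

Lemma indep X Y a b : nz X -> ~ parallel X Y -> (forall f, a * Y f + b * X f = 0) ->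
  a = 0 /\ b = 0.
Proof.
move=> [f0 hf0] hXY e; have a0 : a = 0.
  apply/eqP/negPn/negP => a0; apply: hXY; exists (- b / a) => f.
  apply: (mulfI a0); rewrite mulrA mulrCA divff // mulr1 mulNr; apply/eqP.
  by rewrite -addr_eq0 e.
split=> //; move: (e f0); rewrite a0 mul0r add0r => /eqP.
by rewrite mulf_eq0 (negPf hf0) orbF => /eqP.
Qed.

(** * Constants *)

(** The constants are described by the vector fields, which makes them invariant under the
    group and lets two independent vector fields detect them ([Cst_ker]). *)
Definition Cst c := forall X, vf X -> X c = 0.

Lemma Cst_ker X Y f : vf X -> vf Y -> nz X -> ~ parallel X Y -> X f = 0 -> Y f = 0 -> Cst f.
Proof.
move=> hX hY nX hXY eX eY Z hZ; have [a [b ->]] := rank2 hX hY hZ nX hXY.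
by rewrite eX eY !mulr0 addr0.
Qed.

Lemma Cst_act g c : Cst c -> act g c = c.
Proof. by move=> h; apply: fixed_log; apply: h; exact: vf_log. Qed.

Lemma Cst0 : Cst 0. Proof. by move=> X hX; rewrite (vf_0 hX). Qed.
Lemma Cst1 : Cst 1. Proof. by move=> X hX; rewrite (vf_1 hX). Qed.
Lemma CstB a b : Cst a -> Cst b -> Cst (a - b).
Proof. by move=> ha hb X hX; rewrite (vf_B hX) ha // hb // subrr. Qed.
Lemma CstD a b : Cst a -> Cst b -> Cst (a + b).
Proof. by move=> ha hb X hX; rewrite (vf_D hX) ha // hb // addr0. Qed.
Lemma CstM a b : Cst a -> Cst b -> Cst (a * b).
Proof. by move=> ha hb X hX; rewrite (vf_M hX) (ha _ hX) (hb _ hX) mulr0 mul0r addr0. Qed.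
Lemma CstV a : Cst a -> Cst a^-1.
Proof. by move=> ha X hX; rewrite (vf_V hX) ha // oppr0 mul0r. Qed.

Lemma ge_intV (n : int) : n != 0 -> v 0 (n%:~R^-1).
Proof.
case: n => [[//|n]|n] _; first exact: ge_natV.
rewrite NegzE mulrNz invrN; apply: geN; exact: ge_natV.
Qed.

Lemma int_neq0 (n : int) : n != 0 -> n%:~R != 0 :> K.
Proof.
case: n => [[//|n]|n] _; first exact: (nat_neq0 v).
by rewrite NegzE mulrNz oppr_eq0; exact: (nat_neq0 v).
Qed.

(** The Euler field multiplies leading terms by their degree; on a constant it vanishes, so
    the degree is zero. *)
Lemma Cst_order c : Cst c -> c != 0 -> v 0 c /\ v 0 c^-1.
Proof.
move=> hc c0; have [n [h1 h2]] := ge_exact v c0.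
have := euler_near h1; rewrite hc ?sub0r; last exact: vf_euler.
have [n0|n0] := eqVneq n 0; first by move: h1 h2; rewrite n0 oppr0.
move/geNE => h3; have h4 := geM (geMl (ge_intV n0) h3) h2.
rewrite mulKf ?int_neq0 // mulfV // addrAC subrr add0r in h4.
by case: (@ge1_neq _ v 1).
Qed.

Lemma Cst_ge0 c : Cst c -> v 0 c.
Proof.
move=> hc; have [->|c0] := eqVneq c 0; first exact: ge0.
by case: (Cst_order hc c0).
Qed.

Lemma Cst_ge1 c : Cst c -> v 1 c -> c = 0.
Proof.
move=> hc h1; apply/eqP/negPn/negP => c0; have [_ h2] := Cst_order hc c0.
by have := geM h1 h2; rewrite divff // addr0; exact: ge1_neq.
Qed.

(** * Unipotency of the adjoint action *)

Lemma raises_Ad g (b : int) X : vf X -> raises b X -> raises (b + 1) (fun f => Ad g X f - X f).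
Proof.
move=> hX hb n f hf.
have -> : Ad g X f - X f = delta g (X (act g^-1%g f)) + X (delta g^-1%g f).
  by rewrite /delta vf_B // /Ad addrA subrK.
apply: geD.
  by rewrite addrA; apply: delta_ge; apply: hb; exact: act_ge.
by have := hb _ _ (delta_ge g^-1%g hf); rewrite addrAC addrA.
Qed.

(** A nonzero operator cannot raise orders by arbitrarily much, since an element of infinite
    order is zero; take the largest gain [b] valid on [D]. *)
Lemma exact_raises (D : K -> Prop) V : vf V -> (exists2 f, D f & V f != 0) ->
  exists b : int, (forall n f, D f -> v n f -> v (n + b) (V f)) /\
    exists n f, [/\ D f, v n f & ~ v (n + b + 1) (V f)].
Proof.
move=> hV [f0 Df0 Vf0]; have [b0 hb0] := vf_raises hV.
pose Q (b : int) := forall n f, D f -> v n f -> v (n + b) (V f).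
apply: contrapT => hn; have hQ k : Q (b0 + k%:Z).
  elim: k => [|k IH]; first by move=> n f _ /hb0; rewrite addr0.
  move=> n f Df hf; apply: contrapT => h; apply: hn; exists (b0 + k%:Z); split=> //.
  by exists n, f; split=> // h1; apply: h; apply: ge_le h1; lia.
move/eqP: Vf0; apply; apply: (@ge_sep _ v) => n.
have [n0 h0] := ge_bound v f0.
by apply: ge_le (hQ `|(n - n0 - b0)%R|%N _ _ Df0 h0); lia.
Qed.

(** Conjugation by [g] does not change the initial form of [V], hence multiplies it by
    something whose initial form is [1]. It suffices to see this where [V] gains the least
    order, and the subset [D] may be smaller than the field. *)
Lemma unipotent (D : K -> Prop) g V r :
  (forall a b, D a -> D b -> D (a - b)) -> (forall f, D f -> D (act g^-1%g f)) ->
  vf V -> (exists2 f, D f & V f != 0) ->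
  (forall f, D f -> Ad g V f = r * V f) -> v 1 (r - 1).
Proof.
move=> DB Dg hV DV e; have [b [hb [n [f [Df hf hVf]]]]] := exact_raises hV DV.
have Vf_neq : V f != 0.
  by apply/eqP => h; apply: hVf; rewrite h; exact: ge0.
have H : v (n + b + 1) ((r - 1) * V f).
  rewrite mulrBl mul1r -e //.
  have -> : Ad g V f - V f = delta g (V (act g^-1%g f)) + V (delta g^-1%g f).
    by rewrite /delta (vf_B hV) /Ad addrA subrK.
  apply: geD.
    by apply: delta_ge; apply: hb; [exact: Dg | exact: act_ge].
  rewrite addrAC; apply: hb; last exact: delta_ge.
  by apply: DB => //; exact: Dg.
by apply: ge_cancel Vf_neq H _; rewrite addrK.
Qed.

End Setting.

(** * Generated subgroups *)

Section Generation.
Variable gT : groupType.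
Implicit Types (G P : set gT) (x y : gT).

Lemma subgroupE G :
  subgroup G <-> G 1%g /\ (forall x y, G x -> G y -> G (x * y^-1)%g).
Proof.
split=> [[h1 h2]|[h1 h2]].
  split=> [|x y hx hy]; first by move: h1; rewrite inE.
  by have := h2 x y; rewrite !inE; apply.
split; first by rewrite inE.
by move=> x y; rewrite !inE; exact: h2.
Qed.

Lemma subgroup1 G : subgroup G -> G 1%g.
Proof. by move/subgroupE => []. Qed.

Lemma subgroupV G x : subgroup G -> G x -> G x^-1%g.
Proof. by move/subgroupE => [h1 h2] hx; rewrite -[(x^-1)%g]mul1g; exact: h2. Qed.

Lemma subgroupM G x y : subgroup G -> G x -> G y -> G (x * y)%g.
Proof.
move=> hG hx hy; have [_ h2] := (subgroupE G).1 hG.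
by rewrite -[y]invgK; apply: h2 => //; exact: subgroupV.
Qed.

Lemma subgroup_comm G x y : subgroup G -> G x -> G y -> G (commutator x y).
Proof.
by move=> hG hx hy; rewrite /commutator; do 3?[apply: subgroupM => //]; exact: subgroupV.
Qed.

Lemma sub_gen P : P `<=` generated_subgroup P.
Proof. by move=> x hx G [_ hG]; exact: hG. Qed.

Lemma gen_sub P G : subgroup G -> P `<=` G -> generated_subgroup P `<=` G.
Proof. by move=> hG hP x hx; exact: hx. Qed.

Lemma gen_subgroup P : subgroup (generated_subgroup P).
Proof.
apply/subgroupE; split=> [G [hG _]|x y hx hy G hG]; first exact: subgroup1.
by have [_ h] := (subgroupE G).1 hG.1; apply: h; [exact: hx | exact: hy].
Qed.

Lemma commutator_conj (k x y : gT) :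
  (k * commutator x y * k^-1)%g = commutator (k * x * k^-1)%g (k * y * k^-1)%g.
Proof. by rewrite /commutator !invgM !invgK !mulgA !mulgVK. Qed.

Lemma commutator_eq1 (x y : gT) : commutator x y = 1%g <-> (x * y)%g = (y * x)%g.
Proof.
split=> [e|e]; last by rewrite /commutator e mulgK mulgV.
have : (commutator x y * y * x)%g = (1 * y * x)%g by rewrite e.
by rewrite /commutator !mulgVK mul1g.
Qed.

Lemma commutator_inv (x y : gT) : ((commutator x y)^-1)%g = commutator y x.
Proof. by rewrite /commutator !invgM !invgK !mulgA. Qed.

End Generation.

(** * Normalisers of a foliation *)

Section Classes.
Variable (S : setting).
Local Notation K := (sK S).
Local Notation v := (@sv S).
Local Notation U := (sU S).
Local Notation vf := (vf v (@scal S)).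
Local Notation act := (@act S).
Local Notation raises := (raises v).
Implicit Types (f a b c u p s r : K) (g h : U) (X Y Z V W : K -> K).

Lemma Ad_scale g X Y a : (forall f, Y f = a * X f) ->
  forall f, Ad g Y f = act g a * Ad g X f.
Proof. by move=> e f; rewrite /Ad e actM. Qed.

Lemma Ad_comb g X Y Z a b : (forall f, Z f = a * Y f + b * X f) ->
  forall f, Ad g Z f = act g a * Ad g Y f + act g b * Ad g X f.
Proof. by move=> e f; rewrite /Ad e actD !actM. Qed.

Lemma scale_inj X a b : nz X -> (forall f, a * X f = b * X f) -> a = b.
Proof. by move=> [f hf] e; exact: (mulIf hf (e f)). Qed.

Lemma ker_M X f k : vf X -> X f = 0 -> X k = 0 -> X (f * k) = 0.
Proof. by move=> hX hf hk; rewrite (vf_M hX) hf hk mulr0 mul0r addr0. Qed.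

Lemma ker_V X f : vf X -> X f = 0 -> X f^-1 = 0.
Proof. by move=> hX hf; rewrite (vf_V hX) hf oppr0 mul0r. Qed.

Definition preserves_foliation X g := exists u, forall f, Ad g X f = u * X f.

(** [g] multiplies [X] by a first integral of [X]. Then it acts on the field of first
    integrals and maps leaves to leaves by affine maps in the time coordinate of [X]. *)
Definition normalises X g := exists2 u, X u = 0 & forall f, Ad g X f = u * X f.

Lemma normalises_preserves_foliation X g : normalises X g -> preserves_foliation X g.
Proof. by move=> [u _ e]; exists u. Qed.

Lemma preserves_foliation_ker X g f : nz X -> preserves_foliation X g -> X f = 0 -> X (act g f) = 0.
Proof.
move=> nX [u e] hf; have u0 := parallel_coef_neq0 (nz_Ad g nX) e.
have := Ad_act g X f; rewrite e hf act0 => /eqP.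
by rewrite mulf_eq0 (negPf u0) => /eqP.
Qed.

Lemma preserves_foliation_inv X g u : nz X -> (forall f, Ad g X f = u * X f) ->
  forall f, Ad g^-1%g X f = (act g^-1%g u)^-1 * X f.
Proof.
move=> nX e f; have u0 := parallel_coef_neq0 (nz_Ad g nX) e.
have := Ad_scale g^-1%g e f; rewrite AdK => ->.
by rewrite mulKf // act_eq0.
Qed.

Lemma preserves_foliationV X g : nz X -> preserves_foliation X g -> preserves_foliation X g^-1%g.
Proof. by move=> nX [u /(preserves_foliation_inv nX) e]; eexists; exact: e. Qed.

Lemma preserves_foliation_kerV X g f : nz X -> preserves_foliation X g -> X f = 0 -> X (act g^-1%g f) = 0.
Proof. by move=> nX /(preserves_foliationV nX); exact: preserves_foliation_ker. Qed.

Lemma preserves_foliation_par X Z g : nz Z -> parallel X Z -> preserves_foliation Z g -> preserves_foliation X g.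
Proof.
move=> nZ [a e] [u hu]; have a0 := parallel_coef_neq0 nZ e.
exists ((act g a)^-1 * (u * a)) => f.
have := Ad_scale g e f; rewrite hu e => E.
by apply: (@mulfI _ (act g a)); rewrite ?act_eq0 // -E -mulrA mulVKf ?act_eq0 // mulrA.
Qed.

Lemma normalises1 X : vf X -> normalises X 1%g.
Proof. by move=> hX; exists 1 => [|f]; rewrite ?vf_1 // Ad1 mul1r. Qed.

Lemma normalisesM X g h : vf X -> nz X -> normalises X g -> normalises X h -> normalises X (g * h)%g.
Proof.
move=> hX nX Ng [u hu eh]; have Fg := normalises_preserves_foliation Ng; case: Ng => [w hw eg].
exists (act g u * w) => [|f]; first by apply: ker_M => //; exact: preserves_foliation_ker.
by rewrite AdM (Ad_scale g eh) eg mulrA.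
Qed.

Lemma normalisesV X g : vf X -> nz X -> normalises X g -> normalises X g^-1%g.
Proof.
move=> hX nX Ng; have Fg := normalises_preserves_foliation Ng; case: Ng => [w hw eg].
exists (act g^-1%g w)^-1; last exact: preserves_foliation_inv.
by apply: ker_V => //; exact: preserves_foliation_kerV.
Qed.

Lemma subgroup_normalises X : vf X -> nz X -> subgroup [set g | normalises X g].
Proof.
move=> hX nX; apply/subgroupE; split=> [|g h]; first exact: normalises1.
by move=> Ng Nh; apply: normalisesM => //; exact: normalisesV.
Qed.

(** The logarithm is a limit of combinations of iterates of [g], and [X] is continuous. *)
Lemma log_stable X g : vf X -> (forall f, X f = 0 -> X (act g f) = 0) ->
  forall f, X f = 0 -> X (log g f) = 0.
Proof.
move=> hX hg f hf; apply: lim_unique (vf_lim hX (log_lim g f)) _.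
apply: lim_eq (lim_cst v 0) => m /=; rewrite /log_seq (vf_sum hX) big1 // => i _.
rewrite (vf_M hX) (vf_logcoef hX) mul0r add0r.
suff -> : X (iter i (fun a => act g a - a) f) = 0 by rewrite mulr0.
by elim: (i : nat) => //= j IH; rewrite (vf_B hX) hg // IH subrr.
Qed.

Lemma log_comm X g : vf X -> (forall f, Ad g X f = X f) ->
  forall f, X (log g f) = log g (X f).
Proof.
move=> hX e f; apply: lim_unique (vf_lim hX (log_lim g f)) _.
apply: lim_eq (log_lim g (X f)) => m /=; rewrite /log_seq (vf_sum hX).
apply: eq_bigr => i _; rewrite (vf_M hX) (vf_logcoef hX) mul0r add0r; congr (_ * _).
elim: (i : nat) => //= j ->; rewrite (vf_B hX); congr (_ - _).
by rewrite -Ad_act e.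
Qed.

(** The infinitesimal form of [normalises]. The powers of [Ad g - 1] multiply [X] by first
    integrals; the Leibniz rule of [log_leibniz] for the pairing of vector fields with
    functions shows that the bracket of [log g] with [X] is the limit of the corresponding
    logarithmic series, and a limit of first integrals is one. *)
Lemma normalises_bracket X g : vf X -> nz X -> normalises X g ->
  exists2 p, X p = 0 & forall f, log g (X f) - X (log g f) = p * X f.
Proof.
move=> hX nX Ng; have Fg := normalises_preserves_foliation Ng; case: Ng => [u hu e].
have [b hb] := vf_raises hX.
pose pk k := iter k (fun a => act g a * u - a) 1.
have kpk k : X (pk k) = 0.
  elim: k => [|k IH]; first by rewrite vf_1.
  by rewrite /= (vf_B hX) IH subr0 ker_M //; exact: preserves_foliation_ker.
pose N (Y : K -> K) := Ad g Y - Y.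
have NE k f : iter k N X f = pk k * X f.
  elim: k f => [|k IH] f; first by rewrite mul1r.
  rewrite iterS /N /GRing.add /GRing.opp /= (Ad_scale g IH) IH e mulrA -mulrBl.
  by [].
have vfN k : vf (iter k N X).
  have -> : iter k N X = fun f => pk k * X f by apply/funext.
  exact: vf_scale.
have raN k : raises (b + k%:Z) (iter k N X).
  elim: k => [|k IH]; first by rewrite addr0.
  rewrite (_ : b + k.+1%:Z = b + k%:Z + 1); last by lia.
  move=> n f hf; have := raises_Ad g (vfN k) IH hf.
  by rewrite iterS.
have near f m n : v n f ->
    v (n + b + m%:Z) (log_seq (act g) (X f) m -
      ((\sum_(k < m) logcoef K k * pk k) * X f + X (log_seq (act g) f m))).
  move=> hf.
  have -> : (\sum_(k < m) logcoef K k * pk k) * X f + X (log_seq (act g) f m) =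
      \sum_(k < m) logcoef K k * (iter k N X (iter 0 (delta g) f)) +
      \sum_(k < m) logcoef K k * (iter 0 N X (iter k (delta g) f)).
    congr (_ + _); first by rewrite mulr_suml; apply: eq_bigr => k _; rewrite NE mulrA.
    rewrite /log_seq (vf_sum hX); apply: eq_bigr => k _.
    by rewrite (vf_M hX) (vf_logcoef hX) mul0r add0r.
  apply: (@log_leibniz _ v _ _ (fun i j => iter i N X (iter j (delta g) f))).
  - move=> k; rewrite -iter_binomial; last exact: actD.
    have -> : iter k (act g) (X f) = iter k (Ad g) X (iter k (act g) f).
      by elim: k => //= k ->; rewrite Ad_act.
    rewrite !iter_binomial; first last.
    + by move=> Y Z; apply/funext => a; rewrite /Ad /GRing.add /= actD.
    + exact: actD.
    rewrite fct_sumE; apply: eq_bigr => i _.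
    rewrite (_ : (iter i (fun Y => Ad g Y - Y) X *+ 'C(k, i)) = (iter i N X *+ 'C(k, i))) //.
    rewrite -/(delta g) natmulfctE (vf_sum (vfN i)) -sumrMnl; apply: eq_bigr => j _.
    by rewrite (vf_Mn (vfN i)) -mulrnA mulnC.
  - by move=> k; apply: iter_delta_ge; exact: hb.
  - move=> i j; have := raN i _ _ (iter_delta_ge g j hf).
    by apply: ge_le; lia.
pose q m := \sum_(k < m) logcoef K k * pk k.
have kq m : X (q m) = 0.
  rewrite (vf_sum hX) big1 // => k _; apply: ker_M => //; exact: (vf_logcoef hX).
have limq f : lim v (fun m => q m * X f) (log g (X f) - X (log g f)).
  have [n hn] := ge_bound v f.
  apply: lim_close (limB (log_lim g (X f)) (vf_lim hX (log_lim g f))).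
  apply: (@near_lim S _ _ (n + b)) => m /=.
  have := near f m n hn; rewrite -/(q m).
  by rewrite opprD addrA addrAC.
have [f0 hf0] := nX.
have limq0 : lim v q ((log g (X f0) - X (log g f0)) / X f0).
  by apply: lim_eq (limMr (X f0)^-1 (limq f0)) => m; rewrite mulfK.
exists ((log g (X f0) - X (log g f0)) / X f0) => [|f].
  apply: lim_unique (vf_lim hX limq0) _.
  by apply: lim_eq (lim_cst v 0) => m /=; rewrite kq.
exact: lim_unique (limq f) (limMr (X f) limq0).
Qed.

Lemma commuting_coef X Y Z a b : vf X -> nz X -> ~ parallel X Y ->
  (forall f, X (Y f) = Y (X f)) -> (forall f, X (Z f) = Z (X f)) ->
  (forall f, Z f = a * Y f + b * X f) -> X a = 0 /\ X b = 0.
Proof.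
move=> hX nX hXY eY eZ e; apply: (indep nX hXY) => f.
have := eZ f; rewrite !e (vf_D hX) !(vf_M hX) eY => /eqP.
by rewrite -subr_eq0 => /eqP <-; ring.
Qed.

Lemma Cst_eigen g V r : vf V -> nz V -> Cst r -> (forall f, Ad g V f = r * V f) -> r = 1.
Proof.
move=> hV [f hf] hr e; apply/eqP; rewrite -subr_eq0; apply/eqP/Cst_ge1.
  by apply: CstB => //; exact: Cst1.
by apply: (@unipotent _ (fun=> True) g V r) => //; exists f.
Qed.

(** In this case the first integrals of [X] determine its foliation ([ker_par]). *)
Definition nonCst X := exists2 f, X f = 0 & ~ Cst f.

Lemma nonCstPn X : ~ nonCst X -> forall f, X f = 0 -> Cst f.
Proof. by move=> h f hf; apply: contrapT => hc; apply: h; exists f. Qed.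

Lemma ker_par X Y : vf X -> vf Y -> nz X -> nonCst X -> (forall f, X f = 0 -> Y f = 0) -> parallel X Y.
Proof.
move=> hX hY nX [f hf hc] e; apply: contrapT => h; apply: hc.
by apply: (Cst_ker hX hY nX h) => //; exact: e.
Qed.

Lemma ker_move X V : vf X -> vf V -> nz X -> nonCst X -> ~ parallel X V ->
  exists2 f, X f = 0 & V f != 0.
Proof.
move=> hX hV nX cX hXV; apply: contrapT => h; apply: hXV; apply: ker_par => // f hf.
by apply/eqP/negPn/negP => hVf; apply: h; exists f.
Qed.

(** This is [unipotent] on the field of first integrals of [X], where the term in [X]
    disappears. *)
Lemma Cst_eigen_mod X g V a b : vf X -> nz X -> nonCst X -> vf V -> ~ parallel X V ->
  preserves_foliation X g -> Cst a -> (forall f, Ad g V f = a * V f + b * X f) -> a = 1.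
Proof.
move=> hX nX cX hV hXV Fg ha e; apply/eqP; rewrite -subr_eq0; apply/eqP/Cst_ge1.
  by apply: CstB => //; exact: Cst1.
apply: (@unipotent _ (fun f => X f = 0) g V a) => //.
- by move=> f k hf hk; rewrite (vf_B hX) hf hk subrr.
- by move=> f; exact: preserves_foliation_kerV.
- exact: ker_move.
- by move=> f hf; rewrite e hf mulr0 addr0.
Qed.

Lemma fix_par X g : vf X -> nz X -> nonCst X -> (forall f, X f = 0 -> act g f = f) -> parallel X (log g).
Proof.
by move=> hX nX cX e; apply: ker_par => // [|f hf]; [exact: vf_log | apply: log_fixed; exact: e].
Qed.

Lemma parallel_fix X g f : parallel X (log g) -> X f = 0 -> act g f = f.
Proof. by move=> [s e] hf; apply: fixed_log; rewrite e hf mulr0. Qed.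

(** On the first integrals of [X] every logarithm is a multiple of the derivation [V]. If [g]
    commutes with [V] there, the factor is fixed by [g], hence killed by [log g] and so by
    [V], and it is a constant. Thus any other [h] commuting with [V] preserves [log g] on
    the first integrals, and therefore commutes with [g] there ([eq_act_of_log]). *)
Lemma comm_on_ker X V (P : set U) : vf X -> nz X -> vf V -> ~ parallel X V ->
  (forall f, X f = 0 -> X (V f) = 0) ->
  (forall g, P g -> preserves_foliation X g) -> (forall g, P g -> forall f, X f = 0 -> Ad g V f = V f) ->
  forall g h f, P g -> P h -> X f = 0 -> act g (act h f) = act h (act g f).
Proof.
move=> hX nX hV hXV stV PF PV g h f Pg Ph hf.
have [cX|cX] := pselect (nonCst X); last by rewrite !(Cst_act _ (nonCstPn cX hf)).
have [f0 hf0 Vf0] := ker_move hX hV nX cX hXV.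
have Fg := PF _ Pg; have Fh := PF _ Ph.
have hl := vf_log g.
have [al [be E]] := rank2 hX hV hl nX hXV.
have E0 k : X k = 0 -> log g k = al * V k by move=> hk; rewrite E hk mulr0 addr0.
have Xal : X al = 0.
  have -> : al = log g f0 * (V f0)^-1 by rewrite E0 // mulfK.
  apply: ker_M => //; last by apply: ker_V => //; exact: stV.
  by apply: log_stable => // k; exact: preserves_foliation_ker.
have gal : act g al = al.
  apply: (mulIf Vf0); rewrite -E0 // -(PV _ Pg _ hf0) /Ad -actM -E0; last exact: preserves_foliation_kerV.
  by rewrite -/(Ad g (log g) f0) Ad_log mulgK.
have Cal : Cst al.
  have : al * V al = 0 by rewrite -E0 // log_fixed.
  move/eqP; rewrite mulf_eq0 => /orP[/eqP ->|/eqP Val]; first exact: Cst0.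
  exact: (Cst_ker hX hV nX hXV).
suff H : forall k, X k = 0 -> act (h * g * h^-1)%g k = act g k.
  have := H (act h f) (preserves_foliation_ker nX Fh hf).
  by rewrite !actMg actK => ->.
apply: eq_act_of_log => [a b ha hb|a ha|a ha|a ha].
- by rewrite (vf_B hX) ha hb subrr.
- by rewrite !actMg; do 2!apply: preserves_foliation_ker => //; exact: preserves_foliation_kerV.
- exact: preserves_foliation_ker.
rewrite -Ad_log /Ad E0; last exact: preserves_foliation_kerV.
by rewrite actM (Cst_act h Cal) -/(Ad h V a) (PV _ Ph) // E0.
Qed.

(** * Adapted sets of automorphisms *)

(** This refines solvability ([adapted_derived3]) and, unlike it, restricts how an
    automorphism may conjugate elements of [P] into [P]. *)
Record adapted (P : set U) X : Prop := Adapted {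
  adapted_vf : vf X;
  adapted_nz : nz X;
  adapted_normalises : forall g, P g -> normalises X g;
  adapted_comm : forall g h f, P g -> P h -> X f = 0 -> act g (act h f) = act h (act g f) }.

Lemma adapted_sub (P Q : set U) X : Q `<=` P -> adapted P X -> adapted Q X.
Proof.
move=> QP [hX nX N C]; split=> // [g /QP|g h f /QP hg /QP hh]; [exact: N | exact: C].
Qed.

Lemma adapted_gen P X : adapted P X -> adapted (generated_subgroup P) X.
Proof.
move=> [hX nX N C].
have step (Q : set U) : (forall q, Q q -> preserves_foliation X q) ->
    subgroup [set g | normalises X g /\ forall h f, Q h -> X f = 0 -> act g (act h f) = act h (act g f)].
  move=> QF; apply/subgroupE; split=> [|x y [Nx Cx] [Ny Cy]].
    by split=> [|h f _ _]; [exact: normalises1 | rewrite !act1g].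
  have Ny' := normalisesV hX nX Ny; split=> [|h f Qh hf]; first exact: normalisesM.
  have hyf : X (act y^-1%g f) = 0 by apply: preserves_foliation_ker => //; exact: normalises_preserves_foliation.
  rewrite !actMg -Cx //; congr (act x _).
  rewrite -[in LHS](actVK y f) -Cy // actK //.
have NG g : generated_subgroup P g -> normalises X g.
  by apply: gen_sub => //; exact: subgroup_normalises.
have CG g : generated_subgroup P g -> forall h f, P h -> X f = 0 -> act g (act h f) = act h (act g f).
  move=> hg; suff [] : [set g | normalises X g /\ forall h f, P h -> X f = 0 ->
      act g (act h f) = act h (act g f)] g by [].
  apply: (gen_sub (P := P)) hg; first by apply: step => q /N /normalises_preserves_foliation.
  by move=> x Px; split=> [|h f Ph hf]; [exact: N | exact: C].
split=> // g h f hg hh hf.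
suff [_ H] : [set g | normalises X g /\ forall h f, generated_subgroup P h -> X f = 0 ->
    act g (act h f) = act h (act g f)] g by exact: H.
apply: (gen_sub (P := P)) hg; first by apply: step => q /NG /normalises_preserves_foliation.
by move=> x Px; split=> [|k a Gk ha]; [exact: N | exact/esym/CG].
Qed.

(** When the first integrals of [X] are constants, [g] and [h] fix [X] by unipotency. The
    vector fields commuting with [X] then form a space of dimension at most two over the
    constants, on which [g] acts fixing [X] and [log g]. Either these two span it, or
    [log g] is a constant multiple of [X], which [h] fixes. *)
Lemma normalises_comm X g h : vf X -> nz X -> ~ nonCst X -> normalises X g -> normalises X h -> (g * h)%g = (h * g)%g.
Proof.
move=> hX nX /nonCstPn cX Ng Nh.
have fixX k : normalises X k -> forall f, Ad k X f = X f.
  by move=> [u hu e] f; rewrite e (Cst_eigen hX nX (cX _ hu) e) mul1r.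
have eg := fixX _ Ng; have eh := fixX _ Nh.
have cg := log_comm hX eg; have ch := log_comm hX eh.
have hg := vf_log g; have hh := vf_log h.
apply: comm_of_Ad_log.
have scl k l a : normalises X l -> (forall f, X (log k f) = log k (X f)) ->
    (forall f, log k f = a * X f) -> (l * k)%g = (k * l)%g.
  move=> Nl ck ek; apply: comm_of_Ad_log => f.
  have Xa : X a = 0.
    have [f0 hf0] := nX; have := ck f0; rewrite !ek (vf_M hX) => /eqP.
    by rewrite addrC -subr_eq0 addrAC subrr add0r mulf_eq0 (negPf hf0) orbF => /eqP.
  by rewrite (Ad_scale l ek) (Cst_act _ (cX _ Xa)) fixX // ek.
have [[s es]|hp] := pselect (parallel X (log h)).
  by apply: Ad_log_id; exact: (scl h g s).
have [a [b E]] := rank2 hX hh hg nX hp.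
have [al [be EA]] := rank2 hX hh (vf_Ad g hh) nX hp.
have [Xa Xb] := commuting_coef hX nX hp ch cg E.
have cAd f : X (Ad g (log h) f) = Ad g (log h) (X f).
  by rewrite -eg /Ad actK ch -/(Ad g (log h) _) -[in RHS]eg /Ad actK.
have [Xal Xbe] := commuting_coef hX nX hp ch cAd EA.
have [a0|a0] := eqVneq a 0.
  apply: Ad_log_id; apply/esym/(scl g h b) => // f.
  by rewrite E a0 mul0r add0r.
have Eg f : a * (al - 1) * log h f + a * be * X f = 0.
  have := Ad_comb g E f; rewrite Ad_log mulgK eg EA E.
  rewrite !(Cst_act _ (cX _ _)) // => /eqP; rewrite eq_sym -subr_eq0 => /eqP <-.
  by ring.
have [/eqP h1 /eqP h2] := indep nX hp Eg.
move: h1 h2; rewrite !mulf_eq0 (negPf a0) subr_eq0 => /eqP e1 /eqP e2 f.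
by rewrite EA e1 e2 mul1r mul0r addr0.
Qed.

Section Subgroup.
Variables (H : set U) (X : K -> K).
Hypotheses (HG : subgroup H) (HC : adapted H X).
Let hX := adapted_vf HC.
Let nX := adapted_nz HC.

Lemma adapted_preserves_foliation g : H g -> preserves_foliation X g.
Proof. by move=> hg; exact: normalises_preserves_foliation (adapted_normalises HC hg). Qed.

Lemma comm_fix g h f : H g -> H h -> X f = 0 -> act (commutator g h) f = f.
Proof.
move=> hg hh hf; rewrite /commutator !actMg.
have hg' := subgroupV HG hg; have hh' := subgroupV HG hh.
have k : X (act g^-1%g (act h^-1%g f)) = 0.
  apply: preserves_foliation_ker => //; first exact: adapted_preserves_foliation.
  by apply: preserves_foliation_ker => //; exact: adapted_preserves_foliation.
by rewrite (adapted_comm HC hg hh k) !actVK.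
Qed.

Lemma conj_log_ker g h f : H g -> H h -> X f = 0 -> Ad g (log h) f = log h f.
Proof.
move=> hg hh; rewrite Ad_log.
apply: (@log_local _ (fun f => X f = 0)) => [a b ha hb|a ha|a ha].
- by rewrite (vf_B hX) ha hb subrr.
- apply: preserves_foliation_ker => //; apply: adapted_preserves_foliation.
  by do 2?[apply: subgroupM => //]; exact: subgroupV.
rewrite !actMg (adapted_comm HC hg hh) ?actVK //.
by apply: preserves_foliation_ker => //; apply: adapted_preserves_foliation; exact: subgroupV.
Qed.

(** The factor [a] is a first integral of [X] because both logarithms act on first
    integrals. It is fixed by [g], since [g] commutes with [h] there, so that [log g] kills
    it as well. *)
Lemma adapted_coef_Cst g h a b : nonCst X -> H g -> H h -> ~ parallel X (log g) ->
  (forall f, log h f = a * log g f + b * X f) -> Cst a.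
Proof.
move=> cX hg hh hp e; have hl := vf_log g.
have [f0 hf0 Lf0] := ker_move hX hl nX cX hp.
have st k : H k -> forall f, X f = 0 -> X (log k f) = 0.
  by move=> hk; apply: log_stable => // f; apply: preserves_foliation_ker => //; exact: adapted_preserves_foliation.
have e0 f : X f = 0 -> log h f = a * log g f by move=> hf; rewrite e hf mulr0 addr0.
have Xa : X a = 0.
  have -> : a = log h f0 * (log g f0)^-1 by rewrite e0 // mulfK.
  by apply: ker_M => //; [exact: st | apply: ker_V => //; exact: st].
have ga : act g a = a.
  apply: (mulIf Lf0); rewrite -e0 // -(conj_log_ker hg hg hf0) /Ad -actM -e0.
    exact: conj_log_ker.
  by apply: preserves_foliation_kerV => //; exact: adapted_preserves_foliation.
by apply: (Cst_ker hX hl nX hp) => //; exact: log_fixed.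
Qed.

Lemma adapted_mod g h : nonCst X -> H g -> H h -> ~ parallel X (log g) ->
  exists a b, Cst a /\ forall f, log h f = a * log g f + b * X f.
Proof.
move=> cX hg hh hp; have [a [b e]] := rank2 hX (vf_log g) (vf_log h) nX hp.
by exists a, b; split=> //; exact: (adapted_coef_Cst cX hg hh hp e).
Qed.

End Subgroup.

(** Compare the bracket of [s X] with [X] given by [normalises_bracket] with its direct
    computation, which is [- X s] times [X]. In the time coordinate of [X] along the leaves,
    [s] is thus an affine function. *)
Lemma log_affine X g s : vf X -> nz X -> normalises X g -> (forall f, log g f = s * X f) -> X (X s) = 0.
Proof.
move=> hX nX Ng e; have [p Xp B] := normalises_bracket hX nX Ng.
have [f0 hf0] := nX; suff -> : X s = - p by rewrite (vf_N hX) Xp oppr0.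
apply: (mulIf hf0); have := B f0; rewrite !e (vf_M hX) => h.
by rewrite mulNr -h; ring.
Qed.

Lemma comb_affine X Y g h a b s : vf X -> nz X -> normalises X g -> normalises X h -> Cst a -> Cst b ->
  (forall f, Y f = a * log g f + b * log h f) -> (forall f, Y f = s * X f) -> X (X s) = 0.
Proof.
move=> hX nX Ng Nh Ca Cb eY e.
have [p Xp Bg] := normalises_bracket hX nX Ng; have [q Xq Bh] := normalises_bracket hX nX Nh.
have [f0 hf0] := nX; suff -> : X s = - (a * p + b * q).
  by rewrite (vf_N hX) (vf_D hX) !(ker_M hX) ?(Ca _ hX) ?(Cb _ hX) // addr0 oppr0.
apply: (mulIf hf0).
have E1 : Y (X f0) - X (Y f0) = (a * p + b * q) * X f0.
  have E k l x : log k (X f0) - X (log k f0) = x * X f0 ->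
      l * log k (X f0) - l * X (log k f0) = l * x * X f0.
    by move=> E; rewrite -mulrBr E mulrA.
  rewrite !eY (vf_D hX) !(vf_M hX) (Ca _ hX) (Cb _ hX) mulrDl.
  by rewrite -(E _ a _ (Bg f0)) -(E _ b _ (Bh f0)); ring.
by rewrite mulNr -E1 !e (vf_M hX); ring.
Qed.

Section Leafwise.
Variables (X : K -> K) (g h : U).
Hypotheses (hX : vf X) (nX : nz X) (Ng : normalises X g) (Nh : normalises X h).
Hypothesis fg : forall f, X f = 0 -> act g f = f.
Hypothesis fh : forall f, X f = 0 -> act h f = f.
Local Notation e := (commutator g h).

Lemma comm_leafwise f : X f = 0 -> act e f = f.
Proof.
have fV k : (forall f, X f = 0 -> act k f = f) -> forall f, X f = 0 -> act k^-1%g f = f.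
  by move=> fk a ha; rewrite -{1}(fk a ha) actK.
by move=> hf; rewrite /commutator !actMg (fV h) // (fV g) // fh // fg.
Qed.

Lemma comm_Ad_id f : Ad e X f = X f.
Proof.
case: Ng Nh => [u hu eg] [w hw eh].
have Em k : Ad (h * g)%g X k = w * u * X k.
  by rewrite AdM (Ad_scale h eg) fh // eh mulrCA mulrA.
have Em' k : Ad (g * h)%g X k = w * u * X k.
  by rewrite AdM (Ad_scale g eh) fg // eg mulrA.
have m0 : w * u != 0 := parallel_coef_neq0 (nz_Ad _ nX) Em.
have em : (e * (h * g))%g = (g * h)%g by rewrite /commutator !mulgA !mulgVK.
apply: (mulfI m0); rewrite -Em' -em AdM (Ad_scale e Em) comm_leafwise //.
by apply: ker_M.
Qed.

(** In the time coordinate of [X], both act on each leaf by affine maps, so that their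
    commutator is a translation: its logarithm is a first integral times [X]. *)
Lemma comm_translation : nonCst X -> exists2 s, X s = 0 & forall f, log e f = s * X f.
Proof.
move=> cX; have [s es] := fix_par hX nX cX comm_leafwise.
have es' : act e s = s.
  apply: (scale_inj nX) => f.
  by rewrite -[in LHS](comm_Ad_id f) -(Ad_scale e es) Ad_log mulgK es.
have : s * X s = 0 by rewrite -es log_fixed.
move/eqP; rewrite mulf_eq0 => /orP[/eqP s0|/eqP Xs]; last by exists s.
by exists s => //; rewrite s0 (vf_0 hX).
Qed.

End Leafwise.

End Classes.

(** * Adapted groups are solvable *)

Section Main.
Variable (S : setting).
Local Notation K := (sK S).
Local Notation v := (@sv S).
Local Notation U := (sU S).
Local Notation vf := (vf v (@scal S)).
Local Notation act := (@act S).
Local Notation raises := (raises v).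
Implicit Types (f a b c u p s r : K) (g h : U) (X Y Z V W : K -> K).

(** Commutators fix the first integrals of [X]. Commutators of such elements preserve [X]
    besides, and two elements with both properties have logarithms that are multiples of
    [X] by first integrals, so that they commute. If all first integrals are constants the
    group is already abelian ([normalises_comm]). *)
Lemma adapted_derived3 (H : set U) X : subgroup H -> adapted H X -> derived_subgroup 3 H = [set 1%g].
Proof.
move=> HG HC; have hX := adapted_vf HC; have nX := adapted_nz HC.
have one (G : set U) : subgroup G -> (forall x, G x -> x = 1%g) -> G = [set 1%g].
  move=> hG h; apply/seteqP; split=> x; first exact: h.
  by move=> ->; exact: subgroup1.
have der (G B : set U) : subgroup B -> (forall x y, G x -> G y -> B (commutator x y)) ->
    generated_subgroup (commutators G G) `<=` B.
  by move=> hB h; apply: gen_sub => // z [x hx [y hy <-]]; exact: h.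
have sub1 : subgroup [set 1%g : U].
  by apply/subgroupE; split=> // x y -> ->; rewrite /= mulgV.
apply: one; first exact: gen_subgroup.
have [cX|cX] := pselect (nonCst X); last first.
  have H1 : derived_subgroup 1 H `<=` [set 1%g].
    apply: der => // x y hx hy; apply/commutator_eq1.
    by apply: (normalises_comm hX nX cX); exact: (adapted_normalises HC).
  have H2 : derived_subgroup 2 H `<=` [set 1%g].
    by apply: der => // x y /H1 -> /H1 ->; apply/commutator_eq1.
  by apply: der => // x y /H2 -> /H2 ->; apply/commutator_eq1.
(* [B1] and [B2] contain the first and second derived subgroups; [B2] is abelian *)
pose B1 := [set g | normalises X g /\ forall f, X f = 0 -> act g f = f].
pose B2 := [set g | forall f, Ad g X f = X f] `&` B1.
have sB1 : subgroup B1.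
  apply/subgroupE; split=> [|x y [Nx Fx] [Ny Fy]].
    by split=> [|f _]; [exact: normalises1 | rewrite act1g].
  split=> [|f hf]; first by apply: normalisesM => //; exact: normalisesV.
  have hf' : X (act y^-1%g f) = 0 by apply: preserves_foliation_kerV => //; exact: normalises_preserves_foliation.
  by rewrite actMg Fx // -[RHS](actVK y) Fy.
have sB2 : subgroup B2.
  apply/subgroupE; split=> [|x y [Ex Bx] [Ey By]].
    by split=> [f|]; [exact: Ad1 | exact: subgroup1].
  split; last by have [_ h] := (subgroupE B1).1 sB1; exact: h.
  move=> f; rewrite AdM -(Ex f); apply: eq_Ad => a.
  by rewrite -(AdK y X a); apply: eq_Ad => ?; rewrite Ey.
have H1 : derived_subgroup 1 H `<=` B1.
  apply: der => // x y hx hy; split=> [|f hf]; last exact: (comm_fix HG HC hx hy).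
  by apply: (adapted_normalises HC); exact: subgroup_comm.
have H2 : derived_subgroup 2 H `<=` B2.
  apply: der => // x y /H1 Bx /H1 By; split; last exact: subgroup_comm.
  exact: (comm_Ad_id hX nX Bx.1 By.1 Bx.2 By.2).
apply: der => // x y /H2[Ex [Nx Fx]] /H2[Ey [Ny Fy]].
apply/commutator_eq1; apply: comm_of_Ad_log => f.
have [s es] := fix_par hX nX cX Fy.
have Xs : s * X s = 0.
  rewrite -es log_fixed //; apply: (scale_inj nX) => a.
  by rewrite -[in LHS]Ey -(Ad_scale y es) Ad_log mulgK es.
rewrite (Ad_scale x es) Ex es Fx //.
by move/eqP: Xs; rewrite mulf_eq0 => /orP[/eqP ->|/eqP //]; exact: (vf_0 hX).
Qed.

(** * The plane spanned by two commuting logarithms *)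

Section Plane.
Variables (z1 z2 : U).
Hypothesis z12 : (z1 * z2)%g = (z2 * z1)%g.
Hypothesis n1 : nz (log z1).
Hypothesis ind : ~ parallel (log z1) (log z2).
Local Notation Z1 := (log z1).
Local Notation Z2 := (log z2).
Let h1 := vf_log z1.
Let h2 := vf_log z2.

Definition plane Y := exists a b, [/\ Cst a, Cst b & forall f, Y f = a * Z1 f + b * Z2 f].

Lemma plane1 : plane Z1.
Proof.
by exists 1, 0; split=> [||f]; [exact: Cst1 | exact: Cst0 | rewrite mul1r mul0r addr0].
Qed.

Lemma plane2 : plane Z2.
Proof.
by exists 0, 1; split=> [||f]; [exact: Cst0 | exact: Cst1 | rewrite mul1r mul0r add0r].
Qed.

Lemma plane_comb a b Y Y' Y'' : Cst a -> Cst b -> plane Y -> plane Y' ->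
  (forall f, Y'' f = a * Y f + b * Y' f) -> plane Y''.
Proof.
move=> Ca Cb [c [d [Cc Cd e]]] [c' [d' [Cc' Cd' e']]] E.
exists (a * c + b * c'), (a * d + b * d'); split; try by apply: CstD; apply: CstM.
by move=> f; rewrite E e e'; ring.
Qed.

Lemma plane_vf Y : plane Y -> vf Y.
Proof.
move=> [a [b [_ _ e]]]; have -> : Y = fun f => a * Z1 f + b * Z2 f by apply/funext.
exact: vf_comb.
Qed.

Lemma plane_fix t Y : (t * z1)%g = (z1 * t)%g -> (t * z2)%g = (z2 * t)%g -> plane Y ->
  forall f, Ad t Y f = Y f.
Proof.
move=> c1 c2 [a [b [Ca Cb e]]] f.
by rewrite (Ad_comb t e) !Ad_log_id // !Cst_act.
Qed.

Lemma plane_coef_Cst a : Z1 a = 0 -> Z2 a = 0 -> Cst a.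
Proof. exact: Cst_ker. Qed.

(** The coefficients of [log t] in the basis of the two logarithms are fixed by [z1] and
    [z2], hence killed by two independent vector fields. *)
Lemma plane_log t : (t * z1)%g = (z1 * t)%g -> (t * z2)%g = (z2 * t)%g -> plane (log t).
Proof.
move=> c1 c2; have [a [b e]] := rank2 h1 h2 (vf_log t) n1 ind.
have fixed z : (z * z1)%g = (z1 * z)%g -> (z * z2)%g = (z2 * z)%g -> (z * t)%g = (t * z)%g ->
    log z a = 0 /\ log z b = 0.
  move=> d1 d2 dt; suff [ea eb] : act z a - a = 0 /\ act z b - b = 0.
    by split; apply: log_fixed; apply/eqP; rewrite -subr_eq0 ?ea ?eb.
  apply: (indep n1 ind) => f.
  have : Ad z (log t) f - log t f = 0 by rewrite Ad_log_id // subrr.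
  by rewrite (Ad_comb z e) e !Ad_log_id // => <-; ring.
have [a1 b1] := fixed z1 erefl z12 (esym c1).
have [a2 b2] := fixed z2 (esym z12) erefl (esym c2).
by exists b, a; split=> [||f]; try exact: plane_coef_Cst; rewrite e addrC.
Qed.

Lemma plane_comm Y Y' f : plane Y -> plane Y' -> Y (Y' f) = Y' (Y f).
Proof.
have c12 k : Z1 (Z2 k) = Z2 (Z1 k) by apply/esym/log_comm => // a; exact: Ad_log_id.
move=> [a [b [Ca Cb e]]] [a' [b' [Ca' Cb' e']]].
rewrite !(e, e') !(vf_D h1) !(vf_D h2) !(vf_M h1) !(vf_M h2).
rewrite !(Ca _ h1, Ca _ h2, Cb _ h1, Cb _ h2, Ca' _ h1, Ca' _ h2, Cb' _ h1, Cb' _ h2) c12.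
by ring.
Qed.

Lemma plane_scale W W' a : plane W -> plane W' -> nz W -> (forall f, W' f = a * W f) -> Cst a.
Proof.
move=> pW pW' [f0 hf0] e.
have H Y : vf Y -> plane Y -> Y a = 0.
  move=> hY pY; apply: (mulIf hf0); rewrite mul0r.
  have := plane_comm f0 pY pW'; rewrite !e (vf_M hY) (plane_comm f0 pY pW).
  by move/eqP; rewrite addrC -subr_eq0 addrAC subrr add0r => /eqP.
by apply: plane_coef_Cst; apply: H => //; [exact: plane1 | exact: plane2].
Qed.

Lemma plane_span W Y Y' : plane W -> plane Y -> plane Y' -> nz W -> nz Y -> ~ parallel W Y ->
  exists a b, [/\ Cst a, Cst b & forall f, Y' f = a * W f + b * Y f].
Proof.
move=> pW pY pY' nW nY hp.
have hW := plane_vf pW; have hY := plane_vf pY; have hY' := plane_vf pY'.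
have hp' : ~ parallel Y W by move=> h; apply: hp; exact: parallel_sym.
have [b [a e]] := rank2 hW hY hY' nW hp.
have e' f : Y' f = a * W f + b * Y f by rewrite e addrC.
have [Wb Wa] := commuting_coef hW nW hp (fun f => plane_comm f pW pY) (fun f => plane_comm f pW pY') e.
have [Ya Yb] := commuting_coef hY nY hp' (fun f => plane_comm f pY pW) (fun f => plane_comm f pY pY') e'.
by exists a, b; split=> //; exact: (Cst_ker hW hY nW hp).
Qed.

Lemma raises_le (m n : int) Y : m <= n -> raises n Y -> raises m Y.
Proof. by move=> h hY k f hf; apply: ge_le (hY _ _ hf); rewrite lerD2l. Qed.

Lemma raises_comb (n : int) a b Y Y' Y'' : Cst a -> Cst b -> raises n Y -> raises n Y' ->
  (forall f, Y'' f = a * Y f + b * Y' f) -> raises n Y''.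
Proof.
by move=> Ca Cb hY hY' e k f hf; rewrite e; apply: geD; apply: geMl; try exact: Cst_ge0;
  [exact: hY | exact: hY'].
Qed.

Lemma plane_raises Y : plane Y -> raises 1 Y.
Proof.
by move=> [a [b [Ca Cb e]]]; apply: raises_comb e => //; exact: log_raises.
Qed.

Lemma exact_order Y : vf Y -> nz Y -> exists n : int, raises n Y /\ ~ raises (n + 1) Y.
Proof.
move=> hY [f0 hf0]; have [|n [h [k [f [_ hf hn]]]]] := @exact_raises S (fun=> True) Y hY.
  by exists f0.
exists n; split=> [m a ha|hr]; first exact: h.
by apply: hn; have := hr _ _ hf; rewrite addrA.
Qed.

(** The order of vanishing filters the plane by subspaces; take [W] in the last nonzero one.
    A unipotent operator that preserves the plane fixes it. *)
Lemma plane_max : exists W (n : int), [/\ plane W, nz W, raises n W &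
  forall Y, plane Y -> raises (n + 1) Y -> forall f, Y f = 0].
Proof.
have [n [rn nrn]] := exact_order h1 n1.
have [all|] := pselect (forall Y, plane Y -> raises (n + 1) Y -> forall f, Y f = 0).
  by exists Z1, n; split=> //; exact: plane1.
move=> /existsNP[Y /not_implyP[pY /not_implyP[rY]]] /existsNP[f0 /eqP hf0].
have nY : nz Y by exists f0.
have [m [rm nrm]] := exact_order (plane_vf pY) nY.
have nm : n + 1 <= m.
  by rewrite leNgt; apply/negP => h; apply: nrm; apply: raises_le rY; lia.
have C0 := @Cst0 S.
have nYZ : ~ parallel Y Z1.
  move=> [a e]; apply: nrn.
  have Ca := plane_scale pY plane1 nY e.
  by apply: (raises_comb Ca C0 rY rY) => f; rewrite e mul0r addr0.
exists Y, m; split=> // Y' pY' rY' f; apply/eqP/negPn/negP => hf.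
have nY' : nz Y' by exists f.
have [a [b [Ca Cb e]]] := plane_span pY plane1 pY' nY n1 nYZ.
have [b0|b0] := eqVneq b 0.
  have a0 : a != 0.
    by apply: contraNneq hf => a0; rewrite e a0 b0 !mul0r addr0.
  apply: nrm; apply: (raises_comb (CstV Ca) C0 rY' rY') => k.
  by rewrite e b0 !mul0r !addr0 mulKf.
apply: nrn.
have Cab : Cst (- a * b^-1) by apply: CstM; [rewrite -sub0r; exact: CstB | exact: CstV].
apply: (raises_comb (CstV Cb) Cab (raises_le _ rY') rY) => [|k]; first by lia.
by rewrite e; field.
Qed.

End Plane.

(** * The descending step *)

(** Here [s X] and its image [sg X] are affine along the leaves of [X]. Applying [F] to the
    first integral [X s] gives [sg * X w / w] as a difference of first integrals. Two such
    relations with [X w] nonzero make the coefficients [sg] proportional over the first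
    integrals. *)
Lemma affine_distortion X F w s sg : vf X -> nz X -> (forall f, Ad F X f = w * X f) ->
  act F s * w = sg -> X (X s) = 0 -> X (X sg) = 0 -> X (sg * X w / w) = 0.
Proof.
move=> hX nX e es Xs Xsg; have w0 := parallel_coef_neq0 (nz_Ad F nX) e.
have FF : preserves_foliation X F by exists w.
have eF : act F s = sg / w by rewrite -es mulfK.
have := Ad_act F X s; rewrite e eF (vf_div hX) // => E.
have -> : sg * X w / w = X sg - act F (X s) by rewrite -E; field.
by rewrite (vf_B hX) Xsg preserves_foliation_ker // subrr.
Qed.

Section Step.
Variables (A T H : set U) (X : K -> K).
Hypotheses (HG : subgroup H) (HC : adapted H X) (TH : T `<=` H).
Hypothesis AV : forall F, A F -> A F^-1%g.
Hypothesis conj_in : forall F t, A F -> T t -> H (F * t * F^-1)%g.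
Hypothesis comm_in : forall F G, A F -> A G -> T (commutator F G).
Hypothesis recur : forall F, A F -> (forall t, T t -> (F * t)%g = (t * F)%g) \/
  exists t t', [/\ T t, T t', t <> 1%g & (F * t * F^-1)%g = t'].

Let hX := adapted_vf HC.
Let nX := adapted_nz HC.
Let TN t (ht : T t) : normalises X t := adapted_normalises HC (TH ht).

Lemma adapted_rank1 X' : vf X' -> nz X' -> (forall F, A F -> normalises X' F) -> (forall t, T t -> normalises X' t) ->
  (forall t f, T t -> X' f = 0 -> act t f = f) -> adapted (A `|` T) X'.
Proof.
move=> hX' nX' AN TN' Tf; split=> // [g [/AN|/TN']|g h f] //.
have Ak F a : A F -> X' a = 0 -> X' (act F a) = 0.
  by move=> /AN/normalises_preserves_foliation; exact: preserves_foliation_ker.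
case=> [hg|hg] [hh|hh] hf.
- have e : (g * h)%g = (commutator g h * (h * g))%g.
    by rewrite /commutator !mulgA !mulgVK.
  rewrite -!actMg e actMg Tf //; first exact: comm_in.
  by rewrite actMg; apply: (Ak) => //; exact: Ak.
- by rewrite (Tf _ _ hh hf) (Tf _ _ hh (Ak _ _ hg hf)).
- by rewrite (Tf _ _ hg hf) (Tf _ _ hg (Ak _ _ hh hf)).
- by rewrite !Tf.
Qed.

(** The commutator of [g] and [h] is a translation along the leaves, and so is its conjugate
    by [F], the commutator of the conjugates. Hence [F] maps a first integral times [X] to a
    first integral times [X]. *)
Lemma normalises_of_comm F g h : A F -> preserves_foliation X F -> nonCst X -> H g -> H h ->
  H (F * g * F^-1)%g -> H (F * h * F^-1)%g ->
  (forall f, X f = 0 -> act g f = f) -> (forall f, X f = 0 -> act h f = f) ->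
  (g * h)%g <> (h * g)%g -> normalises X F.
Proof.
move=> AF FF cX Hg Hh HFg HFh fg fh gh.
have fF k : (forall f, X f = 0 -> act k f = f) -> forall f, X f = 0 -> act (F * k * F^-1)%g f = f.
  by move=> fk f hf; rewrite !actMg fk ?actVK //; exact: preserves_foliation_kerV.
have N k : H k -> normalises X k := @adapted_normalises _ _ _ HC k.
have [s Xs es] := comm_translation hX nX (N _ Hg) (N _ Hh) fg fh cX.
have [s' Xs' es'] := comm_translation hX nX (N _ HFg) (N _ HFh) (fF _ fg) (fF _ fh) cX.
have s0 : s != 0.
  apply: parallel_coef_neq0 es; apply: nz_log => /commutator_eq1; exact: gh.
exists ((act F s)^-1 * s') => [|f].
  by apply: (ker_M hX) => //; apply: (ker_V hX); exact: preserves_foliation_ker.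
have Fs0 : act F s != 0 by rewrite act_eq0.
apply: (mulfI Fs0); rewrite -(Ad_scale F es) Ad_log commutator_conj es'.
by rewrite -mulrA mulVKf.
Qed.

Lemma step0 : (forall t, T t -> t = 1%g) -> exists X', adapted (A `|` T) X'.
Proof.
move=> T1; have [A1|] := pselect (forall F, A F -> F = 1%g).
  exists X; split=> // [g [/A1 ->|/T1 ->]|g h f _ [/A1 ->|/T1 ->]]; try exact: normalises1.
    by rewrite !act1g.
  by rewrite !act1g.
move=> /existsNP[F /not_implyP[AF F1]].
have com g h : (A `|` T) g -> (A `|` T) h -> (g * h)%g = (h * g)%g.
  case=> [Ag|/T1 ->]; last by rewrite mul1g mulg1.
  case=> [Ah|/T1 ->]; last by rewrite mul1g mulg1.
  by apply/commutator_eq1; apply: T1; exact: comm_in.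
have hF := vf_log F.
exists (log F); split=> // [|g hg|g h f hg hh _]; first exact: nz_log.
  exists 1 => [|f]; first exact: (vf_1 hF).
  by rewrite mul1r; apply: Ad_log_id; apply: com => //; left.
by rewrite -!actMg com.
Qed.

(** All logarithms of [T] are tangent to one foliation, which [A] preserves by [recur]. If [T]
    is abelian, its logarithms are multiples of one of them by first integrals, and this
    field replaces [X]. Otherwise two noncommuting elements of [T] show by
    [adapted_coef_Cst] that the foliation is that of [X], and by [normalises_of_comm] that
    [A] normalises [X]. *)
Lemma step1 z : T z -> z <> 1%g -> (forall t, T t -> parallel (log z) (log t)) ->
  exists X', adapted (A `|` T) X'.
Proof.
move=> Tz z1 rk; set Z := log z in rk.
have hZ : vf Z := vf_log z; have nZ : nz Z := nz_log z1.
have FZ F : A F -> preserves_foliation Z F.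
  case/recur=> [c|[t [t' [Tt Tt' t1 e]]]].
    by exists 1 => f; rewrite mul1r; apply: Ad_log_id; exact: c.
  have [s es] := rk _ Tt; have [s' es'] := rk _ Tt'.
  have s0 := parallel_coef_neq0 (nz_log t1) es.
  exists ((act F s)^-1 * s') => f; have Fs0 : act F s != 0 by rewrite act_eq0.
  by apply: (mulfI Fs0); rewrite -(Ad_scale F es) Ad_log e es' -mulrA mulVKf.
have [ab|] := pselect (forall t t', T t -> T t' -> (t * t')%g = (t' * t)%g).
  exists Z; apply: adapted_rank1 => // [F AF|t Tt|t f Tt]; last first.
  - by apply: parallel_fix; exact: rk.
  - exists 1 => [|f]; first exact: (vf_1 hZ).
    by rewrite mul1r; apply: Ad_log_id; exact: ab.
  have [c|[t [t' [Tt Tt' t1 e]]]] := recur AF.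
    exists 1 => [|f]; first exact: (vf_1 hZ).
    by rewrite mul1r; apply: Ad_log_id; exact: c.
  have coef t0 s0 : T t0 -> (forall f, log t0 f = s0 * Z f) -> Z s0 = 0.
    move=> Tt0 e0; apply: log_fixed; apply: (scale_inj nZ) => f.
    have E : Ad z Z f = Z f by apply: Ad_log_id.
    rewrite -[in LHS]E -(Ad_scale z e0) -e0; apply: Ad_log_id; exact: ab.
  have [s es] := rk _ Tt; have [s' es'] := rk _ Tt'.
  have s0 := parallel_coef_neq0 (nz_log t1) es.
  exists ((act F s)^-1 * s') => [|f].
    apply: (ker_M hZ); last exact: coef es'.
    by apply: (ker_V hZ); apply: preserves_foliation_ker; [exact: nZ | exact: FZ | exact: coef es].
  have Fs0 : act F s != 0 by rewrite act_eq0.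
  by apply: (mulfI Fs0); rewrite -(Ad_scale F es) Ad_log e es' -mulrA mulVKf.
move=> /existsNP[x /existsNP[y /not_implyP[Tx /not_implyP[Ty xy]]]].
have cX : nonCst X.
  by apply: contrapT => h; apply: xy; apply: (normalises_comm hX nX h); exact: TN.
have x1 : x <> 1%g by move=> e; apply: xy; rewrite e mul1g mulg1.
have y1 : y <> 1%g by move=> e; apply: xy; rewrite e mul1g mulg1.
have [[a ea] [b eb]] := (rk _ Tx, rk _ Ty).
have a0 := parallel_coef_neq0 (nz_log x1) ea; have b0 := parallel_coef_neq0 (nz_log y1) eb.
have pXZ : parallel X Z.
  have [pXx|nXx] := pselect (parallel X (log x)).
    by apply: parallel_trans pXx _; apply: parallel_sym; [exact: nz_log | exists a].
  exfalso; apply: xy; apply/esym.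
  have e f : log y f = b / a * log x f + 0 * X f.
    by rewrite mul0r addr0 ea eb mulrA divfK.
  have Cba := adapted_coef_Cst HG HC cX (TH Tx) (TH Ty) nXx e.
  apply: comm_of_Ad_log => f.
  have ba0 : b / a != 0 by rewrite mulf_neq0 ?invr_eq0.
  have e' f0 : log y f0 = b / a * log x f0 by rewrite e mul0r addr0.
  apply: (mulfI ba0); rewrite -{1}(Cst_act y Cba) -(Ad_scale y e') -e'.
  by rewrite Ad_log mulgK.
have Tfix t f : T t -> X f = 0 -> act t f = f.
  by move=> Tt; apply: parallel_fix; apply: parallel_trans pXZ _; exact: rk.
exists X; apply: adapted_rank1 => // F AF.
apply: (@normalises_of_comm F x y) => //; try (by apply: conj_in) ; try (by apply: TH); try by move=> f; exact: Tfix.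
by apply: preserves_foliation_par pXZ _ => //; exact: FZ.
Qed.

(** Elements of [A] conjugate [t] into [H]; modulo [X] this multiplies [log t] by a constant,
    which is [1] by unipotency. So [A] and [T] commute with [log t] on first integrals, and
    [comm_on_ker] applies. *)
Lemma step_comm t : T t -> ~ parallel X (log t) -> nonCst X -> (forall F, A F -> preserves_foliation X F) ->
  forall g h f, (A `|` T) g -> (A `|` T) h -> X f = 0 -> act g (act h f) = act h (act g f).
Proof.
move=> Tt nt cX AF; have ht := vf_log t.
apply: (comm_on_ker hX nX ht nt) => [f|g|g].
- by apply: log_stable => // a; apply: preserves_foliation_ker => //; apply: normalises_preserves_foliation; exact: TN.
- by case=> [/AF//|/TN/normalises_preserves_foliation].
case=> [Ag|Tg] f hf; last by apply: (conj_log_ker HG HC) => //; exact: TH.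
have [a [b [Ca e]]] := adapted_mod HG HC cX (TH Tt) (conj_in Ag Tt) nt.
have e' k : Ad g (log t) k = a * log t k + b * X k by rewrite Ad_log e.
by rewrite e' (Cst_eigen_mod hX nX cX ht nt (AF _ Ag) Ca e') hf mulr0 addr0 mul1r.
Qed.

(** Commutators of [T] are tangent to the foliation of [X], and so are their conjugates by
    [A], which lie in [H]: thus [A] preserves this foliation. Let [M'] be the set of
    commutators of elements of the group generated by [T]. If [M'] is not abelian, [A]
    normalises [X] by [normalises_of_comm]. Otherwise the logarithms of [M'] are multiples
    of a single [W = s X] by first integrals, and [T] normalises [W]. An element of [A]
    sends [W] to fields affine along the leaves, as does its inverse, so that by
    [affine_distortion] it normalises [X] or [W]. The commutator of an element normalising
    [W] but not [X] with one not normalising [W] would belong to [T], which contradicts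
    [affine_distortion] again. So all of [A] normalises [X], or all of it normalises [W]. *)
Lemma step2_nonab x y t : T x -> T y -> (x * y)%g <> (y * x)%g -> T t -> ~ parallel X (log t) ->
  exists X', adapted (A `|` T) X'.
Proof.
move=> Tx Ty xy Tt nt.
have cX : nonCst X.
  by apply: contrapT => h; apply: xy; apply: (normalises_comm hX nX h); exact: TN.
pose M := generated_subgroup T; have MG : subgroup M by exact: gen_subgroup.
have TM k : T k -> M k by exact: sub_gen.
have MH m : M m -> H m by apply: gen_sub.
have MF F m : A F -> M m -> H (F * m * F^-1)%g.
  move=> AF; suff : M `<=` [set m | H (F * m * F^-1)%g] by apply.
  apply: gen_sub => [|k Tk]; last exact: conj_in.
  apply/subgroupE; split=> [|a b]; first by rewrite /= mulg1 mulgV; exact: subgroup1.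
  move=> Ha Hb; have := subgroupM HG Ha (subgroupV HG Hb).
  by rewrite /= !invgM invgK !mulgA mulgVK.
pose M' := [set g | exists m n, [/\ M m, M n & g = commutator m n]].
have M'H g : M' g -> H g by move=> [m [n [/MH Hm /MH Hn ->]]]; exact: subgroup_comm.
have M'fix g : M' g -> forall f, X f = 0 -> act g f = f.
  by move=> [m [n [/MH Hm /MH Hn ->]]] f; exact: (comm_fix HG HC Hm Hn).
have M'F F g : A F -> M' g -> H (F * g * F^-1)%g /\
    forall f, X f = 0 -> act (F * g * F^-1)%g f = f.
  move=> AF [m [n [Mm Mn ->]]]; rewrite commutator_conj.
  have Hm := MF _ _ AF Mm; have Hn := MF _ _ AF Mn.
  by split=> [|f]; [exact: subgroup_comm | exact: (comm_fix HG HC Hm Hn)].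
set e := commutator x y; have M'e : M' e by exists x, y; split=> //; exact: TM.
have e1 : e <> 1%g by move/commutator_eq1.
pose W := log e; have hW : vf W := vf_log e; have nW : nz W := nz_log e1.
have [s es] : parallel X W := fix_par hX nX cX (M'fix _ M'e).
have s0 : s != 0 := parallel_coef_neq0 nW es.
have Xs : X (X s) = 0 by apply: log_affine es => //; exact: (adapted_normalises HC (M'H _ M'e)).
have kW a : W a = 0 <-> X a = 0.
  rewrite es; split=> [/eqP|->]; last by rewrite mulr0.
  by rewrite mulf_eq0 (negPf s0) => /eqP.
have AW F : A F -> exists sF, X (X sF) = 0 /\ forall f, Ad F W f = sF * X f.
  move=> AF; have [HF fF] := M'F _ _ AF M'e; have [sF eF] := fix_par hX nX cX fF.
  exists sF; split=> [|f]; last by rewrite Ad_log eF.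
  by apply: log_affine eF => //; exact: (adapted_normalises HC HF).
have AX F : A F -> exists w sF, [/\ forall f, Ad F X f = w * X f,
    X (X sF) = 0, act F s * w = sF & forall f, Ad F W f = sF * X f].
  move=> AF; have [sF [XsF eF]] := AW _ AF.
  have Fs0 : act F s != 0 by rewrite act_eq0.
  have e' f : Ad F X f = (act F s)^-1 * sF * X f.
    by apply: (mulfI Fs0); rewrite -(Ad_scale F es) eF -mulrA mulVKf.
  by exists ((act F s)^-1 * sF), sF; split=> //; rewrite mulrA divff // mul1r.
have AF F : A F -> preserves_foliation X F by move=> /AX[w [_ [ew _ _ _]]]; exists w.
have ACX := step_comm Tt nt cX AF.
have TX g : T g -> normalises X g by exact: TN.
have [com|] := pselect (forall g k, M' g -> M' k -> (g * k)%g = (k * g)%g); last first.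
  move=> /existsNP[g /existsNP[k /not_implyP[M'g /not_implyP[M'k gk]]]].
  exists X; split=> // q [AFq|/TX //].
  have [Hg' _] := M'F _ _ AFq M'g; have [Hk' _] := M'F _ _ AFq M'k.
  apply: (normalises_of_comm AFq (AF _ AFq) cX (M'H _ M'g) (M'H _ M'k)) => //; exact: M'fix.
have TW k : T k -> normalises W k.
  move=> Tk; have Mk := TM _ Tk.
  have M'k : M' (k * e * k^-1)%g.
    rewrite commutator_conj; exists (k * x * k^-1)%g, (k * y * k^-1)%g.
    have Mc (l : U) : T l -> M (k * l * k^-1)%g.
      by move=> Tl; apply: (subgroupM MG); [apply: (subgroupM MG); exact: TM | apply: (subgroupV MG); exact: TM].
    by split=> //; exact: Mc.
  have [s' es'] := fix_par hX nX cX (M'fix _ M'k).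
  have eW f : log (k * e * k^-1)%g f = s' / s * W f by rewrite es' es mulrA divfK.
  exists (s' / s) => [|f]; last by rewrite Ad_log.
  apply: log_fixed; apply: (scale_inj nW) => f.
  have eWW a : Ad e W a = W a by apply: Ad_log_id.
  rewrite -[in LHS]eWW -(Ad_scale e eW) -eW; apply: Ad_log_id; exact: com.
(* the distortion of [F], computed from the images of [W] by [F] and by its inverse *)
have dich F : A F -> normalises X F \/ normalises W F.
  move=> AF'; have [w [sF [ew XsF wF eF]]] := AX _ AF'.
  have [sm [Xsm em]] := AW _ (AV AF').
  have wm : act F sm * w = s.
    apply: (scale_inj nX) => f; rewrite -mulrA -ew -(Ad_scale F em).
    by rewrite -(AdM F F^-1%g) mulgV Ad1 es.
  have d1 := affine_distortion hX nX ew wF Xs XsF.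
  have d2 := affine_distortion hX nX ew wm Xsm Xs.
  have [Xw|Xw] := eqVneq (X w) 0; [by left; exists w | right].
  have w0 := parallel_coef_neq0 (nz_Ad F nX) ew.
  exists (sF / s) => [|f]; last by rewrite eF es mulrA divfK.
  apply/kW; have -> : sF / s = (sF * X w / w) / (s * X w / w).
    by field; rewrite s0 w0 Xw.
  by apply: (ker_M hX d1); exact: (ker_V hX).
have [allW|] := pselect (forall F, A F -> normalises W F).
  exists W; split=> // [g [/allW|/TW]|g h f Pg Ph /kW hf] //; exact: ACX.
move=> /existsNP[F /not_implyP[AF' nF]].
exists X; split=> // g [Ag|/TX //].
have [//|[c Wc ec]] := dich _ Ag.
have [w [_ [ew _ _ _]]] := AX _ Ag; exists w => //; apply/eqP/negPn/negP => Xw; apply: nF.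
have w0 := parallel_coef_neq0 (nz_Ad g nX) ew.
have [_ [sF [_ XsF _ eF]]] := AX _ AF'.
have Xc : X c = 0 by apply/kW.
have c0 := parallel_coef_neq0 (nz_Ad g nW) ec.
have [r Er] : exists r, sF = r * s by exists (sF / s); rewrite divfK.
have er f : Ad F W f = r * W f by rewrite eF es Er mulrA.
suff Xr : X r = 0 by exists r => //; apply/kW.
have gs : act g s * w = c * s.
  by apply: (scale_inj nX) => f; rewrite -mulrA -ew -(Ad_scale g es) ec es mulrA.
suff Xgr : X (act g r) = 0.
  by rewrite -(actK g r); apply: preserves_foliation_kerV => //; exact: AF.
set k := commutator F g; have Tk : T k by exact: comm_in.
have Fk : preserves_foliation X k^-1%g.
  by apply: preserves_foliationV => //; apply: normalises_preserves_foliation; exact: TN.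
have [q Wq eq] := TW _ Tk; have Xq : X q = 0 by apply/kW.
have q0 := parallel_coef_neq0 (nz_Ad k nW) eq.
have [q' Wq' eq'] := normalisesV hW nW (TW _ Tk); have Xq' : X q' = 0 by apply/kW.
have [p Xp ep] := normalisesV hX nX (TN Tk).
have p0 := parallel_coef_neq0 (nz_Ad k^-1%g nX) ep.
have q'0 := parallel_coef_neq0 (nz_Ad k^-1%g nW) eq'.
have kq0 : act k^-1%g q != 0 by rewrite act_eq0.
(* compare the actions of [F g] and [k g F] on [W] *)
have E1 : act F c * r = act k (act g r * c) * q.
  apply: (scale_inj nW) => f.
  have eg f' : Ad g (Ad F W) f' = act g r * c * W f' by rewrite (Ad_scale g er) ec mulrA.
  rewrite -mulrA -er -(Ad_scale F ec) -AdM.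
  have -> : (F * g)%g = (k * (g * F))%g by rewrite /k /commutator !mulgA !mulgVK.
  rewrite AdM; have -> : Ad k (Ad (g * F)%g W) f = Ad k (Ad g (Ad F W)) f.
    by apply: eq_Ad => ?; rewrite AdM.
  by rewrite (Ad_scale k eg) eq mulrA.
have E2 : act g r = act k^-1%g (act F c) / (c * act k^-1%g q) * act k^-1%g r.
  have := congr1 (act k^-1%g) E1; rewrite !actM !actK => E.
  by apply: (mulIf (mulf_neq0 c0 kq0)); rewrite mulrA -E; field; rewrite c0 kq0.
(* [k] normalises both [X] and [W], so that it keeps functions affine along the leaves and
   multiplies [s] by a first integral *)
have E3 : act k^-1%g s * p = q' * s.
  by apply: (scale_inj nX) => f; rewrite -mulrA -ep -(Ad_scale k^-1%g es) eq' es mulrA.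
pose i := act k^-1%g (act F c) / (c * act k^-1%g q).
have Xi : X i = 0.
  apply: (ker_M hX); first by apply: preserves_foliation_ker => //; apply: preserves_foliation_ker => //; exact: AF.
  by apply: (ker_V hX); apply: (ker_M hX) => //; exact: preserves_foliation_ker.
have ks : act k^-1%g s = q' / p * s by apply: (mulIf p0); rewrite E3; field.
have E4 : act g sF * w = i * c * p / q' * act k^-1%g sF.
  by rewrite Er !actM E2 -/i -mulrA gs ks; field; rewrite p0 q'0.
have XE4 : X (X (act g sF * w)) = 0.
  have Xj : X (i * c * p / q') = 0.
    by apply: (ker_M hX); [do 2!apply: (ker_M hX) => // | exact: (ker_V hX)].
  have XkF : X (X (act k^-1%g sF)) = 0.
    have E : X (act k^-1%g sF) = p^-1 * act k^-1%g (X sF).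
      by apply: (mulfI p0); rewrite -ep Ad_act mulVKf.
    by rewrite E; apply: (ker_M hX); [exact: (ker_V hX) | exact: preserves_foliation_ker].
  by rewrite E4 (vf_M hX) Xj mul0r add0r (ker_M hX).
have Xcs : X (X (c * s)) = 0 by rewrite (vf_M hX) Xc mul0r add0r (ker_M hX).
have d1 := affine_distortion hX nX ew gs Xs Xcs.
have d2 := affine_distortion hX nX ew (erefl _) XsF XE4.
(* [g] would map [r] to a first integral, as a quotient of two distortions *)
have -> : act g r = (act g sF * w * X w / w) / (c * s * X w / w).
  rewrite -gs Er actM; field.
  by rewrite w0 Xw act_eq0 s0.
by apply: (ker_M hX d2); exact: (ker_V hX).
Qed.

(** * The descending step when the logarithms span a plane *)

Section Abelian.
Variables (z1 z2 : U).
Hypotheses (T1 : T z1) (T2 : T z2) (n1 : nz (log z1)) (ind : ~ parallel (log z1) (log z2)).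
Hypothesis ab : forall t t', T t -> T t' -> (t * t')%g = (t' * t)%g.
Local Notation Z1 := (log z1).
Local Notation Z2 := (log z2).
Local Notation plane := (plane z1 z2).
Let z12 := ab T1 T2.

Lemma plane_ext Y Y' : plane Y -> (forall f, Y' f = Y f) -> plane Y'.
Proof.
move=> pY e; apply: (plane_comb (@Cst1 S) (@Cst0 S) pY pY) => f.
by rewrite e mul1r mul0r addr0.
Qed.

Lemma planeT t : T t -> plane (log t).
Proof. by move=> Tt; apply: plane_log => //; exact: ab. Qed.

Lemma plane_fixT t Y f : T t -> plane Y -> Ad t Y f = Y f.
Proof. by move=> Tt pY; exact: (plane_fix (ab Tt T1) (ab Tt T2) pY). Qed.

Definition normal F := plane (Ad F Z1) /\ plane (Ad F Z2).

Lemma normal_plane F Y : normal F -> plane Y -> plane (Ad F Y).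
Proof.
move=> [p1 p2] [a [b [Ca Cb e]]]; apply: (plane_comb Ca Cb p1 p2) => f.
by rewrite (Ad_comb F e) !Cst_act.
Qed.

Lemma normal_span F W Y : plane W -> plane Y -> nz W -> nz Y -> ~ parallel W Y ->
  plane (Ad F W) -> plane (Ad F Y) -> normal F.
Proof.
move=> pW pY nW nY hp pFW pFY.
have stab Z : plane Z -> plane (Ad F Z).
  move=> pZ; have [a [b [Ca Cb e]]] := plane_span z12 pW pY pZ nW nY hp.
  by apply: (plane_comb Ca Cb pFW pFY) => f; rewrite (Ad_comb F e) !Cst_act.
by split; apply: stab; [exact: plane1 | exact: plane2].
Qed.

Lemma abelian_end W V : vf W -> nz W -> vf V -> ~ parallel W V -> (forall f, W f = 0 -> W (V f) = 0) ->
  (forall t f, T t -> Ad t W f = W f) -> (forall t f, T t -> Ad t V f = V f) ->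
  (forall F f, A F -> Ad F W f = W f) ->
  (forall F, A F -> exists a b, Cst a /\ forall f, Ad F V f = a * V f + b * W f) ->
  adapted (A `|` T) W.
Proof.
move=> hW nW hV hp st TW TVf AW AVf.
have fixW g f : (A `|` T) g -> Ad g W f = W f by case=> [/AW|/TW].
have NW g : (A `|` T) g -> normalises W g.
  by move=> Pg; exists 1 => [|f]; [exact: (vf_1 hW) | rewrite mul1r fixW].
split=> //; apply: (comm_on_ker hW nW hV hp st) => [g /NW/normalises_preserves_foliation //|g Pg f hf].
have [cW|cW] := pselect (nonCst W); last first.
  by have Cf := nonCstPn cW hf; rewrite /Ad (Cst_act _ Cf) (Cf _ hV) act0.
case: Pg => [Ag|/TVf //].
have [a [b [Ca e]]] := AVf _ Ag.
by rewrite e (Cst_eigen_mod hW nW cW hV hp _ Ca e) ?hf ?mulr0 ?addr0 ?mul1r //;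
  apply: normalises_preserves_foliation; apply: NW; left.
Qed.

(** All of [A] preserves the plane, and fixes its vector of maximal order by unipotency. *)
Lemma step2_normal : (forall F, A F -> normal F) -> exists X', adapted (A `|` T) X'.
Proof.
move=> An; have [W [n [pW nW rW max]]] := plane_max z12 n1 ind.
have hW := plane_vf pW.
have AW F f : A F -> Ad F W f = W f.
  move=> AF; apply/eqP; rewrite -subr_eq0; apply/eqP.
  apply: (max (fun f => Ad F W f - W f)); last exact: raises_Ad.
  have C1 := @Cst1 S; have CN1 : Cst (-1 : K) by rewrite -sub0r; apply: CstB => //; exact: Cst0.
  apply: (plane_comb C1 CN1 (normal_plane (An _ AF) pW) pW) => k.
  by rewrite mul1r mulN1r.
exists W.
suff [V [pV nV hp]] : exists V, [/\ plane V, nz V & ~ parallel W V].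
  apply: (@abelian_end W V) => // [|f hf|t f Tt|t f Tt|F AF].
  - exact: plane_vf pV.
  - by rewrite (plane_comm z12 f pW pV) hf (vf_0 (plane_vf pV)).
  - exact: plane_fixT.
  - exact: plane_fixT.
  have [a [b [Ca Cb e]]] := plane_span z12 pW pV (normal_plane (An _ AF) pV) nW nV hp.
  by exists b, a; split=> // f; rewrite e addrC.
have [p1|p1] := pselect (parallel W Z1); last by exists Z1; split=> //; exact: plane1.
have n2 : nz Z2 by apply: contrapT => /nzPn h; apply: ind; exists 0 => f; rewrite h mul0r.
exists Z2; split=> // [|p2]; first exact: plane2.
by apply: ind; apply: parallel_trans p2; exact: parallel_sym.
Qed.

Section Transverse.
Variable (t : U).
Hypotheses (Tt : T t) (nt : ~ parallel X (log t)) (cX : nonCst X).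

Lemma mod_comb w1 w2 a b Y : H w1 -> H w2 -> Cst a -> Cst b ->
  (forall f, Y f = a * log w1 f + b * log w2 f) ->
  exists c d, Cst c /\ forall f, Y f = c * log t f + d * X f.
Proof.
move=> H1 H2 Ca Cb e.
have [a1 [b1 [C1 e1]]] := adapted_mod HG HC cX (TH Tt) H1 nt.
have [a2 [b2 [C2 e2]]] := adapted_mod HG HC cX (TH Tt) H2 nt.
exists (a * a1 + b * a2), (a * b1 + b * b2); split; first by apply: CstD; exact: CstM.
by move=> f; rewrite e e1 e2; ring.
Qed.

Lemma mod_plane Y : plane Y -> exists c d, Cst c /\ forall f, Y f = c * log t f + d * X f.
Proof.
by move=> [a [b [Ca Cb e]]]; apply: mod_comb e => //; exact: TH.
Qed.

Lemma mod_Ad F Y : A F -> plane Y ->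
  exists c d, Cst c /\ forall f, Ad F Y f = c * log t f + d * X f.
Proof.
move=> AF [a [b [Ca Cb e]]].
apply: (mod_comb (conj_in AF T1) (conj_in AF T2) Ca Cb) => f.
by rewrite (Ad_comb F e) !Cst_act // !Ad_log.
Qed.

(** Modulo [X] the logarithms of [H] are proportional over the constants, so that the image
    of the plane contains a multiple of [X]. *)
Lemma line_Ad F : H (F * z1 * F^-1)%g -> H (F * z2 * F^-1)%g ->
  exists W, [/\ plane W, nz W & parallel X (Ad F W)].
Proof.
move=> H1 H2.
have n1' : nz (log (F * z1 * F^-1)%g).
  by have [f hf] := nz_Ad F n1; exists f; rewrite -Ad_log.
have [p1|p1] := pselect (parallel X (log (F * z1 * F^-1)%g)).
  by have [a e] := p1; exists Z1; split=> //; [exact: plane1 | exists a => f; rewrite Ad_log].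
have [a [b [Ca e]]] := adapted_mod HG HC cX H1 H2 p1.
have eW f : Z2 f - a * Z1 f = 1 * Z2 f + (- a) * Z1 f by rewrite mul1r mulNr.
exists (fun f => Z2 f - a * Z1 f); split.
- have CNa : Cst (- a) by rewrite -sub0r; apply: CstB => //; exact: Cst0.
  exact: (plane_comb (@Cst1 S) CNa (plane2 z1 z2) (plane1 z1 z2) eW).
- apply: contrapT => /nzPn h; apply: ind; exists a => f.
  by apply/eqP; rewrite -subr_eq0 h.
exists b => f; rewrite (Ad_comb F eW) actN act1 mul1r (Cst_act F Ca) !Ad_log e.
by rewrite mulNr addrAC subrr add0r.
Qed.

Lemma parallel_Ad F W W' : parallel W W' -> parallel (Ad F W) (Ad F W').
Proof. by move=> [a e]; exists (act F a) => f; rewrite (Ad_scale F e). Qed.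

(** Both sides lie in the span of [log t] and [X], with constant coefficients of [log t];
    being parallel, they are proportional over the constants. *)
Lemma transverse_image F W W' : A F -> ~ preserves_foliation X F -> plane W -> nz W -> parallel X W ->
  plane W' -> nz W' -> parallel X (Ad F^-1%g W') ->
  exists c, [/\ Cst c, c != 0 & forall f, Ad F W f = c * W' f].
Proof.
move=> AF nF pW nW [s es] pW' nW' [q eq].
have ht := vf_log t.
have pFX : parallel (Ad F X) W'.
  exists (act F q) => f; rewrite -(Ad_scale F eq).
  by rewrite -(AdM F F^-1%g) mulgV Ad1.
have pFW : parallel W' (Ad F W).
  apply: (@parallel_trans _ _ (Ad F X)); first exact: parallel_sym.
  by exists (act F s) => f; rewrite (Ad_scale F es).
have nW'X : ~ parallel X W'.
  move=> h; apply: nF; apply: parallel_trans h _; apply: parallel_sym pFX => //.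
have [a [b [Ca ea]]] := mod_Ad AF pW.
have [a' [b' [Ca' ea']]] := mod_plane pW'.
have [c ec] := pFW.
have nFW : nz (Ad F W) by exact: nz_Ad.
have c0 := parallel_coef_neq0 nFW ec.
have a'0 : a' != 0.
  apply/eqP => a'0; apply: nW'X; exists b' => f; by rewrite ea' a'0 mul0r add0r.
have [E _] : a - c * a' = 0 /\ b - c * b' = 0.
  apply: (indep nX nt) => f.
  have := ec f; rewrite ea ea' => /eqP; rewrite -subr_eq0 => /eqP <-.
  by ring.
exists c; split=> //; have -> : c = a / a'.
  by apply: (mulIf a'0); rewrite divfK //; apply/esym/eqP; rewrite -subr_eq0 E.
by apply: CstM => //; exact: CstV.
Qed.

Lemma conj1 z : T z -> H (1 * z * 1^-1)%g.
Proof. by move=> Tz; rewrite mul1g invg1 mulg1; exact: TH. Qed.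

Lemma leaf_line : exists W, [/\ plane W, nz W & parallel X W].
Proof.
have [W [pW nW [a e]]] := line_Ad (conj1 T1) (conj1 T2).
by exists W; split=> //; exists a => f; rewrite -e Ad1.
Qed.

(** The plane contains the line of [X], a second line sent to the direction of [X] by [F], and
    a third one sent there by the inverse of [F]. By [transverse_image], [F] maps the
    second to the first and the first to the third with constant factors, and the first
    two span the plane when [F] moves the foliation. *)
Lemma normal_of_moving F : A F -> ~ preserves_foliation X F -> normal F.
Proof.
move=> AF nF.
have nFV : ~ preserves_foliation X F^-1%g by move=> /(preserves_foliationV nX); rewrite invgK.
have [W [pW nW pXW]] := leaf_line.
have [W' [pW' nW' pFW']] := line_Ad (conj_in AF T1) (conj_in AF T2).
have AFV := AV AF.
have [W'' [pW'' nW'' pFW'']] := line_Ad (conj_in AFV T1) (conj_in AFV T2).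
have [c [Cc c0 ec]] := transverse_image AF nF pW nW pXW pW'' nW'' pFW''.
have pFW'V : parallel X (Ad F^-1%g^-1%g W') by rewrite invgK.
have [d [Cd d0 ed]] := transverse_image AFV nFV pW nW pXW pW' nW' pFW'V.
have C0 := @Cst0 S.
apply: (@normal_span F W W') => // [pWW'| |].
- apply: nF; apply: parallel_trans pFW' _; apply: parallel_sym; first exact: nz_Ad.
  have pXW' := parallel_trans pXW pWW'.
  by exact: parallel_Ad.
- by apply: (plane_comb Cc C0 pW'' pW'') => f; rewrite ec mul0r addr0.
apply: (plane_comb (CstV Cd) C0 pW pW) => f; rewrite mul0r addr0.
apply: (mulfI d0); rewrite mulVKf // -{1}(Cst_act F Cd) -(Ad_scale F ed).
by rewrite -(AdM F F^-1%g) mulgV Ad1.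
Qed.

(** By [normal_of_moving], [F] preserves the foliation, and by [recur] it sends the logarithm
    of some nontrivial element [z] of [T] to that of another one. If [log z] is tangent to the
    foliation it is a constant multiple of [W], and unipotency concludes. If not, the factor
    [r] of [W] under [F] is killed by a logarithm [V] transverse to the foliation and
    is a quotient of affine functions along the leaves. Either [r] is a constant, so that [F]
    preserves [W] and then the plane, or else [W] adds a constant to [r] or multiplies a
    translate of [r] by a constant, which contradicts the fact that [W] raises orders. *)
Lemma leaf_line_fixed F W : A F -> ~ normal F -> plane W -> nz W -> parallel X W ->
  forall f, Ad F W f = W f.
Proof.
move=> AF nF pW nW [s es].
have FF : preserves_foliation X F by apply: contrapT => h; apply: nF; exact: normal_of_moving.
have hW := plane_vf pW.
have s0 := parallel_coef_neq0 nW es.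
have pWX : parallel W X by apply: parallel_sym => //; exists s.
case: (recur AF) => [c|[z [z' [Tz Tz' z_neq e]]]].
  case: nF; split; [apply: (plane_ext (plane1 z1 z2)) | apply: (plane_ext (plane2 z1 z2))] => f;
    by apply: Ad_log_id; exact: c.
have hV0 := vf_log z; have nV0 := nz_log z_neq; have hV := vf_log z'.
have eV f : Ad F (log z) f = log z' f by rewrite Ad_log e.
have [r er] : preserves_foliation W F by apply: preserves_foliation_par pWX FF.
have r0 := parallel_coef_neq0 (nz_Ad F nW) er.
have [pX0|nX0] := pselect (parallel X (log z)).
  have [k ek] : parallel W (log z) := parallel_trans pWX pX0.
  have Ck := plane_scale z12 n1 ind pW (planeT Tz) nW ek.
  have k0 := parallel_coef_neq0 nV0 ek.
  have E f : log z' f = k * r * W f by rewrite -eV (Ad_scale F ek) er (Cst_act F Ck) mulrA.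
  have Ckr := plane_scale z12 n1 ind pW (planeT Tz') nW E.
  have Cr : Cst r by rewrite -(mulKf k0 r); apply: CstM => //; exact: CstV.
  by move=> f; rewrite er (Cst_eigen hW nW Cr er) mul1r.
exfalso.
have nXV : ~ parallel X (log z').
  move=> [a ea]; apply: nX0; have [u eu] := preserves_foliationV nX FF.
  exists (act F^-1%g a * u) => f; rewrite -mulrA -eu -(Ad_scale F^-1%g ea).
  by rewrite -(AdK F (log z) f); apply: eq_Ad => k; rewrite eV.
have [f0 hf0] := nW.
have Vr : log z' r = 0.
  apply: (mulIf hf0); rewrite mul0r.
  have E : log z' (r * W f0) = r * W (log z' f0).
    by rewrite -er -[in RHS]er -!eV /Ad !actK (plane_comm z12 _ (planeT Tz) pW).
  move: E; rewrite (vf_M hV) (plane_comm z12 _ (planeT Tz') pW).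
  by move/eqP; rewrite -subr_eq0 addrK => /eqP.
have Xs : X (X s) = 0.
  have [a [b [Ca Cb eW]]] := pW.
  exact: (comb_affine hX nX (TN T1) (TN T2) Ca Cb eW es).
have Xrs : X (X (r * s)) = 0.
  have [a [b [Ca Cb eW]]] := pW.
  have N1 := adapted_normalises HC (conj_in AF T1); have N2 := adapted_normalises HC (conj_in AF T2).
  apply: (comb_affine hX nX N1 N2 Ca Cb (Y := Ad F W)) => f.
    by rewrite (Ad_comb F eW) !Cst_act // !Ad_log.
  by rewrite er es mulrA.
(* [r] is a quotient of two functions affine along the leaves: a first integral or a
   Moebius function of the time coordinate, on which [W] acts by a first order equation *)
have Wr : W r = X (r * s) - r * X s by rewrite es (vf_M hX); ring.
have Vst f : X f = 0 -> X (log z' f) = 0.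
  by apply: log_stable => // k; apply: preserves_foliation_ker => //; apply: normalises_preserves_foliation; exact: TN.
have VW : log z' (X (r * s)) = r * log z' (X s).
  have : log z' (W r) = 0 by rewrite (plane_comm z12 _ (planeT Tz') pW) Vr (vf_0 hW).
  by rewrite Wr (vf_B hV) (vf_M hV) Vr mul0r add0r => /eqP; rewrite subr_eq0 => /eqP.
have [Xr|/eqP Xr] := pselect (X r = 0).
  have Cr : Cst r by exact: (Cst_ker hX hV nX nXV).
  have r1 := Cst_eigen hW nW Cr er.
  apply: nF; apply: (@normal_span F W (log z)) => //; first exact: planeT.
  - by move=> h; apply: nX0; apply: parallel_trans h; exists s.
  - by apply: (plane_ext pW) => f; rewrite er r1 mul1r.
  - exact: (plane_ext (planeT Tz')).
have [Va|Va] := eqVneq (log z' (X s)) 0; last first.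
  case/eqP: Xr; have -> : r = log z' (X (r * s)) / log z' (X s) by rewrite VW mulfK.
  by apply: (ker_M hX); [exact: Vst | apply: (ker_V hX); exact: Vst].
have Ca : Cst (X s) by exact: (Cst_ker hX hV nX nXV).
have Ca' : Cst (X (r * s)).
  by apply: (Cst_ker hX hV nX nXV) => //; rewrite VW Va mulr0.
have rW := plane_raises pW.
have [a0|a0] := eqVneq (X s) 0.
  have r1 : v 1 (r - 1).
    by apply: (@unipotent _ (fun=> True) F W r) => //; exists f0.
  have : v 1 (W r).
    have := rW _ _ r1; rewrite (vf_B hW) (vf_1 hW) subr0; apply: ge_le; lia.
  rewrite Wr a0 mulr0 subr0 => /(Cst_ge1 Ca') e0.
  by move: Wr; rewrite e0 a0 mulr0 subr0 es => /eqP; rewrite mulf_eq0 (negPf s0) (negPf Xr).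
(* the fixed point of the affine equation satisfied by [r]: [W] multiplies [q] by a constant *)
pose q := r - X (r * s) / X s.
have CV : Cst (X (r * s) / X s) by apply: CstM => //; exact: CstV.
have q0 : q != 0.
  by rewrite subr_eq0; apply: contraNneq Xr => ->; rewrite CV.
have Wq : W q = - X s * q by rewrite (vf_B hW) CV // subr0 Wr /q; field.
have [n [hn hn']] := ge_exact v q0.
have := geM (rW _ _ hn) hn'; rewrite Wq mulfK // addrAC subrr add0r.
by move/geNE/(Cst_ge1 Ca) => e0; rewrite e0 eqxx in a0.
Qed.

End Transverse.

(** If some [F1] in [A] does not preserve the plane, it fixes the line [W] of the plane tangent
    to the foliation ([leaf_line_fixed]). So do all others: if [F] preserves the plane, the
    image of [W] by [F] is again fixed by [F1], because the commutator of the two is in [T] and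
    fixes the plane; as [F1] does not fix the whole plane, this image is a multiple of [W]. *)
Lemma step2_ab : exists X', adapted (A `|` T) X'.
Proof.
have [allN|] := pselect (forall F, A F -> normal F); first exact: step2_normal.
move=> /existsNP[F1 /not_implyP[AF1 nF1]].
have cX : nonCst X.
  apply: contrapT => h; apply: nF1.
  have com z z' : T z -> T z' -> (F1 * z * F1^-1 * z')%g = (z' * (F1 * z * F1^-1))%g.
    move=> Tz Tz'; apply: (normalises_comm hX nX h); last exact: TN.
    exact: (adapted_normalises HC (conj_in AF1 Tz)).
  have pl z : T z -> plane (Ad F1 (log z)).
    move=> Tz; apply: plane_ext (Ad_log F1 z).
    by apply: plane_log => //; exact: com.
  by split; exact: pl.
have [t [Tt nt]] : exists t, T t /\ ~ parallel X (log t).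
  have [p1|p1] := pselect (parallel X Z1); last by exists z1.
  by exists z2; split=> // p2; apply: ind; apply: parallel_trans p2; exact: parallel_sym.
have [W [pW nW pXW]] := leaf_line cX.
have hW := plane_vf pW.
have AW F : A F -> forall f, Ad F W f = W f.
  move=> AF; have [nF|nF] := pselect (normal F); last first.
    exact: (leaf_line_fixed Tt nt cX AF nF pW nW pXW).
  have e1 := leaf_line_fixed Tt nt cX AF1 nF1 pW nW pXW.
  set k := commutator F^-1%g F1^-1%g.
  have Tk : T k by apply: comm_in; exact: AV.
  have eF : (F * F1)%g = (F1 * (F * k))%g.
    by rewrite /k /commutator !invgK !mulgA mulgK mulgV mul1g.
  have pY := normal_plane nF pW.
  have eY f : Ad F1 (Ad F W) f = Ad F W f.
    have -> : Ad F W f = Ad (F * F1)%g W f by rewrite AdM; apply: eq_Ad => ?; rewrite e1.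
    rewrite eF AdM; apply: eq_Ad => a; rewrite AdM; apply: eq_Ad => b.
    by rewrite plane_fixT.
  have [[a ea]|hp] := pselect (parallel W (Ad F W)).
    have Ca := plane_scale z12 n1 ind pW pY nW ea.
    by move=> f; rewrite ea (Cst_eigen hW nW Ca ea) mul1r.
  exfalso; apply: nF1; apply: (normal_span pW pY) => //; first exact: nz_Ad.
    exact: plane_ext pW e1.
  exact: plane_ext pY eY.
have [s es] := pXW; have s0 := parallel_coef_neq0 nW es.
have hp : ~ parallel W (log t) by move=> h; apply: nt; exact: parallel_trans h.
exists W; apply: (@abelian_end W (log t)) => // [|f hf|u f Tu|u f Tu|F f AF|F AF].
- exact: vf_log.
- by rewrite (plane_comm z12 _ pW (planeT Tt)) hf (vf_0 (vf_log t)).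
- exact: plane_fixT.
- exact: (plane_fixT _ Tu (planeT Tt)).
- exact: (AW _ AF).
have [c [d [Cc e]]] := mod_Ad Tt nt cX AF (planeT Tt).
by exists c, (d / s); split=> // f; rewrite e es mulrA divfK.
Qed.

End Abelian.

Lemma adapted_step : exists X', adapted (A `|` T) X'.
Proof.
have [T1|] := pselect (forall t, T t -> t = 1%g); first exact: step0.
move=> /existsNP[z1 /not_implyP[T1 z1_neq]].
have n1 := nz_log z1_neq.
have [rk|] := pselect (forall t, T t -> parallel (log z1) (log t)); first exact: step1 T1 z1_neq rk.
move=> /existsNP[z2 /not_implyP[T2 ind]].
have [ab|] := pselect (forall t t', T t -> T t' -> (t * t')%g = (t' * t)%g).
  exact: (step2_ab T1 T2 n1 ind ab).
move=> /existsNP[x /existsNP[y /not_implyP[Tx /not_implyP[Ty xy]]]].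
have [p1|p1] := pselect (parallel X (log z1)); last exact: step2_nonab Tx Ty xy T1 p1.
apply: (step2_nonab Tx Ty xy T2) => p2.
by apply: ind; apply: parallel_trans p2; exact: parallel_sym.
Qed.

End Step.
(** * From pseudo-solvability to solvability *)

(** An element [F] of [A] conjugates [t] to [[F, t] t], which lies in the group generated by
    [T] and the next term. If [F] commutes with [E] it centralises [T]. Otherwise some
    commutator [[F, b]] is a nontrivial element of [T], and conjugating it by the inverse of
    [F] gives the inverse of another commutator of the same kind; this is where the
    signs in the definition of the iterated commutators matter. *)
Lemma adapted_descent (A E : set U) X : A `<=` E ->
  let T := signed_commutators A E in
  adapted (signed_commutators T (T `|` A) `|` T) X -> exists X', adapted (T `|` A) X'.
Proof.
move=> AE T HC.
have invV (P : set U) x : with_inverses P x -> with_inverses P x^-1%g.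
  by case=> [Px|[y Py <-]]; [right; exists x | rewrite invgK; left].
have invS (P Q : set U) x : P `<=` Q -> with_inverses P x -> with_inverses Q x.
  by move=> PQ [Px|[y Py <-]]; [left; exact: PQ | right; exists y => //; exact: PQ].
have sgn (P Q : set U) x y : with_inverses P x -> with_inverses Q y ->
    signed_commutators P Q (commutator x y).
  by move=> Px Qy; exists x => //; exists y.
pose H := generated_subgroup (signed_commutators T (T `|` A) `|` T).
have HG : subgroup H by exact: gen_subgroup.
have TH : with_inverses T `<=` H.
  move=> x [Tx|[y Ty <-]]; first by apply: sub_gen; right.
  by apply: (subgroupV HG); apply: sub_gen; right.
have conj F t : with_inverses A F -> with_inverses T t -> H (F * t * F^-1)%g.
  move=> AF Tt; have -> : (F * t * F^-1)%g = ((commutator t F)^-1 * t)%g.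
    by rewrite commutator_inv /commutator mulgVK.
  apply: (subgroupM HG); last exact: TH.
  apply: (subgroupV HG); apply: sub_gen; left; apply: sgn => //.
  by apply: invS AF; exact: subsetUr.
have AT F G : with_inverses A F -> with_inverses A G -> with_inverses T (commutator F G).
  by move=> AF AG; left; apply: sgn => //; exact: invS AG.
have move F : with_inverses A F -> (forall t, with_inverses T t -> (F * t)%g = (t * F)%g) \/
    exists t t', [/\ with_inverses T t, with_inverses T t', t <> 1%g & (F * t * F^-1)%g = t'].
  move=> AF.
  have [com|] := pselect (forall b : U, with_inverses E b -> commutator F b = 1%g).
    left=> t Tt; have comV (x : U) : (F * x)%g = (x * F)%g -> (F * x^-1)%g = (x^-1 * F)%g.
      by move=> e; rewrite -[in LHS](mulKg x F) -e -mulgA mulgK.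
    have comT x : T x -> (F * x)%g = (x * F)%g.
      move=> [a Aa [b Eb <-]].
      have ca : (F * a)%g = (a * F)%g by apply/commutator_eq1/com; exact: invS Aa.
      have cb : (F * b)%g = (b * F)%g by apply/commutator_eq1/com.
      rewrite /commutator !mulgA ca -(mulgA a F) cb !mulgA.
      rewrite -(mulgA _ F) comV // !mulgA -(mulgA _ F) comV // !mulgA //.
    by case: Tt => [/comT|[x /comT e <-]] //; exact: comV.
  move=> /existsNP[b /not_implyP[Eb nb]]; right.
  have e : (F * (commutator F^-1 b)^-1 * F^-1)%g = commutator F b.
    by rewrite commutator_inv /commutator invgK !mulgA mulgK.
  exists (commutator F^-1 b)^-1%g, (commutator F b); split=> //.
  - by apply: (invV); left; apply: sgn => //; exact: invV.
  - by left; exact: sgn.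
  by move=> e1; apply: nb; rewrite -e e1 mulg1 mulgV.
have [X' HX'] := adapted_step HG (adapted_gen HC) TH (fun F => @invV A F) conj AT move.
by exists X'; apply: adapted_sub HX' => x [Tx|Ax]; [right; left | left; left].
Qed.

Lemma pseudo_solvable_derived3 (G : set U) :
  pseudo_solvable G -> derived_subgroup 3 G = [set 1%g].
Proof.
move=> [P [_ <- [N hN]]].
pose E j := if j is k.+1 then iter_commutators P k.+1 `|` iter_commutators P k else P.
have sub j : iter_commutators P j `<=` E j by case: j => [|j] x; [|left].
have step j : iter_commutators P j.+1 = signed_commutators (iter_commutators P j) (E j).
  by case: j.
have base : exists X, adapted (E N.+1) X.
  exists (@euler S); have hE := vf_euler S.
  have E1 x : E N.+1 x -> x = 1%g by case; rewrite hN //; exact: leqnSn.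
  split=> // [|x /E1 ->|x y f /E1 -> /E1 ->].
  - exact: euler_neq0.
  - exact: normalises1.
  - by rewrite !act1g.
have desc j : (exists X, adapted (E j.+2) X) -> exists X, adapted (E j.+1) X.
  move=> [X HX]; rewrite /E [iter_commutators P j.+1]step.
  apply: (@adapted_descent _ (E j) X) => //.
  have -> : signed_commutators (iter_commutators P j) (E j) = iter_commutators P j.+1.
    by rewrite step.
  exact: HX.
have [X HX] : exists X, adapted (E 1%N) X.
  elim: N {hN} base => // N IH h; exact/IH/desc.
apply: (adapted_derived3 (gen_subgroup P) (X := X)).
apply: adapted_sub (adapted_gen HX); apply: gen_sub; first exact: gen_subgroup.
by move=> x Px; apply: sub_gen; right.
Qed.

End Main.

(** * The fraction field of the ring of power series *)

Section Order.
Variable F : fieldType.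
Implicit Types (f g : fps2 F) (m n k : nat).

Definition xord n f := fps2_ord n f /\ ~ fps2_ord n.+1 f.

Lemma xord_ex f : f <> 0 -> exists n, xord n f.
Proof.
move=> f0; apply: contrapT => hn; apply: f0; apply: fps2_ord_eq => n; rewrite subr0.
elim: n => [|n IH] //.
by apply: contrapT => h; apply: hn; exists n.
Qed.

Lemma xord_coef n f : xord n f -> exists2 a, (a <= n)%N /\ f a (n - a)%N <> 0 &
  forall i, (i < a)%N -> f i (n - i)%N = 0.
Proof.
move=> [h1 h2]; pose P a := `[< (a <= n)%N /\ f a (n - a)%N <> 0 >].
have exP : exists a, P a.
  apply: contrapT => hn; apply: h2 => i j hij.
  have [h|h] := ltnP (i + j) n; first exact: h1.
  have e : (i + j)%N = n by lia.
  apply: contrapT => hf; apply: hn; exists i; apply/asboolP; split; first by lia.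
  by rewrite -e addKn.
have := ex_minnP exP => -[a /asboolP ha hmin]; exists a => // i hi.
apply: contrapT => hf; have := hmin i; rewrite leqNgt hi => H.
suff : P i by move/H.
by apply/asboolP; split=> //; case: ha => ha _; lia.
Qed.

(** Initial forms multiply: the product of their terms of least degree in [x] is not
    cancelled by other terms. *)
Lemma xordM m n f g : xord m f -> xord n g -> xord (m + n) (f * g).
Proof.
move=> hf hg; split; first exact: fps2_ordM hf.1 hg.1.
have [a [ha fa] amin] := xord_coef hf; have [c [hc gc] cmin] := xord_coef hg.
move=> /(_ (a + c)%N ((m - a) + (n - c))%N) H.
have : (f * g) (a + c)%N ((m - a) + (n - c))%N = 0 by apply: H; lia.
have ia : (a < (a + c).+1)%N by lia.
have ib : (m - a < ((m - a) + (n - c)).+1)%N by lia.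
rewrite fps2_mulE (bigD1 (Ordinal ia)) //= (bigD1 (Ordinal ib)) //= !addKn.
rewrite big1 ?addr0 => [|j /eqP hj].
  rewrite big1 ?addr0 => [/eqP|i /eqP hi]; first by rewrite mulf_eq0 => /orP[/eqP|/eqP].
  rewrite big1 // => j _.
  have bi := ltn_ord i; have bj := ltn_ord j.
  have hi' : i <> a :> nat by move=> e; apply: hi; exact: val_inj.
  have [h|h] := ltnP (i + j) m; first by rewrite hf.1 ?mul0r.
  have [h'|h'] := ltnP ((a + c - i) + (m - a + (n - c) - j)) n.
    by rewrite (hg.1 _ _ h') mulr0.
  have [ltia|ltai|//] := ltngtP (i : nat) a.
    by rewrite (_ : f i j = 0) ?mul0r // (_ : j = (m - i)%N :> nat) ?amin //; lia.
  rewrite (_ : g (a + c - i)%N _ = 0) ?mulr0 //.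
  rewrite (_ : (m - a + (n - c) - j)%N = (n - (a + c - i))%N) ?cmin //; lia.
have bj := ltn_ord j.
have hj' : j <> (m - a)%N :> nat by move=> e; apply: hj; exact: val_inj.
have [h|h] := ltnP (a + j) m; first by rewrite hf.1 ?mul0r.
by rewrite (hg.1 c) ?mulr0 //; lia.
Qed.

Lemma xord_neq0 n f : xord n f -> f != 0.
Proof. by move=> [_ h]; apply/eqP => e; apply: h => i j _; rewrite e. Qed.

Lemma xord_le m n f : xord m f -> fps2_ord n f -> (n <= m)%N.
Proof.
by move=> [_ h] hn; rewrite leqNgt; apply/negP => hmn; apply: h; exact: fps2_ordW hn.
Qed.

Lemma xord_near n f g : xord n f -> fps2_ord n.+1 (g - f) -> xord n g.
Proof.
move=> [h1 h2] h; split.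
  by rewrite -(subrK f g); apply: fps2_ordD => //; apply: fps2_ordW h.
by move=> hg; apply: h2; rewrite -(subKr g f); exact: fps2_ordB.
Qed.

End Order.

Section Domain.
Variable F : fieldType.

Definition fps2_unit : {pred fps2 F} := fun f => `[< exists g, g * f = 1 >].
Definition fps2_inv (f : fps2 F) : fps2 F :=
  if pselect (exists g, g * f = 1) is left e then projT1 (cid e) else f.

Lemma fps2_mulV : {in fps2_unit, left_inverse 1 fps2_inv *%R}.
Proof.
move=> f /asboolP hf; rewrite /fps2_inv; case: pselect => // e.
exact: projT2 (cid e).
Qed.

Lemma fps2_unitP (f g : fps2 F) : g * f = 1 -> fps2_unit f.
Proof. by move=> e; apply/asboolP; exists g. Qed.

Lemma fps2_inv_out : {in [predC fps2_unit], fps2_inv =1 id}.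
Proof.
move=> f; rewrite inE => /asboolP hf; rewrite /fps2_inv; case: pselect => //.
Qed.

HB.instance Definition _ :=
  GRing.ComNzRing_hasMulInverse.Build (fps2 F) fps2_mulV fps2_unitP fps2_inv_out.

Lemma fps2_integral (f g : fps2 F) : f * g = 0 -> (f == 0) || (g == 0).
Proof.
move=> e; apply/norP => -[/eqP/xord_ex[m hf] /eqP/xord_ex[n hg]].
by have := xord_neq0 (xordM hf hg); rewrite e eqxx.
Qed.

HB.instance Definition _ := GRing.ComUnitRing_isIntegral.Build (fps2 F) fps2_integral.

End Domain.

Section FieldIdentities.
Variable K : fieldType.
Implicit Types (a b n d x y : K).

Lemma quotient_rule a b n d a' b' n' d' : b != 0 -> d != 0 -> a * d = n * b ->
  a' * d + a * d' = n' * b + n * b' ->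
  (a' * b - a * b') / b ^+ 2 = (n' * d - n * d') / d ^+ 2.
Proof.
move=> b0 d0 e e'.
have ea : a = n * b / d by rewrite -e mulfK.
have ea' : a' = (n' * b + n * b' - a * d') / d by rewrite -e' addrK mulfK.
by rewrite ea' ea; field; rewrite b0 d0.
Qed.

Lemma add_fractions a b n d : b != 0 -> d != 0 -> a / b + n / d = (a * d + n * b) / (b * d).
Proof. by move=> b0 d0; field; rewrite b0 d0. Qed.

Lemma quotient_rule_add a b n d a' b' n' d' : b != 0 -> d != 0 ->
  ((a' * d + a * d' + (n' * b + n * b')) * (b * d) - (a * d + n * b) * (b' * d + b * d')) /
    (b * d) ^+ 2 = (a' * b - a * b') / b ^+ 2 + (n' * d - n * d') / d ^+ 2.
Proof. by move=> b0 d0; field; rewrite b0 d0. Qed.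

Lemma quotient_rule_mul a b n d a' b' n' d' : b != 0 -> d != 0 ->
  ((a' * n + a * n') * (b * d) - (a * n) * (b' * d + b * d')) / (b * d) ^+ 2 =
  (a' * b - a * b') / b ^+ 2 * (n / d) + a / b * ((n' * d - n * d') / d ^+ 2).
Proof. by move=> b0 d0; field; rewrite b0 d0. Qed.

Lemma sub_fractions a b n d : b != 0 -> d != 0 -> a / b - n / d = ((a - n) * d - n * (b - d)) / (b * d).
Proof. by move=> b0 d0; field; rewrite b0 d0. Qed.

Lemma near_euler_quotient a b a' b' x y : b != 0 ->
  (a' * b - a * b') / b ^+ 2 - (x - y) * (a / b) =
  ((a' - x * a) * b - a * (b' - y * b)) / b ^+ 2.
Proof. by move=> b0; field; rewrite b0. Qed.

Lemma scale_shift (e w : K) (m k : nat) (n : int) :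
  e - n%:~R * w = (e - (m%:R - k%:R) * w) + (m%:Z - k%:Z - n)%:~R * w.
Proof. by rewrite !intrB -!pmulrn; ring. Qed.

End FieldIdentities.

Section Fractions.
Variable R : idomainType.
Local Notation K := {fraction R}.
Local Notation "x %:F" := (@FracField.tofrac R x).

Lemma frac_decomp (u : K) : exists a b : R, b != 0 /\ u = a%:F / b%:F.
Proof.
elim/quotW: u => x; exists \n_x, \d_x; split; first exact: denom_ratioP.
have d0 : \d_x != 0 by exact: denom_ratioP.
have dF : (\d_x)%:F != 0 :> K by rewrite tofrac_eq0.
apply: (mulIf dF); rewrite divfK //; unlock FracField.tofrac.
rewrite -[LHS]FracField.pi_mul; apply/eqmodP => /=.
rewrite FracField.equivfE /FracField.mulf !numden_Ratio ?oner_neq0 ?mulf_neq0 ?mulr1 ?oner_neq0 //.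
by rewrite mulrC.
Qed.

Definition fnum u := projT1 (cid (frac_decomp u)).
Definition fden u := projT1 (cid (projT2 (cid (frac_decomp u)))).

Lemma fden_neq0 u : fden u != 0.
Proof. exact: (projT2 (cid (projT2 (cid (frac_decomp u))))).1. Qed.

Lemma frac_numden u : u = (fnum u)%:F / (fden u)%:F.
Proof. exact: (projT2 (cid (projT2 (cid (frac_decomp u))))).2. Qed.

Lemma tofrac_inj : injective (@FracField.tofrac R).
Proof. by move=> a b /eqP; rewrite tofrac_eq => /eqP. Qed.

Lemma frac_eq (a b c d : R) : b != 0 -> d != 0 ->
  (a%:F / b%:F = c%:F / d%:F) <-> a * d = c * b.
Proof.
move=> b0 d0; have bF : b%:F != 0 by rewrite tofrac_eq0.
have dF : d%:F != 0 by rewrite tofrac_eq0.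
split=> [e|e].
  apply: tofrac_inj; rewrite !tofracM; apply: (mulIf (invr_neq0 bF)).
  by rewrite mulfK // mulrAC e divfK.
apply: (mulIf bF); rewrite divfK //; apply: (mulIf dF).
by rewrite mulrAC divfK // -!tofracM e.
Qed.

Section Ext.
Variable phi : R -> R.

(** The extension of an injective ring endomorphism to the fraction field. *)
Definition frac_map (u : K) : K := (phi (fnum u))%:F / (phi (fden u))%:F.

Hypothesis phiM : forall a b, phi (a * b) = phi a * phi b.
Hypothesis phi0 : forall a, a != 0 -> phi a != 0.

Lemma frac_mapE a b : b != 0 -> frac_map (a%:F / b%:F) = (phi a)%:F / (phi b)%:F.
Proof.
move=> b0; rewrite /frac_map; set u := a%:F / b%:F.
have d0 := fden_neq0 u; apply/frac_eq; try exact: phi0.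
by rewrite -!phiM; congr phi; apply/frac_eq => //; rewrite -frac_numden.
Qed.

Lemma frac_mapM u w : frac_map (u * w) = frac_map u * frac_map w.
Proof.
have [a [b [b0 ->]]] := frac_decomp u; have [c [d [d0 ->]]] := frac_decomp w.
by rewrite mulrACA -invfM -!tofracM !frac_mapE ?mulf_neq0 // !phiM !tofracM invfM mulrACA.
Qed.

Lemma frac_mapD u w : (forall a b, phi (a + b) = phi a + phi b) ->
  frac_map (u + w) = frac_map u + frac_map w.
Proof.
move=> phiD; have [a [b [b0 ->]]] := frac_decomp u; have [c [d [d0 ->]]] := frac_decomp w.
have F0 e : e != 0 -> e%:F != 0 :> K by rewrite tofrac_eq0.
rewrite add_fractions ?F0 // -!tofracM -tofracD !frac_mapE ?mulf_neq0 //.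
by rewrite phiD !phiM tofracD !tofracM -add_fractions ?F0 // phi0.
Qed.

Lemma frac_map_tofrac a : phi 1 = 1 -> frac_map a%:F = (phi a)%:F.
Proof.
by move=> e; rewrite -[a%:F]divr1 -tofrac1 frac_mapE ?oner_neq0 // e tofrac1 divr1.
Qed.

End Ext.

Section Der.
Variable D : R -> R.

(** The extension of a derivation to the fraction field, by the quotient rule. *)
Definition frac_der (u : K) : K :=
  ((D (fnum u))%:F * (fden u)%:F - (fnum u)%:F * (D (fden u))%:F) / (fden u)%:F ^+ 2.

Hypothesis DM : forall a b, D (a * b) = D a * b + a * D b.

Lemma frac_derE a b : b != 0 ->
  frac_der (a%:F / b%:F) = ((D a)%:F * b%:F - a%:F * (D b)%:F) / b%:F ^+ 2.
Proof.
move=> b0; rewrite /frac_der; set u := a%:F / b%:F.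
set n := fnum u; set d := fden u; have d0 : d != 0 := fden_neq0 u.
have e : a * d = n * b by apply/frac_eq => //; rewrite -frac_numden.
have bF : b%:F != 0 by rewrite tofrac_eq0.
have dF : d%:F != 0 by rewrite tofrac_eq0.
have eF : a%:F * d%:F = n%:F * b%:F by rewrite -!tofracM e.
have : D (a * d) = D (n * b) by rewrite e.
rewrite !DM => /(congr1 (@FracField.tofrac R)); rewrite !tofracD !tofracM => eD.
exact: quotient_rule.
Qed.

Lemma frac_derM u w : frac_der (u * w) = frac_der u * w + u * frac_der w.
Proof.
have [a [b [b0 ->]]] := frac_decomp u; have [c [d [d0 ->]]] := frac_decomp w.
have F0 e : e != 0 -> e%:F != 0 :> K by rewrite tofrac_eq0.
rewrite [in LHS]mulrACA -invfM -!tofracM !frac_derE ?mulf_neq0 //.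
by rewrite !DM !tofracD !tofracM; apply: quotient_rule_mul; exact: F0.
Qed.

Lemma frac_derD u w : (forall a b, D (a + b) = D a + D b) ->
  frac_der (u + w) = frac_der u + frac_der w.
Proof.
move=> DD; have [a [b [b0 ->]]] := frac_decomp u; have [c [d [d0 ->]]] := frac_decomp w.
have F0 e : e != 0 -> e%:F != 0 :> K by rewrite tofrac_eq0.
rewrite add_fractions ?F0 // -!tofracM -tofracD !frac_derE ?mulf_neq0 //.
by rewrite DD !DM !tofracD !tofracM; apply: quotient_rule_add; exact: F0.
Qed.

Lemma frac_der_tofrac a : D 1 = 0 -> frac_der a%:F = (D a)%:F.
Proof.
move=> e; rewrite -[in LHS](divr1 a%:F) -tofrac1 frac_derE ?oner_neq0 //.
by rewrite e tofrac1 tofrac0 mulr0 subr0 mulr1 expr1n divr1.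
Qed.

End Der.

End Fractions.

Section FractionOrder.
Variable F : fieldType.
Hypothesis char0 : forall k, k.+1%:R != 0 :> F.
Local Notation R := (fps2 F).
Local Notation K := {fraction (fps2 F)}.
Local Notation "x %:F" := (@FracField.tofrac (fps2 F) x).
Implicit Types (a b c d : R) (u w : K).

Definition frac_ge (n : int) (u : K) := exists a b (m k : nat),
  [/\ xord k b, fps2_ord m a, u = a%:F / b%:F & n + k%:Z <= m%:Z].

Lemma frac_geE n a b k : xord k b -> frac_ge n (a%:F / b%:F) ->
  forall p : nat, p%:Z <= n + k%:Z -> fps2_ord p a.
Proof.
move=> hb [a' [b' [m' [k' [hb' ha' /frac_eq e hn]]]]] p hp.
have {}e := e (xord_neq0 hb) (xord_neq0 hb').
have [->|/eqP/xord_ex[q hq]] := eqVneq a 0; first by move=> i j _; rewrite fps2_0E.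
have h := xord_le (xordM hq hb'); rewrite e in h.
have := h _ (fps2_ordM ha' hb.1) => hq'.
by apply: fps2_ordW hq.1; lia.
Qed.

Lemma frac_ge_tofrac (n : nat) a : fps2_ord n a -> frac_ge n%:Z a%:F.
Proof.
move=> ha; exists a, 1, n, 0%N; split=> //; last by rewrite addr0.
  split=> // /(_ 0%N 0%N isT) /eqP; rewrite oner_eq0 //.
by rewrite tofrac1 divr1.
Qed.

Lemma frac_ge_le m n u : m <= n -> frac_ge n u -> frac_ge m u.
Proof.
by move=> h [a [b [p [k [hb ha e hn]]]]]; exists a, b, p, k; split=> //; lia.
Qed.

Lemma xord1 : xord 0 (1 : R).
Proof. by split=> // /(_ 0%N 0%N isT) /eqP; rewrite oner_eq0. Qed.

Lemma frac_ge0 n : frac_ge n 0.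
Proof.
exists 0, 1, `|n|%N, 0%N; split; [exact: xord1 | by move=> i j _; rewrite fps2_0E | | by lia].
by rewrite tofrac0 mul0r.
Qed.

Lemma frac_geD n u w : frac_ge n u -> frac_ge n w -> frac_ge n (u + w).
Proof.
move=> [a [b [m [k [hb ha -> hn]]]]] [a' [b' [m' [k' [hb' ha' -> hn']]]]].
have bF : b%:F != 0 by rewrite tofrac_eq0; exact: xord_neq0 hb.
have bF' : b'%:F != 0 by rewrite tofrac_eq0; exact: xord_neq0 hb'.
exists (a * b' + a' * b), (b * b'), (minn (m + k') (m' + k)), (k + k')%N; split.
- exact: xordM.
- apply: fps2_ordD; [apply: fps2_ordW (fps2_ordM ha hb'.1) | apply: fps2_ordW (fps2_ordM ha' hb.1)].
    exact: geq_minl.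
  exact: geq_minr.
- by rewrite add_fractions // tofracD !tofracM.
by lia.
Qed.

Lemma frac_geN n u : frac_ge n u -> frac_ge n (- u).
Proof.
move=> [a [b [m [k [hb ha -> hn]]]]]; exists (- a), b, m, k; split=> //.
  exact: fps2_ordN.
by rewrite tofracN mulNr.
Qed.

Lemma frac_geM m n u w : frac_ge m u -> frac_ge n w -> frac_ge (m + n) (u * w).
Proof.
move=> [a [b [p [k [hb ha -> hn]]]]] [a' [b' [p' [k' [hb' ha' -> hn']]]]].
exists (a * a'), (b * b'), (p + p')%N, (k + k')%N; split.
- exact: xordM.
- exact: fps2_ordM.
- by rewrite !tofracM invfM mulrACA.
by lia.
Qed.

Lemma fps2_nat00 k : (k%:R : R) 0%N 0%N = k%:R.
Proof. by elim: k => [|k IH]; rewrite ?fps2_0E // !mulrS fps2_addE IH. Qed.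

Lemma xord_nat k : xord 0 (k.+1%:R : R).
Proof.
split=> // /(_ 0%N 0%N isT); rewrite fps2_nat00 => e.
by have := char0 k; rewrite e eqxx.
Qed.

Lemma tofrac_nat k : (k%:R : R)%:F = k%:R.
Proof. exact: (rmorph_nat (@FracField.tofrac (fps2 F))). Qed.

Definition frac_filtration : filtration K.
Proof.
apply: (@Filtration K frac_ge).
- exact: frac_ge_le.
- exact: frac_ge0.
- exact: frac_geD.
- exact: frac_geN.
- exact: frac_geM.
- by rewrite -tofrac1; apply: (@frac_ge_tofrac 0).
- move=> k; exists 1, k.+1%:R, 0%N, 0%N; split=> //; first exact: xord_nat.
  by rewrite tofrac1 tofrac_nat mul1r.
- by move=> k; rewrite -tofrac_nat tofrac_eq0; exact: xord_neq0 (xord_nat k).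
- move=> u h; have [a [b [b0 e]]] := frac_decomp u.
  have [k hb] := xord_ex (elimN eqP b0); rewrite e in h *.
  suff -> : a = 0 by rewrite tofrac0 mul0r.
  by apply: fps2_ord_eq => n; rewrite subr0; apply: (frac_geE hb (h n%:Z)); lia.
move=> u u0; have [a [b [b0 e]]] := frac_decomp u.
have a0 : a != 0 by apply: contraNneq u0 => a0; rewrite e a0 tofrac0 mul0r.
have [k hb] := xord_ex (elimN eqP b0); have [m ha] := xord_ex (elimN eqP a0).
exists (m%:Z - k%:Z); split; [exists a, b, m, k | exists b, a, k, m]; split=> //.
- exact: ha.1.
- lia.
- exact: hb.1.
- by rewrite e invfM invrK mulrC.
- lia.
Defined.

End FractionOrder.

(** * Formal diffeomorphisms *)

Section Diffeos.
Variable F : fieldType.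
Hypothesis char0 : forall k, k.+1%:R != 0 :> F.
Local Notation R := (fps2 F).
Local Notation K := {fraction (fps2 F)}.
Local Notation "x %:F" := (@FracField.tofrac (fps2 F) x).
Local Notation v := (frac_filtration char0).
Implicit Types (f a b c : R) (u w : K) (g h : diff1 F) (n m k : nat).

(** Composition with the inverse, so that the group acts on the left. *)
Definition pull g f : R := fps2_comp f (diff1_val g^-1%g).

Lemma pull_nocst g : fps2_nocst (diff1_val g).
Proof. exact: tangent_nocst (diff1_tangent g). Qed.

Lemma pullD g a b : pull g (a + b) = pull g a + pull g b.
Proof. exact: fps2_compD. Qed.

Lemma pullM g a b : pull g (a * b) = pull g a * pull g b.
Proof. by apply: fps2_compM; exact: pull_nocst. Qed.

Lemma pull1 g : pull g 1 = 1.
Proof. by apply: fps2_comp1; exact: pull_nocst. Qed.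

Lemma pull_cst g (c : F) : pull g (fps2_cst c) = fps2_cst c.
Proof. by apply: fps2_comp_cst; exact: pull_nocst. Qed.

Lemma pull_id a : pull 1%g a = a.
Proof. by rewrite /pull invg1; exact: fps2_comp_id. Qed.

Lemma pull_mulg g h a : pull (g * h)%g a = pull g (pull h a).
Proof. by rewrite /pull invgM fps2_compA //; exact: pull_nocst. Qed.

Lemma pull_neq0 g a : a != 0 -> pull g a != 0.
Proof.
apply: contraNneq => e; apply/eqP; rewrite -(pull_id a) -(mulVg g) pull_mulg e.
exact: fps2_comp0.
Qed.

Lemma pull_near g n a : fps2_ord n a -> fps2_ord n.+1 (pull g a - a).
Proof.
by move=> h; apply: fps2_ord_sym; apply: fps2_diff_ord => //; exact: diff1_tangent.
Qed.

Definition dact g : K -> K := frac_map (pull g).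

Lemma dactE g a b : b != 0 -> dact g (a%:F / b%:F) = (pull g a)%:F / (pull g b)%:F.
Proof. by apply: frac_mapE; [exact: pullM | exact: pull_neq0]. Qed.

Lemma dact_tofrac g a : dact g a%:F = (pull g a)%:F.
Proof.
by apply: frac_map_tofrac; [exact: pullM | exact: pull_neq0 | exact: pull1].
Qed.

Lemma dactD g u w : dact g (u + w) = dact g u + dact g w.
Proof. by apply: frac_mapD; [exact: pullM | exact: pull_neq0 | exact: pullD]. Qed.

Lemma dactM g u w : dact g (u * w) = dact g u * dact g w.
Proof. by apply: frac_mapM; [exact: pullM | exact: pull_neq0]. Qed.

Lemma dact_id u : dact 1%g u = u.
Proof. by have [a [b [b0 ->]]] := frac_decomp u; rewrite (dactE _ a b0) !pull_id. Qed.

Lemma dact_mulg g h u : dact (g * h)%g u = dact g (dact h u).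
Proof.
have [a [b [b0 ->]]] := frac_decomp u.
rewrite (dactE h a b0) (dactE g (pull h a) (pull_neq0 h b0)) (dactE (g * h)%g a b0).
by rewrite !pull_mulg.
Qed.

Lemma dact_near g (n : int) u : v n u -> v (n + 1) (dact g u - u).
Proof.
move=> [a [b [m [k [hb ha -> hn]]]]]; have b0 := xord_neq0 hb.
have hb' : xord k (pull g b) by apply: (xord_near hb); apply: pull_near; exact: hb.1.
have tn0 c : c != 0 -> c%:F != 0 by rewrite tofrac_eq0.
rewrite (dactE g a b0) sub_fractions ?tn0 ?pull_neq0 // -!(tofracB, tofracM).
exists ((pull g a - a) * b - a * (pull g b - b)), (pull g b * b), (m + k).+1, (k + k)%N.
split=> //; [exact: xordM | | lia].
apply: fps2_ordB; first by rewrite -addSn; apply: fps2_ordM; [exact: pull_near | exact: hb.1].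
by rewrite -addnS; apply: fps2_ordM => //; apply: pull_near; exact: hb.1.
Qed.

Lemma dact_faithful g : (forall u, dact g u = u) -> g = 1%g.
Proof.
move=> e; have eR a : pull g a = a by apply: tofrac_inj; rewrite -dact_tofrac.
suff h : (g^-1)%g = 1%g by rewrite -[g]invgK h invg1.
apply: diff1_inj; have ex := eR (fps2_x F); have ey := eR (fps2_y F).
rewrite /pull fps2_comp_x in ex; last exact: pull_nocst.
rewrite /pull fps2_comp_y in ey; last exact: pull_nocst.
by rewrite [LHS]surjective_pairing ex ey.
Qed.

Definition constant u := exists c : F, u = (fps2_cst c)%:F.

Lemma dact_constant g u : constant u -> dact g u = u.
Proof. by move=> [c ->]; rewrite dact_tofrac pull_cst. Qed.

(** The coefficients of degree [d] of the terms of index [k > d] vanish, since each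
    application of [g - 1] raises the order. *)
Definition fps2_log g f : R := fun i j =>
  \sum_(k < (i + j).+1) logcoef F k * iter k (fun a => pull g a - a) f i j.

Lemma iter_pull_ord g n k f : fps2_ord n f -> fps2_ord (n + k) (iter k (fun a => pull g a - a) f).
Proof.
move=> hf; elim: k => [|k IH]; first by rewrite addn0.
by rewrite addnS; exact: pull_near.
Qed.

Lemma fps2_log_trunc g n f : fps2_ord n
  (fps2_log g f - \sum_(k < n) fps2_cst (logcoef F k) * iter k (fun a => pull g a - a) f).
Proof.
move=> i j h; rewrite fps2_addE fps2_oppE fps2_sumE /fps2_log.
apply/eqP; rewrite subr_eq0; apply/eqP.
rewrite (big_ord_widen n (fun k => logcoef F k * iter k (fun a => pull g a - a) f i j)) //.
rewrite big_mkcond; apply: eq_bigr => k _; rewrite fps2_cstM; case: ltnP => // hk.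
by rewrite (@iter_pull_ord g 0 k f) ?mulr0 //; rewrite add0n.
Qed.

Lemma tofrac_logcoef k : (fps2_cst (logcoef F k))%:F = logcoef K k.
Proof. exact: (logcoef_rmorph ((@FracField.tofrac (fps2 F)) \o (@fps2_cst F))). Qed.

Lemma dact_log_tofrac g f : lim v (log_seq (dact g) f%:F) (fps2_log g f)%:F.
Proof.
move=> n; exists `|n|%N => m hm.
have -> : log_seq (dact g) f%:F m =
    (\sum_(k < m) fps2_cst (logcoef F k) * iter k (fun a => pull g a - a) f)%:F.
  rewrite /log_seq rmorph_sum; apply: eq_bigr => k _; rewrite -tofrac_logcoef.
  rewrite rmorphM; congr (_ * _); elim: (k : nat) => //= l ->.
  by rewrite dact_tofrac tofracB.
rewrite -tofracB; apply: (@ge_le _ v _ m%:Z); first by lia.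
by apply: frac_ge_tofrac; exact: fps2_log_trunc.
Qed.

Lemma dact_log_frac g u : exists a b : K, [/\ b != 0, u = a / b,
  exists e, lim v (log_seq (dact g) a) e & exists e, lim v (log_seq (dact g) b) e].
Proof.
have [a [b [b0 ->]]] := frac_decomp u; exists a%:F, b%:F; split=> //.
- by rewrite tofrac_eq0.
- by eexists; exact: dact_log_tofrac.
- by eexists; exact: dact_log_tofrac.
Qed.

(** By the derivation rule the field vanishes on polynomials, by continuity on power series,
    and by the quotient rule on fractions. *)
Lemma vf_eq0 (X : K -> K) : vf v constant X ->
  X (fps2_x F)%:F = 0 -> X (fps2_y F)%:F = 0 -> forall u, X u = 0.
Proof.
move=> hX Xx Xy.
have X0 : X 0 = 0 by apply: (addrI (X 0)); rewrite -(vfD hX) !addr0.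
have X1 : X 1 = 0.
  apply: (vf_scal hX); exists 1; rewrite rmorph1; exact/esym/tofrac1.
have XX w k : X w = 0 -> X (w ^+ k) = 0.
  move=> e; elim: k => [|k IH]; first by rewrite expr0.
  by rewrite exprS (vfM hX) e IH mul0r mulr0 addr0.
have Xsum I (r : seq I) (P : pred I) (G : I -> K) :
    (forall i, X (G i) = 0) -> X (\sum_(i <- r | P i) G i) = 0.
  by move=> e; elim/big_rec: _ => // i x _ ex; rewrite (vfD hX) e ex addr0.
have Xpoly p : X (fps2_of_poly p)%:F = 0.
  rewrite -(fps2_comp_id (fps2_of_poly p)) fps2_comp_of_poly; last exact: fps2_id_nocst.
  have [n [h1 h2]] := fps2_size_bound p; rewrite (fps2_evE _ h1 h2) /=.
  rewrite rmorph_sum; apply: (Xsum) => i; rewrite rmorph_sum; apply: (Xsum) => j.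
  rewrite /= !tofracM !tofracXn (vfM hX) (vfM hX) !XX // !(mul0r, mulr0) !addr0.
  by rewrite (vf_scal hX) ?mul0r ?mulr0 ?addr0 //; eexists.
have XR a : X a%:F = 0.
  have [b hb] := vf_raises hX; apply: (@ge_sep _ v) => n.
  pose N := `|(n - b)%R|%N.
  rewrite -(subrK (fps2_of_poly (fps2_trunc N a)) a) tofracD (vfD hX) Xpoly addr0.
  have := hb N%:Z _ (frac_ge_tofrac (fps2_trunc_ord (n := N) a)).
  by apply: ge_le; rewrite /N; lia.
move=> u; have [a [b [b0 e]]] := frac_decomp u.
have bF : b%:F != 0 :> K by rewrite tofrac_eq0.
apply: (mulIf bF); rewrite mul0r; have := XR a.
have -> : a%:F = u * b%:F by rewrite e divfK.
by rewrite (vfM hX) XR mulr0 addr0.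
Qed.

Definition fps2_euler f : R := fun i j => (i + j)%:R * f i j.

Lemma fps2_eulerD a b : fps2_euler (a + b) = fps2_euler a + fps2_euler b.
Proof. by apply: fps2P => i j; rewrite !fps2_addE /fps2_euler fps2_addE mulrDr. Qed.

Lemma fps2_eulerM a b : fps2_euler (a * b) = fps2_euler a * b + a * fps2_euler b.
Proof.
apply: fps2P => i j; rewrite fps2_addE /fps2_euler !fps2_mulE mulr_sumr -big_split.
apply: eq_bigr => k _; rewrite mulr_sumr -big_split; apply: eq_bigr => l _ /=.
have -> : (i + j = (k + l) + ((i - k) + (j - l)))%N.
  by have := ltn_ord k; have := ltn_ord l; lia.
by rewrite natrD mulrDl mulrA [in X in _ + X]mulrCA.
Qed.

Lemma fps2_euler_near n a : fps2_ord n a -> fps2_ord n.+1 (fps2_euler a - n%:R * a).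
Proof.
move=> h i j hij; rewrite fps2_addE fps2_oppE -(rmorph_nat (@fps2_cst F)) fps2_cstM.
rewrite /fps2_euler -mulrBl; have [lt|ge] := ltnP (i + j) n; first by rewrite h // mulr0.
by rewrite (_ : (i + j)%N = n) ?subrr ?mul0r //; lia.
Qed.

Lemma fps2_euler_cst (c : F) : fps2_euler (fps2_cst c) = 0.
Proof.
apply: fps2P => i j; rewrite /fps2_euler fps2_0E -[fps2_cst c]mulr1 fps2_cstM.
by case: i j => [|i] [|j]; rewrite ?mul0r // mulr0 mulr0.
Qed.

Definition frac_euler : K -> K := frac_der fps2_euler.

Lemma frac_euler_near (n : int) u : v n u -> v (n + 1) (frac_euler u - n%:~R * u).
Proof.
move=> [a [b [m [k [hb ha -> hn]]]]]; have b0 := xord_neq0 hb.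
have bF : b%:F != 0 :> K by rewrite tofrac_eq0.
set w := a%:F / b%:F.
have hw : v (m%:Z - k%:Z) w by exists a, b, m, k; split=> //; lia.
have H : v (m%:Z - k%:Z + 1) (frac_euler w - (m%:R - k%:R) * w).
  rewrite /frac_euler frac_derE //; last exact: fps2_eulerM.
  rewrite near_euler_quotient // -!tofrac_nat -tofracXn -!(tofracM, tofracB).
  exists ((fps2_euler a - m%:R * a) * b - a * (fps2_euler b - k%:R * b)), (b ^+ 2).
  exists (m + k).+1, (k + k)%N; split=> //; [by rewrite expr2; exact: xordM | | lia].
  apply: fps2_ordB; first by rewrite -addSn; apply: fps2_ordM; [exact: fps2_euler_near | exact: hb.1].
  by rewrite -addnS; apply: fps2_ordM => //; apply: fps2_euler_near; exact: hb.1.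
rewrite (scale_shift _ _ m k).
apply: geD; first by apply: ge_le H; lia.
have [e|ne] := eqVneq (m%:Z - k%:Z) n; first by rewrite e subrr mul0r; exact: ge0.
apply: (@ge_le _ v _ (m%:Z - k%:Z)); first by lia.
apply: geMl => //.
case: (m%:Z - k%:Z - n) => l; first exact: ge_nat.
by rewrite NegzE mulrNz; apply: geN; exact: ge_nat.
Qed.

Lemma fps2_euler1 : fps2_euler 1 = 0.
Proof. by rewrite -(rmorph1 (@fps2_cst F)) fps2_euler_cst. Qed.

Lemma vf_frac_euler : vf v constant frac_euler.
Proof.
split.
- by move=> u w; apply: frac_derD; [exact: fps2_eulerM | exact: fps2_eulerD].
- by move=> u w; apply: frac_derM; exact: fps2_eulerM.
- move=> u [c ->]; rewrite /frac_euler frac_der_tofrac ?fps2_euler_cst ?tofrac0 //.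
    exact: fps2_eulerM.
  exact: fps2_euler1.
exists 0 => n u hu; rewrite addr0 -(subrK (n%:~R * u) (frac_euler u)).
apply: geD; first by apply: ge_le (frac_euler_near hu); lia.
apply: geMl => //; case: n {hu} => l; first exact: ge_nat.
by rewrite NegzE mulrNz; apply: geN; exact: ge_nat.
Qed.

Lemma frac_euler_neq0 : exists u, frac_euler u != 0.
Proof.
exists (fps2_x F)%:F.
have -> : frac_euler (fps2_x F)%:F = (fps2_euler (fps2_x F))%:F.
  exact: (frac_der_tofrac fps2_eulerM _ fps2_euler1).
rewrite tofrac_eq0; apply/eqP => /(congr1 (fun f : R => f 1%N 0%N)).
rewrite /fps2_euler /fps2_x /= mulr1 fps2_0E => /eqP.
by rewrite oner_eq0.
Qed.

Definition diff1_setting : setting :=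
  @Setting K v constant (diff1 F : groupType) dact dactD dactM dact_id dact_mulg
    dact_constant dact_near dact_faithful dact_log_frac
    (fps2_x F)%:F (fps2_y F)%:F vf_eq0 frac_euler vf_frac_euler frac_euler_near frac_euler_neq0.

End Diffeos.

Theorem theorem2p5 (R : realType) (G : set (diff1 (complex R))) :
  subgroup G -> pseudo_solvable G -> solvable_group G.
Proof.
move=> _ hG; exists 3%N.
have char0 k : k.+1%:R != 0 :> complex R by rewrite pnatr_eq0.
exact: (@pseudo_solvable_derived3 (diff1_setting char0) G hG).
Qed.
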